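(* Let $\Omega\subset\mathbb{R}^3$ be a bounded domain with smooth boundary $\Gamma$. Let $\boldsymbol J^-$ be a vector field on $\Omega$ and $\boldsymbol B^{\mathrm{in}}$ a vector field given on $\Gamma$, and suppose that $\boldsymbol B^-$ (on $\Omega$) and $\boldsymbol B^+$ (on $\mathbb{R}^3\setminus\overline{\Omega}$), each continuous up to $\Gamma$ from its own side, solve the transmission problem $$\nabla\times\boldsymbol B^-=\boldsymbol J^-,\quad \nabla\cdot\boldsymbol B^-=0\quad\text{in }\Omega,$$ $$\nabla\times\boldsymbol B^+=0,\quad \nabla\cdot\boldsymbol B^+=0\quad\text{in }\mathbb{R}^3\setminus\overline{\Omega},\qquad |\boldsymbol B^+(\boldsymbol x)|=O(|\boldsymbol x|^{-1})\ \text{as } |\boldsymbol x|\to\infty,$$ $$\boldsymbol B^--\boldsymbol B^+=\boldsymbol B^{\mathrm{in}}\quad\text{on }\Gamma.$$ If $\boldsymbol B^{\mathrm{in}}$ extends to $\Omega$ as a solution of $\nabla\times\boldsymbol B^{\mathrm{in}}=0$, $\nabla\cdot\boldsymbol B^{\mathrm{in}}=0$, then for every $\boldsymbol x\in\mathbb{R}^3\setminus\overline\Omega$, $$\boldsymbol B^+(\boldsymbol x)=\nabla\times\int_{\Omega}\frac{\boldsymbol J^-(\boldsymbol y)}{4\pi|\boldsymbol x-\boldsymbol y|}\,dV(\boldsymbol y).$$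
   Context: All fields are classical: they are regular enough in the closures of the regions in which they are defined for the differential equations, the boundary values on $\Gamma$ and the volume integral to make classical sense (e.g. $C^1$ up to $\Gamma$ from the side on which they are defined). The values of $\boldsymbol B^\pm$ on $\Gamma$ are limits from the respective sides, and ''extends to $\Omega$'' means that there is a field in $\Omega$ solving the stated equations whose boundary values on $\Gamma$ are the given $\boldsymbol B^{\mathrm{in}}$. *)

(* Defs.v *)
(* MathComp-Analysis, over an arbitrary [R : realType]. *)
From HB Require Import structures.
From mathcomp Require Import all_boot all_order all_algebra.
From mathcomp Require Import all_classical all_reals all_analysis.

Set Implicit Arguments.
Unset Strict Implicit.
Unset Printing Implicit Defensive.

Import Order.TTheory GRing.Theory Num.Theory.
Import numFieldNormedType.Exports.

Local Open Scope classical_set_scope.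
Local Open Scope ring_scope.

(* The library norm on ['rV[R]_n] is the sup norm: it induces the usual
   topology and bounded sets, but is not the Euclidean length. *)
Definition enorm (R : realType) n (x : 'rV[R]_n) : R :=
  Num.sqrt (\sum_(i < n) x 0 i ^+ 2).

Definition partial (R : realType) n (W : normedModType R) (j : 'I_n)
    (F : 'rV[R]_n -> W) (x : 'rV[R]_n) : W :=
  'D_(delta_mx 0 j) F x.

(* Intended for open [U] only. *)
Definition C1_on (R : realType) n (W : normedModType R) (U : set 'rV[R]_n)
    (F : 'rV[R]_n -> W) : Prop :=
  forall (j : 'I_n) (x : 'rV[R]_n), U x ->
    derivable F x (delta_mx 0 j) /\ {for x, continuous (partial j F)}.

Fixpoint Ck (R : realType) n (k : nat) (f : 'rV[R]_n -> R) : Prop :=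
  continuous f /\
  if k is k'.+1 then
    forall j : 'I_n,
      (forall x, derivable f x (delta_mx 0 j)) /\ Ck k' (partial j f)
  else True.

Definition smooth (R : realType) n (f : 'rV[R]_n -> R) : Prop :=
  forall k, Ck k f.

Definition boundary (T : topologicalType) (A : set T) : set T :=
  closure A `\` A°.

(* Near each boundary point, after relabelling and reorienting the axes, the
   set is the epigraph of a smooth function of the other two coordinates:
   [i] is the distinguished axis, [s] its orientation, and [col' i x] drops
   the coordinate [i]. *)
Definition smooth_boundary (R : realType) (Omega : set 'rV[R]_3) : Prop :=
  forall p, boundary Omega p ->
    exists (i : 'I_3) (s : bool) (gamma : 'rV[R]_2 -> R),
      smooth gamma /\
      \forall x \near p,
        Omega x <-> gamma (col' i x) < (-1) ^+ s * x 0 i.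

Definition bounded_smooth_domain (R : realType) (Omega : set 'rV[R]_3) : Prop :=
  [/\ open Omega, connected Omega, Omega !=set0,
      bounded_set Omega & smooth_boundary Omega].

Definition exterior (T : topologicalType) (A : set T) : set T := ~` closure A.

(* Indices are in the ring ['I_3] of integers modulo 3:
   [(curl F)_i = d_(i+1) F_(i+2) - d_(i+2) F_(i+1)]. *)
Definition curl (R : realType) (F : 'rV[R]_3 -> 'rV[R]_3) (x : 'rV[R]_3) :
    'rV[R]_3 :=
  \row_(i < 3) (partial (i + 1) F x 0 (i + 2) - partial (i + 2) F x 0 (i + 1)).

Definition divergence (R : realType) (F : 'rV[R]_3 -> 'rV[R]_3) (x : 'rV[R]_3) : R :=
  \sum_(i < 3) partial i F x 0 i.

Definition curl_div_solution (R : realType) (U : set 'rV[R]_3)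
    (F J : 'rV[R]_3 -> 'rV[R]_3) : Prop :=
  C1_on U F /\ forall x, U x -> curl F x = J x /\ divergence F x = 0.

(* Volume integration is with respect to the product Lebesgue measure on
   [R * R * R], transported along [vec3]; ['rV[R]_3] itself carries no
   measurable structure in the library. *)
Definition vec3 (R : realType) (y : R * R * R) : 'rV[R]_3 :=
  \row_(i < 3) [:: y.1.1; y.1.2; y.2]`_i.

Definition leb3 (R : realType) :=
  (((@lebesgue_measure R) \x (@lebesgue_measure R)) \x
     (@lebesgue_measure R))%E.

Definition vol_integrable (R : realType) (U : set 'rV[R]_3)
    (f : 'rV[R]_3 -> R) : Prop :=
  (@leb3 R).-integrable (@vec3 R @^-1` U) (fun y => (f (vec3 y))%:E).

Definition vol_integral (R : realType) (U : set 'rV[R]_3)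
    (f : 'rV[R]_3 -> R) : R :=
  \int[@leb3 R]_(y in @vec3 R @^-1` U) f (vec3 y).

Definition vector_potential (R : realType) (Omega : set 'rV[R]_3)
    (J : 'rV[R]_3 -> 'rV[R]_3) (x : 'rV[R]_3) : 'rV[R]_3 :=
  \row_(i < 3)
    vol_integral Omega (fun y => J y 0 i / (4 * pi * enorm (x - y))).

(* Main.v *)
From HB Require Import structures.
Require Import Defs.
From mathcomp Require Import all_boot all_order all_algebra.
From mathcomp Require Import all_classical all_reals all_analysis.
From mathcomp Require Import measurable_realfun ring lra.
Import Order.TTheory GRing.Theory Num.Theory.
Import numFieldNormedType.Exports.
Local Open Scope classical_set_scope.
Local Open Scope ring_scope.
Set Implicit Arguments.
Unset Strict Implicit.
Unset Printing Implicit Defensive.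

(** Subtract the extension of B^in from B^- inside Omega and keep B^+ outside.
    By the jump condition the glued field V is continuous on the whole space.
    Off the boundary it is C1, divergence-free, and its curl is J^- in Omega
    and 0 outside; at infinity it is O(1/|x|).  Such a field is the
    Biot-Savart field of its curl, which is the claim.

    The representation is obtained at each exterior point p by a direct
    computation with the regularized kernel 1/w, w(y) = sqrt(e^2 + |y - p|^2).
    With g = grad(1/w), the fields
      H_j = V_k g_j + V_j g_k - delta_jk (V . g)
    have, off the boundary and because div V = 0, the divergence
      sum_j (d_j V_k - d_k V_j) g_j - V_k rho,   rho = 3 e^2 / w^5.
    It integrates to zero over the whole space (Rintegral_divergence_K), so
    the integral of V_k rho equals that of sum_j (d_j V_k - d_k V_j) g_j,
    which involves only J^- on Omega.  Since rho has mass 4 pi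
    (integral_newton) and concentrates at p, letting e tend to 0 gives
    newton_representation: 4 pi V_k(p) is an integral of J^- against the
    gradient of 1/|p - y|.

    The vanishing of the integral needs a divergence theorem for fields that
    are continuous across the boundary but whose derivatives may blow up or
    jump there; only the divergence is known to be integrable.  Near a point
    of the boundary, which is a graph x_i = G(x), such a field is multiplied by
    cut((x_i - G)/e), a function that vanishes in a thin layer around the graph
    and is 1 further away.  The product is C1 with compact support, so its
    divergence has integral zero.  The error term contains the derivative of
    the cut-off, of size 1/e in a layer of width of order e, but this
    derivative integrates to zero across the layer on every line parallel to
    the axis i; by uniform continuity of the field the error tends to 0
    (layer_flux, Rintegral_div_graph).  Finitely many bump functions reduce the
    general case to this one (Rintegral_div0), and the decay of V allows a
    further cut-off at infinity.

    Finally, p has a positive distance to Omega, so 1/|p - y| has a first-order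
    expansion in p with a remainder that is quadratic uniformly in y in Omega.
    This makes the potential differentiable at p, with derivatives under the
    integral sign (vector_potential_differentiable), and the representation of
    V_k(p) becomes the k-th component of its curl. *)

(** * Integrals of bounded functions of bounded support *)

Section boundedSupport.
Context d1 d2 (T1 : measurableType d1) (T2 : measurableType d2) (R : realType).
Variables (m1 : {sigma_finite_measure set T1 -> \bar R})
          (m2 : {sigma_finite_measure set T2 -> \bar R}).

Lemma bounded_support_integrable d (T : measurableType d)
    (m : {measure set T -> \bar R}) (A : set T) (f : T -> R) (M : R) :
  measurable A -> (m A < +oo)%E -> measurable_fun setT f ->
  (forall x, `|f x| <= M) -> (forall x, ~ A x -> f x = 0) ->
  m.-integrable setT (EFin \o f).
Proof.
move=> mA fA mf fM f0.
have -> : EFin \o f = (EFin \o f) \_ A.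
  apply/funext => x; rewrite patchE /=; case: ifPn => // /negP xA.
  by rewrite f0// => Ax; apply: xA; rewrite inE.
apply: (integrable_mkcond _ mA).1.
apply: (measurable_bounded_integrable mA fA); first exact: measurable_funTS.
exists M; split; first exact: num_real.
by move=> y My x _ /=; rewrite (le_trans (fM x))// ltW.
Qed.

Lemma bounded_support_Rintegral d (T : measurableType d)
    (m : {measure set T -> \bar R}) (A : set T) (f : T -> R) (c : R) :
  measurable A -> (m A < +oo)%E -> measurable_fun setT f ->
  (forall x, `|f x| <= c) -> (forall x, ~ A x -> f x = 0) ->
  `|\int[m]_x f x| <= c * fine (m A).
Proof.
move=> mA fA mf fM f0.
have fi := bounded_support_integrable mA fA mf fM f0.
apply: le_trans (le_normr_Rintegral _ fi) _ => //.
have -> : \int[m]_t `|f t| = \int[m]_(t in A) `|f t|.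
  rewrite [RHS]Rintegral_mkcond; apply: eq_Rintegral => x _.
  rewrite patchE; case: ifPn => // /negP xA.
  by rewrite f0 ?normr0// => Ax; apply: xA; rewrite inE.
rewrite -Rintegral_cst//; apply: le_Rintegral => //.
- by apply: (integrableS measurableT) => //; exact: integrable_norm.
- apply: measurable_bounded_integrable => //.
  exists `|c|; split; first exact: num_real.
  by move=> y My x _ /=; rewrite ltW.
Qed.

Lemma bounded_support_fubini (A : set T1) (B : set T2) (f : T1 * T2 -> R) M :
  measurable A -> measurable B -> (m1 A < +oo)%E -> (m2 B < +oo)%E ->
  measurable_fun setT f -> (forall x, `|f x| <= M) ->
  (forall x, ~ (A x.1 /\ B x.2) -> f x = 0) ->
  [/\ measurable_fun setT (fun x => \int[m2]_y f (x, y)),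
      measurable_fun setT (fun y => \int[m1]_x f (x, y)),
      \int[(m1 \x m2)%E]_z f z = \int[m1]_x \int[m2]_y f (x, y) &
      \int[(m1 \x m2)%E]_z f z = \int[m2]_y \int[m1]_x f (x, y)].
Proof.
move=> mA mB fA fB mf fM f0.
have mAB : measurable (A `*` B) by exact: measurableX.
have fAB : ((m1 \x m2)%E (A `*` B) < +oo)%E.
  rewrite product_measure1E//; apply: lte_mul_pinfty => //.
  by rewrite ge0_fin_numE.
have fi : (m1 \x m2)%E.-integrable setT (EFin \o f).
  by apply: (bounded_support_integrable mAB) => //.
have fi1 x : m2.-integrable setT (EFin \o (fun y => f (x, y))).
  apply: (bounded_support_integrable mB) => //.
    exact: (measurableT_comp mf (pair1_measurable x)).
  by move=> y By; apply: f0 => -[].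
have fi2 y : m1.-integrable setT (EFin \o (fun x => f (x, y))).
  apply: (bounded_support_integrable mA) => //.
    exact: (measurableT_comp mf (pair2_measurable y)).
  by move=> x Ax; apply: f0 => -[].
have E1 : (fun x => (\int[m2]_y f (x, y))%:E) =
   @fubini_F _ _ T1 T2 R m2 (EFin \o f).
  apply/funext => x; rewrite /fubini_F /Rintegral fineK//.
  exact: (integrable_fin_num measurableT (fi1 x)).
have E2 : (fun y => (\int[m1]_x f (x, y))%:E) =
   @fubini_G _ _ T1 T2 R m1 (EFin \o f).
  apply/funext => y; rewrite /fubini_G /Rintegral fineK//.
  exact: (integrable_fin_num measurableT (fi2 y)).
split.
- by apply/measurable_EFinP; rewrite /comp E1; exact: measurable_fubini_F fi.
- by apply/measurable_EFinP; rewrite /comp E2; exact: measurable_fubini_G fi.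
- rewrite {1}/Rintegral -(integral12_prod_meas1 fi) -E1 //.
- rewrite {1}/Rintegral -(integral21_prod_meas1 fi) -E2 //.
Qed.

End boundedSupport.

(** * Lebesgue measure on three-space *)

Section plane.
Variable R : realType.
Local Notation mu := (@lebesgue_measure R).

(** The inner factor of [leb3].  Naming it gives it its own sigma-finiteness, on
    which Fubini on the triple product depends. *)
Definition leb2 : set (measurableTypeR R * measurableTypeR R) -> \bar R :=
  (mu \x mu)%E.

HB.instance Definition _ := Measure.on leb2.

Let leb2_sigma_finite : sigma_finite setT leb2.
Proof.
have /sigma_finiteP[F [TF ndF Foo]] := sigma_finiteT mu.
exists (fun n => F n `*` F n).
  rewrite -setXTT {1 2}TF predeqE => -[x y]; split.
    move=> [/= [n _ Fnx] [k _ Fky]]; exists (maxn n k) => //; split.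
    - by move: x Fnx; exact/subsetPset/ndF/leq_maxl.
    - by move: y Fky; exact/subsetPset/ndF/leq_maxr.
  by move=> [n _ []/= ? ?]; split; exists n.
move=> k; have [mF muF] := Foo k.
split; first exact: measurableX.
by rewrite /leb2 product_measure1E// lte_mul_pinfty// ge0_fin_numE.
Qed.

HB.instance Definition _ := @Measure_isSigmaFinite.Build _ _ _ leb2
  leb2_sigma_finite.

End plane.

(** Convertible to [leb3], with the inner product measure named. *)
Notation mu3 R := (@leb2 R \x @lebesgue_measure R)%E.

Section space.
Variable R : realType.
Local Notation mu := (@lebesgue_measure R).
Implicit Types (f : 'rV[R]_3 -> R).

Definition upd (x : 'rV[R]_3) (i : 'I_3) (t : R) : 'rV[R]_3 :=
  \row_j if j == i then t else x 0 j.

Lemma vec3E (y : R * R * R) (i : 'I_3) :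
  vec3 y 0 i = [:: y.1.1; y.1.2; y.2]`_i.
Proof. by rewrite mxE. Qed.

Lemma ord3_ind (P : 'I_3 -> Prop) : P 0 -> P 1 -> P 2 -> forall i, P i.
Proof.
move=> P0 P1 P2 [[|[|[|//]]] hi].
- by rewrite (_ : Ordinal hi = 0)//; apply/val_inj.
- by rewrite (_ : Ordinal hi = 1)//; apply/val_inj.
- by rewrite (_ : Ordinal hi = 2)//; apply/val_inj.
Qed.

Lemma measurable_coord (i : 'I_3) :
  measurable_fun setT (fun y : R * R * R => vec3 y 0 i).
Proof.
case: i => -[|[|[|//]]] hi; under eq_fun do rewrite vec3E /=.
- exact: (measurableT_comp measurable_fst measurable_fst).
- exact: (measurableT_comp measurable_snd measurable_fst).
- exact: measurable_snd.
Qed.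

Lemma norm_rV_lt n (x : 'rV[R]_n.+1) e : (`|x| < e) <-> (forall i, `|x 0 i| < e).
Proof.
split=> [xe i|xe].
  apply: le_lt_trans xe; rewrite [leRHS]/Num.norm/= mx_normrE.
  by apply: (le_bigmax _ _ (0, i)).
rewrite [ltLHS]/Num.norm/= mx_normrE; apply: bigmax_lt.
  by apply: le_lt_trans (xe ord0).
by move=> [i j] _; rewrite (ord1 i)/=.
Qed.

Lemma norm_rV_le n (x : 'rV[R]_n) e : 0 <= e -> (`|x| <= e) <-> (forall i, `|x 0 i| <= e).
Proof.
move=> e0; split=> [xe i|xe].
  apply: le_trans xe; rewrite [leRHS]/Num.norm/= mx_normrE.
  by apply: (le_bigmax _ _ (0, i)).
rewrite [leLHS]/Num.norm/= mx_normrE; apply: bigmax_le => //.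
by move=> [i j] _; rewrite (ord1 i)/=.
Qed.

Lemma coord_le_norm n (x : 'rV[R]_n) i : `|x 0 i| <= `|x|.
Proof. by move: i; apply/norm_rV_le. Qed.

Lemma measurable_vec3_ball (x : 'rV[R]_3) (e : R) : measurable (@vec3 R @^-1` ball x e).
Proof.
have -> : @vec3 R @^-1` ball x e =
  \bigcap_(i in [set: 'I_3]) ((fun y : R * R * R => vec3 y 0 i) @^-1` (ball (x 0 i) e)).
  apply/seteqP; split => y /=.
    rewrite -ball_normE /= => /norm_rV_lt h i _.
    by rewrite /= -ball_normE /=; have := h i; rewrite !mxE.
  move=> h; rewrite -ball_normE /=; apply/norm_rV_lt => i.
  by have := h i I; rewrite /= -ball_normE /= !mxE.
apply: fin_bigcap_measurable => // i _.
by rewrite -[X in measurable X]setTI; exact: measurable_coord (measurable_ball _ _).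
Qed.

(** An open set is the countable union of the balls with rational centre and
    radius that it contains. *)
Lemma open_vec3_measurable (U : set 'rV[R]_3) : open U ->
  measurable (@vec3 R @^-1` U).
Proof.
move=> oU.
pose c (q : rat * rat * rat) : 'rV[R]_3 := vec3 (ratr q.1.1, ratr q.1.2, ratr q.2).
pose B (q : rat * rat * rat * rat) := ball (c q.1) (ratr q.2 : R).
have -> : U = \bigcup_q (if `[< B q `<=` U >] then B q else set0).
  apply/seteqP; split=> [x Ux|x [q _]]; last first.
    by case: asboolP => // BU /BU.
  have [e /= e0 eU] : exists2 e : R, 0 < e & ball x e `<=` U.
    exact/nbhs_ballP/open_nbhs_nbhs.
  have [r] := rat_in_itvoo (divr_gt0 e0 (ltr0n R 2)).
  rewrite in_itv /= => /andP[r0 re].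
  have near_rat (t : R) : exists q : rat, `|ratr q - t| < ratr r.
    have [q] := @rat_in_itvoo R (t - ratr r) (t + ratr r) ltac:(lra).
    by rewrite in_itv /= => /andP[q1 q2]; exists q; rewrite ltr_distl q1.
  have [[q0 h0] [q1 h1] [q2 h2]] := And3 (near_rat (x 0 0)) (near_rat (x 0 1)) (near_rat (x 0 2)).
  exists (q0, q1, q2, r) => //=.
  have Bx : B (q0, q1, q2, r) x.
    rewrite /B -ball_normE /=; apply/norm_rV_lt.
    by apply: ord3_ind; rewrite !mxE.
  case: asboolP => // -[] y By; apply: eU.
  move: Bx By; rewrite /B -!ball_normE /= => Bx By.
  rewrite -(subrKA (c (q0, q1, q2))) (le_lt_trans (ler_normD _ _))// distrC.
  lra.
rewrite preimage_bigcup.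
refine (countable_bigcupT_measurable _ _) => [|q]; first exact: countableP.
case: asboolP => _; first exact: measurable_vec3_ball.
by rewrite preimage_set0.
Qed.

Lemma closed_vec3_measurable (A : set 'rV[R]_3) : closed A ->
  measurable (@vec3 R @^-1` A).
Proof.
move=> cA; rewrite -(setCK A) -preimage_setC; apply: measurableC.
by exact: open_vec3_measurable (closed_openC cA).
Qed.

Lemma open_continuous_vec3_measurable (U : set 'rV[R]_3) f : open U ->
  {in U, continuous f} -> measurable_fun (@vec3 R @^-1` U) (f \o @vec3 R).
Proof.
move=> oU cf mD; apply: (measurability _ (RGenOInfty.measurableE R)) => //.
move=> _ [_ [a ->] <-].
suff oV : open (U `&` f @^-1` `]a, +oo[%classic) by exact: open_vec3_measurable oV.
rewrite openE => x [Ux fx]; apply: filterI; first exact: open_nbhs_nbhs.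
apply: cf; first by rewrite inE.
exact: open_nbhs_nbhs.
Qed.

Lemma continuous_vec3_measurable f : continuous f ->
  measurable_fun setT (f \o @vec3 R).
Proof.
move=> cf; rewrite -(preimage_setT (@vec3 R)).
by apply: open_continuous_vec3_measurable; [exact: openT | move=> x _; exact: cf].
Qed.

Lemma upd_vec3 (y : R * R * R) (t : R) :
  [/\ upd (vec3 y) 0 t = vec3 (t, y.1.2, y.2),
      upd (vec3 y) 1 t = vec3 (y.1.1, t, y.2) &
      upd (vec3 y) 2 t = vec3 (y.1.1, y.1.2, t)].
Proof. by split; apply/rowP; apply: ord3_ind; rewrite !mxE. Qed.

(** Fubini, integrating first along the axis [i].  For [c = 0] this turns facts
    about single lines into vanishing integrals and null sets; for [c > 0] it
    bounds the flux through a thin layer transverse to the axis. *)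
Lemma line_bound (f : 'rV[R]_3 -> R) (L M c : R) (i : 'I_3) :
  0 <= L -> 0 <= c ->
  measurable_fun setT (f \o @vec3 R) -> (forall x, `|f x| <= M) ->
  (forall x, L < `|x| -> f x = 0) ->
  (forall x, `|\int[@lebesgue_measure R]_t f (upd x i t)| <= c) ->
  `|\int[mu3 R]_y f (vec3 y)| <= c * (2 * L) ^+ 2.
Proof.
move=> L0 c0 mf fM f0 fc.
pose A : set R := `[- L, L]%classic.
have mA : measurable A by exact: measurable_itv.
have muA : mu A = (2 * L)%:E.
  rewrite /A lebesgue_measure_itv /= lte_fin.
  by case: ltP => h; rewrite ?EFinN -?EFinD; congr (_%:E); lra.
have fA : (mu A < +oo)%E by rewrite muA ltry.
have nA t : ~ A t -> L < `|t|.
  rewrite /A /= in_itv /= -ler_norml => /negP.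
  by rewrite -ltNge.
pose g y := f (vec3 y).
have g0 y : ~ ((A `*` A) y.1 /\ A y.2) -> g y = 0.
  move=> h; apply: f0; apply: contrapT => /negP; rewrite -leNgt => yL.
  have {}yL k := le_trans (coord_le_norm _ k) yL.
  apply: h; move: (yL 0) (yL 1) (yL 2); rewrite !mxE /=.
  by rewrite /A /setX /= !in_itv /= -!ler_norml.
have mAA : measurable (A `*` A) by exact: measurableX.
have EAA : @leb2 R (A `*` A) = ((2 * L)^+2)%:E.
  rewrite /leb2 product_measure1E// expr2 EFinM; by congr (_ * _)%E.
have fAA : (@leb2 R (A `*` A) < +oo)%E by rewrite EAA ltry.
have [m1 m2 e1 e2] := bounded_support_fubini (m1 := @leb2 R) (m2 := mu)
  mAA mA fAA fA mf (fun x => fM _) g0.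
have bound1 (h : R -> R) k : measurable_fun setT h -> (forall t, `|h t| <= k) ->
    (forall t, ~ A t -> h t = 0) -> `|\int[mu]_t h t| <= k * (2 * L).
  move=> mh hk h0; have := bounded_support_Rintegral (m := mu) mA fA mh hk h0.
  by move/le_trans; apply; rewrite (congr1 fine muA).
have int0 (h : R -> R) : (forall t, h t = 0) -> \int[mu]_t h t = 0.
  move=> h0; rewrite (_ : h = cst 0); last exact/funext.
  by rewrite Rintegral_cst// mul0r.
have slice z : [/\ measurable_fun setT (fun x => \int[mu]_y g ((x, y), z)),
      measurable_fun setT (fun y => \int[mu]_x g ((x, y), z)),
      \int[@leb2 R]_p g (p, z) = \int[mu]_x \int[mu]_y g ((x, y), z) &
      \int[@leb2 R]_p g (p, z) = \int[mu]_y \int[mu]_x g ((x, y), z)].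
  apply: (bounded_support_fubini (m1 := mu) (m2 := mu) (M := M) mA mA fA fA).
  - exact: (measurableT_comp mf (pair2_measurable z)).
  - by move=> p; exact: fM.
  - by move=> p pA; apply: (g0) => -[[? ?] _]; apply: pA.
move: i fc; apply: ord3_ind => fc.
- rewrite e2 expr2 mulrA; apply: (bound1) => // z.
  + have [_ mz _ ->] := slice z; apply: (bound1) => // y.
    * have := fc (vec3 (0, y, z)).
      by under eq_Rintegral => t _ do have [-> _ _] := upd_vec3 (0, y, z) t.
    * by move=> Ay; apply: (int0) => x; apply: (g0) => -[[]].
  + move=> Az; have [_ mz _ ->] := slice z.
    by apply: (int0) => y; apply: (int0) => x; apply: (g0) => -[].
- rewrite e2 expr2 mulrA; apply: (bound1) => // z.
  + have [mz _ -> _] := slice z; apply: (bound1) => // x.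
    * have := fc (vec3 (x, 0, z)).
      by under eq_Rintegral => t _ do have [_ -> _] := upd_vec3 (x, 0, z) t.
    * by move=> Ay; apply: (int0) => y; apply: (g0) => -[[]].
  + move=> Az; have [_ mz _ ->] := slice z.
    by apply: (int0) => y; apply: (int0) => x; apply: (g0) => -[].
- rewrite e1.
  have := bounded_support_Rintegral (m := @leb2 R) mAA fAA (c := c) m1.
  rewrite (congr1 fine EAA); apply => p.
  + have := fc (vec3 (p, 0)).
    by under eq_Rintegral => t _ do have [_ _ ->] := upd_vec3 (p, 0) t; case: p.
  + by move=> Ap; apply: (int0) => z; apply: (g0) => -[].
Qed.

End space.

(** * Directional derivatives and compact supports *)

Section calculus.
Variable R : realType.
Local Notation mu := (@lebesgue_measure R).

(** A directional derivative depends only on the restriction to a line, so it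
    can be computed along any line of another space on which the functions agree. *)
Lemma is_derive_along (V W : normedModType R) (F : V -> R) (G : W -> R)
    (a v : V) (b w : W) (d : R) :
  (forall h, F (h *: v + a) = G (h *: w + b)) ->
  is_derive b w G d -> is_derive a v F d.
Proof.
move=> FG [dG eG].
have E : (fun h : R => h^-1 *: ((F \o shift a) (h *: v) - F a)) =
         (fun h : R => h^-1 *: ((G \o shift b) (h *: w) - G b)).
  have FGa : F a = G b by have := FG 0; rewrite !scale0r !add0r.
  by apply/funext => h /=; rewrite FG FGa.
by split; [rewrite /derivable E | rewrite /derive E].
Qed.

Lemma is_derive_comp (V : normedModType R) (f : R -> R) (g : V -> R) a v p q :
  is_derive (g a) (1 : R) f p -> is_derive a v g q ->
  is_derive a v (f \o g) (p * q).
Proof.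
move=> fp gq.
apply: (@is_derive_along _ _ _ (f \o (fun t : R => g (t *: v + a))) _ _ 0 1).
  by move=> h /=; rewrite addr0 scaler1.
apply: is_derive1_comp; first by rewrite scale0r add0r.
apply: (@is_derive_along _ _ _ g _ _ a v) => // h /=.
by rewrite addr0 scaler1.
Qed.

Lemma upd_line (x : 'rV[R]_3) i h t :
  upd x i (h *: (1 : R) + t) = h *: delta_mx 0 i + upd x i t.
Proof.
apply/rowP => j; rewrite !mxE eqxx /=.
by case: (j == i) => /=; rewrite ?mulr0 ?add0r.
Qed.

Lemma is_derive_upd (f : 'rV[R]_3 -> R) x i t d :
  is_derive (upd x i t) (delta_mx 0 i) f d ->
  is_derive t (1 : R) (fun t => f (upd x i t)) d.
Proof. by apply: is_derive_along => h; rewrite upd_line. Qed.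

Lemma upd_continuous (x : 'rV[R]_3) i : continuous (upd x i).
Proof.
move=> t; apply/cvgrPdist_lt => e e0; near=> s.
apply/norm_rV_lt => j; rewrite !mxE; case: eqP => _; last by rewrite subrr normr0.
by near: s; apply: cvgr_dist_lt.
Unshelve. all: by end_near. Qed.

Lemma far_near (V : normedModType R) (x : V) L :
  L < `|x| -> \forall y \near x, L < `|y|.
Proof.
move=> xL; have : `|y| @[y --> x] --> `|x| by apply: cvg_norm; exact: cvg_id.
by move/cvgr_gt; apply.
Qed.

Lemma derive_far0 (V : normedModType R) (f : V -> R) x v d L :
  (forall x, L < `|x| -> f x = 0) -> L < `|x| -> is_derive x v f d -> d = 0.
Proof.
move=> f0 xL fd.
have f00 : \forall y \near x, f y = cst 0 y.
  by near=> y; rewrite f0//; near: y; exact: far_near.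
by have [_ <-] := near_eq_is_derive f00 fd; rewrite derive_cst.
Unshelve. all: by end_near. Qed.

Lemma integral_derive0 (g g' : R -> R) L : (forall t, is_derive t (1 : R) g (g' t)) ->
  continuous g' -> (forall t, L < `|t| -> g t = 0) -> \int[mu]_t g' t = 0.
Proof.
move=> dg cg' g0.
have g'0 t : L < `|t| -> g' t = 0.
  move=> tL; exact: (derive_far0 g0 tL (dg t)).
pose b := `|L| + 1.
have bL : L < `|b|.
  rewrite ger0_norm ?addr_ge0//; apply: le_lt_trans (ler_norm _) _; rewrite ltrDl//.
have b0 : 0 < b by rewrite /b ltr_wpDl.
have -> : \int[mu]_t g' t = \int[mu]_(t in `[- b, b]) g' t.
  rewrite [RHS]Rintegral_mkcond; apply: eq_Rintegral => t _.
  rewrite patchE; case: ifPn => //; rewrite notin_setE /= in_itv /= -ler_norml => /negP.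
  rewrite -ltNge => bt; apply: g'0; apply: lt_trans bt.
  by rewrite -(gtr0_norm b0).
have Nbb : - b < b by rewrite gtrN.
rewrite /Rintegral (@continuous_FTC2 _ _ g _ _ Nbb).
- by rewrite !g0 ?normrN// -EFinB subrr.
- exact: continuous_subspaceT.
- have cg t : {for t, continuous g}.
    apply: differentiable_continuous; apply/derivable1_diffP; by have [] := dg t.
  split.
  + by move=> x _; by have [] := dg x.
  + by apply: cvg_at_right_filter; exact: cg.
  + by apply: cvg_at_left_filter; exact: cg.
- by move=> x _; rewrite derive1E; have [] := dg x.
Qed.

Lemma closed_norm_le n (L : R) : closed [set x : 'rV[R]_n | `|x| <= L].
Proof.
apply: (@closed_comp _ _ (fun x : 'rV[R]_n => `|x|) [set t | t <= L]).
  by move=> x _; exact: norm_continuous.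
exact: closed_le.
Qed.

Lemma closure_norm_le n (A : set 'rV[R]_n) (L : R) :
  (forall x, A x -> `|x| <= L) -> forall x, closure A x -> `|x| <= L.
Proof.
move=> AL; suff : closure A `<=` [set x : 'rV[R]_n | `|x| <= L] by [].
by rewrite [X in _ `<=` X](iffLR (closure_id _) (@closed_norm_le n L)); exact: closureS.
Qed.

Lemma compact_closed_ball_rV n (L : R) : compact [set x : 'rV[R]_n | `|x| <= L].
Proof.
apply: bounded_closed_compact.
  exists L; split; first exact: num_real.
  by move=> M LM x /= xL; rewrite (le_trans xL)// ltW.
exact: closed_norm_le.
Qed.

Lemma bounded_on_compact (T : topologicalType) (K : set T) (f : T -> R) :
  compact K -> {within K, continuous f} ->
  exists2 M, 0 <= M & forall x, K x -> `|f x| <= M.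
Proof.
move=> cK cf.
have /compact_bounded[M [_ fM]] := continuous_compact cf cK.
exists (`|M| + 1); first by rewrite addr_ge0.
move=> x Kx; apply: fM; last by exists x.
by rewrite (le_lt_trans (ler_norm M))// ltrDl.
Qed.

Lemma compact_support_bounded n (f : 'rV[R]_n -> R) L : continuous f ->
  (forall x, L < `|x| -> f x = 0) -> exists2 M, 0 <= M & forall x, `|f x| <= M.
Proof.
move=> cf f0.
have [M M0 fM] := bounded_on_compact (@compact_closed_ball_rV n L)
  (continuous_subspaceT cf).
exists M => // x; case: (lerP `|x| L) => xL; first exact: fM.
by rewrite f0// normr0.
Qed.

(** Heine-Cantor on the ball of radius [L + 1]; a point outside this ball is at
    distance at least 1 from the support. *)
Lemma compact_support_uniform n (f : 'rV[R]_n -> R) L e : continuous f ->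
  (forall x, L < `|x| -> f x = 0) -> 0 < e ->
  \forall d \near 0^'+, forall x y, `|x - y| <= d -> `|f x - f y| <= e.
Proof.
move=> cf f0 e0.
have /compact_near_coveringP cK := @compact_closed_ball_rV n (L + 1).
have H : forall x : 'rV[R]_n, [set x | `|x| <= L + 1] x ->
    \forall x' \near x & d \near 0^'+,
      forall y, `|x' - y| <= d -> `|f x' - f y| <= e.
  move=> x _.
  have : \forall z \near x, `|f x - f z| < e / 2.
    by have := cf x; move=> /cvgr_dist_lt; apply; rewrite divr_gt0.
  move=> /nbhs_ballP[r /= r0 xr].
  exists (ball x (r / 2), [set d | d < r / 2]) => /=.
    split; first by apply: nbhsx_ballx; rewrite divr_gt0.
    by apply: nbhs_right_lt; rewrite divr_gt0.
  move=> [x' d] /= [xx' dr] y x'y.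
  have h1 : `|f x - f x'| < e / 2.
    by apply: xr; apply: le_ball xx'; rewrite ler_pdivrMr// ler_peMr// ?ler1n// ltW.
  have h2 : `|f x - f y| < e / 2.
    apply: xr; move: xx'; rewrite -!ball_normE /= => xx'.
    rewrite -(subrKA x') (le_lt_trans (ler_normD _ _))//; lra.
  rewrite -(subrKA (f x)) (le_trans (ler_normD _ _))// (distrC (f x')); lra.
have {cK}H := cK R (0 : R)^'+ (fun d x => forall y, `|x - y| <= d -> `|f x - f y| <= e) _ H.
near=> d => x y xy.
case: (lerP `|x| (L + 1)) => xL.
  by move: x xL y xy; near: d; exact: H.
rewrite f0 ?f0 ?subrr ?normr0 ?(ltW e0)//; last by apply: lt_trans xL; rewrite ltrDl.
have d1 : d < 1 by near: d; exact: nbhs_right_lt.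
have := ler_normB y x; rewrite distrC.
have := ler_normD y (x - y); rewrite subrKC; lra.
Unshelve. all: by end_near. Qed.

(** On each line along the axis [i] the fundamental theorem of calculus gives 0,
    and [line_bound] with [c = 0] integrates this over the lines. *)
Lemma Rintegral_partial0 (f D : 'rV[R]_3 -> R) i L : 0 <= L ->
  (forall x, is_derive x (delta_mx 0 i) f (D x)) -> continuous D ->
  (forall x, L < `|x| -> f x = 0) -> \int[mu3 R]_y D (vec3 y) = 0.
Proof.
move=> L0 fD cD f0.
have D0 x : L < `|x| -> D x = 0 by move=> xL; exact: (derive_far0 f0 xL (fD x)).
have [M _ DM] := compact_support_bounded cD D0.
apply/eqP; rewrite -normr_le0 -(mul0r ((2 * L) ^+ 2)).
apply: (line_bound (i := i) L0 _ _ DM D0) => //.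
  exact: continuous_vec3_measurable.
move=> x; rewrite normr_le0; apply/eqP.
apply: (@integral_derive0 (fun t => f (upd x i t)) _ L).
- by move=> t; apply: is_derive_upd; exact: fD.
- move=> t; apply: continuous_comp; [exact: upd_continuous | exact: cD].
- move=> t tL; apply: f0; apply: lt_le_trans tL _.
  by have := coord_le_norm (upd x i t) i; rewrite mxE eqxx.
Qed.

End calculus.

(** * Dominated convergence and a C1 step *)

Section dct.
Context d (T : measurableType d) (R : realType) (m : {measure set T -> \bar R}).

Lemma Rdominated_cvg (f_ : nat -> T -> R) (f g : T -> R) :
  (forall n, measurable_fun setT (f_ n)) -> measurable_fun setT f ->
  {ae m, forall x, f_ ^~ x @ \oo --> f x} ->
  m.-integrable setT (EFin \o g) -> (forall n x, `|f_ n x| <= g x) ->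
  \int[m]_x f_ n x @[n --> \oo] --> \int[m]_x f x.
Proof.
move=> mf_ mf cf ig fg.
have fi n : m.-integrable setT (EFin \o f_ n).
  apply: le_integrable ig => //; first by apply/measurable_EFinP.
  by move=> x _; rewrite /= lee_fin (le_trans (fg n x))// ler_norm.
have [if_ _ H] := @dominated_convergence _ _ _ m setT measurableT
  (fun n => EFin \o f_ n) (EFin \o f) (EFin \o g)
  (fun n => (measurable_EFinP _ _).2 (mf_ n)) ((measurable_EFinP _ _).2 mf)
  ltac:(by apply: filterS cf => x h _; apply/cvg_EFin; [exact: nearW | exact: h])
  ig ltac:(by apply: aeW => x n _; rewrite lee_fin).
have fE (F : T -> R) : m.-integrable setT (EFin \o F) ->
    (\int[m]_x F x)%:E = (\int[m]_x (F x)%:E)%E.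
  by move=> iF; rewrite fineK//; exact: integrable_fin_num.
apply: fine_cvg; rewrite -/(Rintegral _ _ _) fE//.
Qed.

End dct.

Section step.
Variable R : realType.

Definition ramp (t : R) := (t + `|t|) / 2.

(** A C1 transition from 0 on the negative half-line to 1 beyond 2: its
    derivative [dstep] is the hat function on [0, 2] with peak 1 at 1. *)
Definition step (t : R) :=
  (ramp t ^+ 2 - 2 * ramp (t - 1) ^+ 2 + ramp (t - 2) ^+ 2) / 2.

Definition dstep (t : R) := ramp t - 2 * ramp (t - 1) + ramp (t - 2).

Lemma ramp_continuous : continuous ramp.
Proof.
by move=> t; apply: cvgM; [apply: cvgD; [exact: cvg_id | exact: norm_continuous] | exact: cvg_cst].
Qed.

Lemma ramp_ge0 t : 0 <= t -> ramp t = t.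
Proof. by move=> t0; rewrite /ramp ger0_norm//; lra. Qed.

Lemma ramp_le0 t : t <= 0 -> ramp t = 0.
Proof. by move=> t0; rewrite /ramp ler0_norm//; lra. Qed.

Lemma is_derive_ramp2 t :
  is_derive t (1 : R) (fun t => ramp t ^+ 2) (2 * ramp t).
Proof.
have [t0|t0|->] := ltgtP t 0.
- apply: (@near_eq_is_derive _ _ _ (cst 0)).
    near=> s; rewrite /= ramp_le0 ?expr0n//; near: s.
    by apply: filterS (lt_nbhsl t0) => s /ltW.
  by rewrite ramp_le0 ?ltW// mulr0; exact: is_derive_cst.
- apply: (@near_eq_is_derive _ R R (fun s => s ^+ 2)).
    near=> s; rewrite /= ramp_ge0//; near: s.
    by apply: filterS (lt_nbhsr t0) => s /ltW.
  rewrite ramp_ge0 ?ltW//.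
  by apply: is_derive_eq; rewrite /GRing.scale /=; ring.
- suff H : (fun h : R => h^-1 *: (((fun t => ramp t ^+ 2) \o shift 0) (h *: 1) - ramp 0 ^+ 2)) @ 0^' --> (2 * ramp 0 : R).
    by split; [apply/cvg_ex; eexists; exact: H | apply/cvg_lim => //; exact: H].
  rewrite ramp_ge0// mulr0.
  have r0 : ramp h @[h --> 0^'] --> (0 : R).
    rewrite -[X in _ --> X](ramp_ge0 (lexx 0)).
    by move/continuous_withinNx: (@ramp_continuous 0).
  apply: cvg_trans r0; apply: near_eq_cvg; near=> h.
  have h0 : h != 0 by near: h; exact: nbhs_dnbhs_neq.
  rewrite /= addr0 /GRing.scale /= mulr1 expr0n /= subr0.
  have [h1|h1] := leP 0 h; first by rewrite ramp_ge0//; field.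
  by rewrite ramp_le0 ?ltW// expr0n /= mulr0.
Unshelve. all: by end_near. Qed.

Lemma is_derive_step t : is_derive t (1 : R) step (dstep t).
Proof.
have sh c : is_derive t (1 : R) (fun t => ramp (t - c) ^+ 2) (2 * ramp (t - c)).
  rewrite -[X in is_derive _ _ _ X]mulr1.
  apply: (@is_derive_comp _ _ (fun t => ramp t ^+ 2) (fun t => t - c)).
    exact: is_derive_ramp2.
  by apply: is_derive_eq; rewrite subr0.
have -> : step = (2^-1 : R) *: ((fun t => ramp t ^+ 2) - 2 *: (fun t => ramp (t - 1) ^+ 2) + (fun t => ramp (t - 2) ^+ 2)).
  by apply/funext => s; rewrite /step !fctE /= /GRing.scale /=; field.
have := is_derive_ramp2 t; have := sh 1; have := sh 2 => h2 h1 h0.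
by apply: is_derive_eq; rewrite /GRing.scale /= /dstep; field.
Qed.

Lemma dstep_continuous : continuous dstep.
Proof.
have sh c : continuous (fun t : R => ramp (t - c)).
  move=> t; apply: (@continuous_comp _ _ _ (fun t => t - c) ramp); last exact: ramp_continuous.
  by apply: cvgB; [exact: cvg_id | exact: cvg_cst].
move=> t; apply: cvgD; last exact: sh.
apply: cvgB; first exact: ramp_continuous.
by apply: cvgM; [exact: cvg_cst | exact: sh].
Qed.

Lemma step_le0 t : t <= 0 -> step t = 0.
Proof. by move=> t0; rewrite /step !ramp_le0; lra. Qed.

Lemma step_ge2 t : 2 <= t -> step t = 1.
Proof. by move=> t2; rewrite /step !ramp_ge0; lra. Qed.

Lemma dstep_le0 t : t <= 0 -> dstep t = 0.
Proof. by move=> t0; rewrite /dstep !ramp_le0; lra. Qed.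

Lemma dstep_ge2 t : 2 <= t -> dstep t = 0.
Proof. by move=> t2; rewrite /dstep !ramp_ge0; lra. Qed.

Lemma dstep_bound t : 0 <= dstep t <= 1.
Proof.
rewrite /dstep /ramp.
by case: (ger0P t) => h0; case: (ger0P (t - 1)) => h1; case: (ger0P (t - 2)) => h2; lra.
Qed.

Lemma step_bound t : 0 <= step t <= 1.
Proof.
have [h0|h0] := leP t 0; first by rewrite step_le0//; lra.
have [h2|h2] := leP 2 t; first by rewrite step_ge2//; lra.
have -> : step t = (t ^+ 2 - 2 * ramp (t - 1) ^+ 2) / 2.
  by rewrite /step (@ramp_ge0 t) ?ltW// (@ramp_le0 (t - 2)) ?expr0n ?addr0//; lra.
have [h1|h1] := leP 1 t.
  by rewrite ramp_ge0; [nra | lra].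
by rewrite ramp_le0; [nra | lra].
Qed.

End step.

(** * Pointwise calculus rules, integrability and null sets *)

Lemma near_infty_natS (R : realType) (r : R) : \forall n \near \oo, r < n.+1%:R.
Proof.
by apply: filterS (nbhs_infty_gtr r) => n /lt_trans; apply; rewrite ltr_nat.
Qed.

(* The rules are stated for lambda-abstractions, at a point, so that they apply
   by unification to explicit formulas. *)
Section continuity_rules.
Context (R : realType) (T : topologicalType).
Implicit Types (f g : T -> R) (x : T).

Lemma cont_at f : (forall x, {for x, continuous f}) -> continuous f.
Proof. by []. Qed.

Lemma cont_add f g x : {for x, continuous f} -> {for x, continuous g} ->
  {for x, continuous (fun y => f y + g y)}.
Proof. by move=> cf cg; apply: cvgD. Qed.

Lemma cont_sub f g x : {for x, continuous f} -> {for x, continuous g} ->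
  {for x, continuous (fun y => f y - g y)}.
Proof. by move=> cf cg; apply: cvgB. Qed.

Lemma cont_mul f g x : {for x, continuous f} -> {for x, continuous g} ->
  {for x, continuous (fun y => f y * g y)}.
Proof. by move=> cf cg; apply: cvgM. Qed.

Lemma cont_cst (c : R) x : {for x, continuous (fun=> c)}.
Proof. exact: cvg_cst. Qed.

Lemma cont_comp (U W : topologicalType) (h : U -> W) (f : T -> U) x :
  {for x, continuous f} -> {for f x, continuous h} ->
  {for x, continuous (fun y => h (f y))}.
Proof. by move=> cf ch; exact: (@continuous_comp _ _ _ f h). Qed.

Lemma cont_sum n (f : 'I_n -> T -> R) x :
  (forall j, {for x, continuous (f j)}) ->
  {for x, continuous (fun y => \sum_(j < n) f j y)}.
Proof.
elim: n f => [|n IH] f cf.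
  have -> : (fun y => \sum_(j < 0) f j y) = (fun=> 0).
    by apply/funext => y; rewrite big_ord0.
  exact: cont_cst.
have -> : (fun y => \sum_(j < n.+1) f j y) =
   (fun y => \sum_(j < n) f (widen_ord (leqnSn n) j) y + f ord_max y).
  by apply/funext => y; rewrite big_ord_recr.
by apply: cont_add; [exact: (IH (fun j => f _)) | exact: cf].
Qed.

Lemma cont_near f g x : (\forall y \near x, f y = g y) ->
  {for x, continuous f} -> {for x, continuous g}.
Proof.
move=> fg cf; have fgx := nbhs_singleton fg.
by rewrite /prop_for /continuous_at -fgx; apply: cvg_trans cf; exact: near_eq_cvg.
Qed.

End continuity_rules.

Section derive_rules.
Context (R : realType) (V : normedModType R).
Implicit Types (f g : V -> R) (x v : V).

Lemma is_derive_mul f g x v a b : is_derive x v f a -> is_derive x v g b ->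
  is_derive x v (fun y => f y * g y) (a * g x + f x * b).
Proof.
move=> fa gb; have H := is_deriveM fa gb.
by rewrite addrC [a * _]mulrC; exact: H.
Qed.

Lemma is_derive_add f g x v a b : is_derive x v f a -> is_derive x v g b ->
  is_derive x v (fun y => f y + g y) (a + b).
Proof. by move=> fa gb; exact: is_deriveD fa gb. Qed.

Lemma is_derive_sub f g x v a b : is_derive x v f a -> is_derive x v g b ->
  is_derive x v (fun y => f y - g y) (a - b).
Proof. by move=> fa gb; exact: is_deriveB fa gb. Qed.

Lemma is_derive_coord n (i : 'I_n) (x v : 'rV[R]_n) :
  is_derive x v (fun y : 'rV[R]_n => y 0 i) (v 0 i).
Proof.
apply: (@is_derive_along _ _ _ _ (fun t : R => t) _ _ (x 0 i) (v 0 i)).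
  by move=> h; rewrite !mxE.
Qed.

Lemma cont_coord n (i : 'I_n) (x : 'rV[R]_n) :
  {for x, continuous (fun y : 'rV[R]_n => y 0 i)}.
Proof. exact: coord_continuous. Qed.

End derive_rules.

Section box.
Variable R : realType.
Local Notation mu := (@lebesgue_measure R).

Lemma mu3_ball_finite (L : R) : (mu3 R (@vec3 R @^-1` [set x : 'rV[R]_3 | (`|x| <= L)%R]) < +oo)%E.
Proof.
pose A : set R := `[- `|L|, `|L|]%classic.
have mA : measurable A by exact: measurable_itv.
have fA : (mu A < +oo)%E.
  by rewrite /A lebesgue_measure_itv /=; case: ifP => // _; rewrite -EFinD ltry.
have AE : mu3 R ((A `*` A) `*` A) = ((mu A * mu A) * mu A)%E.
  have E2 : @leb2 R (A `*` A) = (mu A * mu A)%E by rewrite /leb2 product_measure1E.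
  rewrite product_measure1E//; last exact: measurableX.
  by rewrite -E2.
have fAAA : (mu3 R ((A `*` A) `*` A) < +oo)%E.
  have fin : mu A \is a fin_num by rewrite ge0_fin_numE.
  by rewrite AE; move: (fin_numM (fin_numM fin fin) fin); rewrite fin_numElt => /andP[].
apply: le_lt_trans fAAA; apply: le_measure; rewrite ?inE.
- apply: closed_vec3_measurable; exact: closed_norm_le.
- by apply: measurableX => //; exact: measurableX.
- move=> y /= yL.
  have {}yL i : `|vec3 y 0 i| <= `|L|.
    by rewrite (le_trans (coord_le_norm _ _))// (le_trans yL)// ler_norm.
  by move: (yL 0) (yL 1) (yL 2); rewrite !mxE /= /A /setX /= !in_itv /= -!ler_norml.
Qed.

Lemma compact_support_integrable (f : 'rV[R]_3 -> R) L M :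
  measurable_fun setT (f \o @vec3 R) -> (forall x, `|f x| <= M) ->
  (forall x, L < `|x| -> f x = 0) ->
  (mu3 R).-integrable setT (EFin \o (f \o @vec3 R)).
Proof.
move=> mf fM f0.
apply: (bounded_support_integrable _ (mu3_ball_finite L) mf) => [|y|y /= yL].
- apply: closed_vec3_measurable; exact: closed_norm_le.
- exact: fM.
- by rewrite f0// ltNge; exact/negP.
Qed.

Lemma continuous_compact_support_integrable (f : 'rV[R]_3 -> R) L :
  continuous f -> (forall x, L < `|x| -> f x = 0) ->
  (mu3 R).-integrable setT (EFin \o (f \o @vec3 R)).
Proof.
move=> cf f0; have [M _ fM] := compact_support_bounded cf f0.
apply: compact_support_integrable fM f0; exact: continuous_vec3_measurable.
Qed.

(** [line_bound] with [c = 0], for the indicator of the part of [S] in each ball. *)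
Lemma lines_null (S : set 'rV[R]_3) i : closed S ->
  (forall x, mu [set t | S (upd x i t)] = 0%E) -> mu3 R (@vec3 R @^-1` S) = 0%E.
Proof.
move=> cS S0.
pose Sn (n : nat) := S `&` [set x | `|x| <= n%:R].
have cSn n : closed (Sn n).
  by apply: closedI => //; exact: closed_norm_le.
have -> : @vec3 R @^-1` S = \bigcup_n (@vec3 R @^-1` Sn n).
  apply/seteqP; split=> [y Sy|y [n _ []]]//.
  exists (Num.truncn `|vec3 y|).+1 => //; split=> //=.
  by rewrite ltW// truncnS_gt.
have mSn n : measurable (@vec3 R @^-1` Sn n) by exact: closed_vec3_measurable.
apply/eqP; rewrite -measure_le0.
have := @measure_sigma_subadditive _ _ _ (mu3 R) _ _ mSn
  (bigcupT_measurable _ mSn) (@subset_refl _ _).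
move=> /le_trans; apply; rewrite eseries0// => n _ _.
have mS : measurable (@vec3 R @^-1` Sn n) by exact: closed_vec3_measurable.
have fS : (mu3 R (@vec3 R @^-1` Sn n) < +oo)%E.
  apply: le_lt_trans (mu3_ball_finite n%:R); apply: le_measure; rewrite ?inE//.
    apply: closed_vec3_measurable; exact: closed_norm_le.
  by move=> y [].
suff: `|\int[mu3 R]_y (\1_(Sn n) (vec3 y) : R)| <= 0 * (2 * n%:R) ^+ 2.
  rewrite mul0r normr_le0 /Rintegral => /eqP.
  have -> : (\int[mu3 R]_y (\1_(Sn n) (vec3 y) : R)%:E)%E = mu3 R (@vec3 R @^-1` Sn n).
    by have := @integral_indic _ _ _ (mu3 R) setT measurableT _ mS; rewrite setIT.
  have F : mu3 R (@vec3 R @^-1` Sn n) \is a fin_num by rewrite ge0_fin_numE.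
  by move=> h; exact: (etrans (esym (fineK F)) (congr1 EFin h)).
apply: (@line_bound _ _ _ 1 _ i) => //.
- exact: measurable_indic.
- by move=> x; rewrite indicE; case: (_ \in _); rewrite ?normr1 ?normr0.
- move=> x nx; rewrite indicE memNset// => -[_ /=]; apply/negP.
  by rewrite -ltNge.
- move=> x; rewrite normr_le0 /Rintegral; apply/eqP.
  have mSx : measurable [set t | Sn n (upd x i t)].
    apply: closed_measurable.
    apply: (@closed_comp _ _ (upd x i) (Sn n)) => // t _; exact: upd_continuous.
  have -> : (\int[mu]_t (\1_(Sn n) (upd x i t) : R)%:E)%E = mu [set t | Sn n (upd x i t)].
    by have := @integral_indic _ _ _ mu setT measurableT _ mSx; rewrite setIT.
  have -> : mu [set t | Sn n (upd x i t)] = 0%E.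
    apply/eqP; rewrite -measure_le0 -(S0 x); apply: le_measure; rewrite ?inE//.
      apply: closed_measurable.
      apply: (@closed_comp _ _ (upd x i) S) => // t _; exact: upd_continuous.
    by move=> t [].
  by [].
Qed.

End box.

(** * Cut-offs around zero *)

Lemma Rintegral_sum_ord (R : realType) d (T : measurableType d)
    (m : {measure set T -> \bar R}) (D : set T) n (f : 'I_n -> T -> R) :
  measurable D -> (forall j, m.-integrable D (EFin \o f j)) ->
  m.-integrable D (EFin \o (fun x => \sum_(j < n) f j x)) /\
  \int[m]_(x in D) (\sum_(j < n) f j x) = \sum_(j < n) \int[m]_(x in D) f j x.
Proof.
move=> mD; elim: n f => [|n IH] f fi.
  have -> : (fun x => \sum_(j < 0) f j x) = cst 0.
    by apply/funext => x; rewrite big_ord0.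
  by split; [exact: integrable0 | rewrite Rintegral_cst// mul0r big_ord0].
have [i1 i2] := IH _ (fun j => fi (widen_ord (leqnSn n) j)).
rewrite big_ord_recr /=.
have -> : EFin \o (fun x => \sum_(j < n.+1) f j x) =
   (EFin \o (fun x => \sum_(j < n) f (widen_ord (leqnSn n) j) x)) \+ (EFin \o f ord_max).
  by apply/funext => x /=; rewrite big_ord_recr /= EFinD.
split; first exact: integrableD.
under eq_Rintegral do rewrite big_ord_recr /=.
by rewrite RintegralD// i2.
Qed.

Section cut.
Variable R : realType.
Local Notation mu := (@lebesgue_measure R).

(** Equal to 0 for |t| <= 1, where [3 - t ^+ 2 >= 2], and to 1 for |t| >= 2,
    where [3 - t ^+ 2 <= 0]; the values on both sides of 0 agree. *)
Definition cut (t : R) := 1 - step (3 - t ^+ 2).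
Definition dcut (t : R) := dstep (3 - t ^+ 2) * (2 * t).

Lemma is_derive_cut t : is_derive t (1 : R) cut (dcut t).
Proof.
have H : is_derive t (1 : R) (fun t => 3 - t ^+ 2) (- (2 * t)).
  by apply: is_derive_eq; rewrite /GRing.scale /=; ring.
have := is_derive_sub (is_derive_cst (1 : R) t (1 : R)) (@is_derive_comp _ R _ (fun t : R => 3 - t ^+ 2) _ _ _ _ (is_derive_step (3 - t ^+ 2)) H).
by rewrite /dcut sub0r mulrN opprK.
Qed.

Lemma dcut_continuous : continuous dcut.
Proof.
move=> t; apply: cvgM; last by apply: cvgM; [exact: cvg_cst | exact: cvg_id].
apply: (@continuous_comp R R R (fun t : R => 3 - t ^+ 2) (@dstep R)).
  by apply: cvgB; [exact: cvg_cst | apply: exprn_continuous].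
exact: dstep_continuous.
Qed.

Lemma cut_near0 t : `|t| <= 1 -> cut t = 0 /\ dcut t = 0.
Proof.
rewrite ler_norml => t1; rewrite /cut /dcut step_ge2 ?dstep_ge2 ?subrr ?mul0r//; nra.
Qed.

Lemma cut_far t : 2 <= `|t| -> cut t = 1 /\ dcut t = 0.
Proof.
rewrite ler_normr => t2; rewrite /cut /dcut step_le0 ?dstep_le0 ?subr0 ?mul0r//.
  by case/orP: t2 => ?; nra.
by case/orP: t2 => ?; nra.
Qed.

Lemma cut_bound t : 0 <= cut t <= 1.
Proof. by have := step_bound (3 - t ^+ 2); rewrite /cut; lra. Qed.

Lemma dcut_bound t : `|dcut t| <= 4.
Proof.
have [t2|t2] := leP 2 `|t|; first by rewrite (cut_far t2).2 normr0.
rewrite /dcut normrM (_ : 4 = 1 * 4); last lra.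
have /andP[h0 h1] := dstep_bound (3 - t ^+ 2).
apply: ler_pM => //; first by rewrite ger0_norm.
rewrite normrM ger0_norm//; lra.
Qed.

(** The cut-off takes the same value 1 on both sides of the layer.  Its derivative
    is of order 1/e there, but has no net mass. *)
Lemma Rintegral_dcut e g : 0 < e -> \int[mu]_t (e^-1 * dcut ((t - g) / e)) = 0.
Proof.
move=> e0.
apply: (@integral_derive0 R (fun t : R => cut ((t - g) / e) - 1)
  (fun t : R => e^-1 * dcut ((t - g) / e)) (`|g| + 2 * e)).
- move=> t.
  have H : is_derive t (1 : R) (fun t => (t - g) / e) e^-1.
    apply: (@is_derive_along _ _ _ _ (fun s : R => s) _ _ ((t - g) / e) e^-1).
      by move=> h; rewrite /GRing.scale /=; ring.
  have := is_derive_sub (@is_derive_comp _ R _ (fun t : R => (t - g) / e) _ _ _ _ (is_derive_cut _) H) (is_derive_cst (1 : R) t (1 : R)).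
  by rewrite subr0 mulrC.
- move=> t; apply: cvgM; first exact: cvg_cst.
  apply: (@continuous_comp R R R (fun t : R => (t - g) / e) dcut).
    by apply: cvgM; [apply: cvgB; [exact: cvg_id|exact: cvg_cst]|exact: cvg_cst].
  exact: dcut_continuous.
- move=> t tg; rewrite (cut_far _).1 ?subrr// normrM normfV (gtr0_norm e0).
  rewrite ler_pdivlMr//.
  have := ler_normD (t - g) g; rewrite subrK; lra.
Qed.

End cut.

(** * The divergence theorem across one graph *)

Section graph.
Variable R : realType.
Local Notation mu := (@lebesgue_measure R).
Variables (i : 'I_3) (G : 'rV[R]_3 -> R) (dG : 'I_3 -> 'rV[R]_3 -> R).
Hypothesis cG : continuous G.
Hypothesis Gi : forall x t, G (upd x i t) = G x.
Hypothesis GdG : forall j x, is_derive x (delta_mx 0 j) G (dG j x).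
Hypothesis cdG : forall j, continuous (dG j).

(* The function u is the height over the graph, and du its gradient. *)
Let u (x : 'rV[R]_3) := x 0 i - G x.
Let du (j : 'I_3) (x : 'rV[R]_3) := (i == j)%:R - dG j x.

Let u_derive j x : is_derive x (delta_mx 0 j) u (du j x).
Proof.
have H := is_derive_sub (is_derive_coord i x (delta_mx 0 j)) (GdG j x).
by rewrite mxE eqxx in H; exact: H.
Qed.

Let u_cont : continuous u.
Proof.
by move=> x; apply: cont_sub; [exact: cont_coord | exact: cG].
Qed.

Let du_cont j : continuous (du j).
Proof. by move=> x; rewrite /du; apply: (@cont_sub _ _ (fun=> _) (dG j)); [exact: cont_cst | exact: cdG]. Qed.

Let u_upd x t : u (upd x i t) = t - G x.
Proof. by rewrite /u Gi mxE eqxx. Qed.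

Lemma graph_closed : closed [set x : 'rV[R]_3 | x 0 i = G x].
Proof.
rewrite (_ : [set x | _] = u @^-1` [set 0]); last first.
  by apply/seteqP; split=> x /=; rewrite /u; [move=> ->; rewrite subrr | move/subr0_eq].
by apply: closed_comp => //; exact: closed_eq.
Qed.

Lemma graph_null : mu3 R (@vec3 R @^-1` [set x : 'rV[R]_3 | x 0 i = G x]) = 0%E.
Proof.
apply: (@lines_null R _ i).
  exact: graph_closed.
move=> x; rewrite (_ : [set t | _] = [set G x]) ?lebesgue_measure_set1//.
by apply/seteqP; split=> t /=; rewrite Gi mxE eqxx.
Qed.

(** On each line the kernel integrates to zero, so [P] may be replaced by its
    variation [P - P(G)], which is at most [w] in the layer.  The layer has
    width 4 e and the kernel is at most 4 / e, whence the factor 16. *)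
Lemma layer_flux (P : 'rV[R]_3 -> R) L e w : 0 <= L -> 0 < e -> 0 <= w ->
  continuous P -> (forall x, L < `|x| -> P x = 0) ->
  (forall x y, `|x - y| <= 2 * e -> `|P x - P y| <= w) ->
  `|\int[mu3 R]_y (e^-1 * dcut (u (vec3 y) / e) * P (vec3 y))|
    <= 16 * w * (2 * L) ^+ 2.
Proof.
move=> L0 e0 w0 cP P0 wP.
have [M M0 PM] := compact_support_bounded cP P0.
have cd (g : R) : continuous (fun t : R => dcut ((t - g) / e)).
  move=> t; apply: (@continuous_comp R R R (fun t : R => (t - g) / e) (@dcut R)).
    by apply: cvgM; [apply: cvgB; [exact: cvg_id|exact: cvg_cst]|exact: cvg_cst].
  exact: dcut_continuous.
have cf : continuous (fun x => e^-1 * dcut (u x / e) * P x).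
  apply: cont_at => x; apply: cont_mul; last exact: cP.
  apply: cont_mul; first exact: cont_cst.
  apply: cont_comp; last exact: dcut_continuous.
  by apply: cont_mul; [exact: u_cont | exact: cont_cst].
have f0 x : L < `|x| -> e^-1 * dcut (u x / e) * P x = 0.
  by move=> xL; rewrite P0// mulr0.
have [M' _ fM] := compact_support_bounded cf f0.
apply: (@line_bound R (fun x => e^-1 * dcut (u x / e) * P x) L M' _ i L0 _ _ fM f0); first by rewrite mulr_ge0.
  exact: continuous_vec3_measurable.
move=> x /=; set g := G x.
(* On the line, the kernel is a function of the single variable t. *)
pose F (t : R) := e^-1 * dcut ((t - g) / e).
have cF : continuous F.
  by move=> t; apply: cvgM; [exact: cvg_cst | exact: cd].
pose A : set R := `[g - 2 * e, g + 2 * e]%classic.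
have AP t : A t <-> `|t - g| <= 2 * e by rewrite /A /= in_itv /= ler_distl.
have F0 t : ~ A t -> F t = 0.
  rewrite AP => /negP tg.
  rewrite /F (cut_far _).2 ?mulr0// normrM normfV (gtr0_norm e0) ler_pdivlMr//.
  by move: tg; rewrite -ltNge => /ltW.
have FM t : `|F t| <= e^-1 * 4.
  by rewrite /F normrM; apply: ler_pM => //; [rewrite ger0_norm// invr_ge0 ltW | exact: dcut_bound].
have mA : measurable A by exact: measurable_itv.
have muA : mu A = (4 * e)%:E.
  have ge : g - 2 * e < g + 2 * e by lra.
  by rewrite lebesgue_measure_itv /= lte_fin ge -EFinD; congr (_%:E); ring.
have fA : (mu A < +oo)%E by rewrite muA ltry.
pose p (t : R) := P (upd x i t).
have cp : continuous p.
  by apply: cont_at => s; apply: cont_comp; [exact: upd_continuous | exact: cP].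
have E : \int[mu]_t (e^-1 * dcut (u (upd x i t) / e) * P (upd x i t)) =
          \int[mu]_t (F t * (p t - p g)).
  have I1 : mu.-integrable setT (EFin \o (fun t => F t * p t)).
    apply: (@bounded_support_integrable _ _ _ mu _ _ (e^-1 * 4 * M) mA fA).
    - by apply: continuous_measurable_fun; apply: cont_at => s; apply: cont_mul; [exact: cF | exact: cp].
    - by move=> s; rewrite (normrM (F s)); apply: ler_pM; rewrite ?normr_ge0 ?FM ?PM.
    - by move=> s /F0 ->; rewrite mul0r.
  have I2 : mu.-integrable setT (EFin \o F).
    apply: (@bounded_support_integrable _ _ _ mu _ _ _ mA fA _ FM F0).
    exact: continuous_measurable_fun.
  have I3 : mu.-integrable setT (EFin \o (fun t => F t * p g)).
    apply: (@bounded_support_integrable _ _ _ mu _ _ (e^-1 * 4 * M) mA fA).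
    - by apply: continuous_measurable_fun; apply: cont_at => s; apply: cont_mul; [exact: cF | exact: cont_cst].
    - by move=> s; rewrite (normrM (F s)); apply: ler_pM; rewrite ?normr_ge0 ?FM ?PM.
    - by move=> s /F0 ->; rewrite mul0r.
  under [RHS]eq_Rintegral do rewrite mulrBr.
  rewrite RintegralB// RintegralZr// Rintegral_dcut// mul0r subr0.
  by under eq_Rintegral do rewrite u_upd.
suff H : `|\int[mu]_t (F t * (p t - p g))| <= 16 * w.
  by apply: le_trans H; rewrite le_eqVlt -E eqxx.
have := @bounded_support_Rintegral _ _ _ mu _ (fun t => F t * (p t - p g)) (e^-1 * 4 * w) mA fA.
rewrite (congr1 fine muA) /=.
have -> : e^-1 * 4 * w * (4 * e) = 16 * w by field; rewrite gt_eqF.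
apply.
- apply: continuous_measurable_fun; apply: cont_at => s; apply: cont_mul; first exact: cF.
  by apply: cont_sub; [exact: cp | exact: cont_cst].
- move=> s; have [tA|/F0 ->] := pselect (A s); last first.
    by rewrite mul0r normr0 !mulr_ge0// invr_ge0 ltW.
  rewrite (normrM (F s)); apply: ler_pM; rewrite ?normr_ge0 ?FM//; apply: wP; apply/norm_rV_le; first by rewrite mulr_ge0// ltW.
  move=> j; rewrite !mxE; case: (j == i); last by rewrite subrr normr0 mulr_ge0// ltW.
  exact/AP.
- by move=> s /F0 ->; rewrite mul0r.
Qed.

Section divergence.
Variables (H D : 'I_3 -> 'rV[R]_3 -> R) (k : 'rV[R]_3 -> R) (L : R).
Hypothesis L0 : 0 <= L.
Hypothesis cH : forall j, continuous (H j).
Hypothesis H0 : forall j x, L < `|x| -> H j x = 0.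
Hypothesis HD : forall (j : 'I_3) (x : 'rV[R]_3), x 0 i != G x -> is_derive x (delta_mx 0 j) (H j) (D j x).
Hypothesis cD : forall (j : 'I_3) (x : 'rV[R]_3), x 0 i != G x -> {for x, continuous (D j)}.
Hypothesis kD : forall (x : 'rV[R]_3), x 0 i != G x -> k x = \sum_j D j x.
Hypothesis ik : (mu3 R).-integrable setT (EFin \o (k \o @vec3 R)).

(* E e j is the j-th partial derivative of the cut-off component
   cut (u / e) * H j; it vanishes near the graph, hence is continuous. *)
Let E (e : R) (j : 'I_3) (x : 'rV[R]_3) : R :=
  e^-1 * dcut (u x / e) * du j x * H j x + cut (u x / e) * D j x.

(* The flux of H through the level sets of u. *)
Let P (x : 'rV[R]_3) : R := \sum_j du j x * H j x.

Let near_graph e x : 0 < e -> `|u x| < e -> \forall y \near x, `|u y / e| <= 1.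
Proof.
move=> e0 xe; have cu : {for x, continuous (fun y => `|u y|)}.
  by apply: cont_comp; [exact: u_cont | exact: norm_continuous].
near=> y; rewrite normrM normfV (gtr0_norm e0) ler_pdivrMr// mul1r ltW//.
by near: y; move/cvgr_lt: cu; apply.
Unshelve. all: by end_near. Qed.

Let E_derive e j x : 0 < e ->
  is_derive x (delta_mx 0 j) (fun y => cut (u y / e) * H j y) (E e j x).
Proof.
move=> e0; have [xe|ex] := ltP `|u x| e.
  have nx := near_graph e0 xe.
  have -> : E e j x = 0.
    have [c0 d0] := cut_near0 (nbhs_singleton nx).
    by rewrite /E c0 d0 mulr0 !mul0r addr0.
  apply: (@near_eq_is_derive _ _ _ (cst 0)).
  by apply: filterS nx => y /cut_near0[-> _]; rewrite mul0r.
have ux : x 0 i != G x.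
  by apply/eqP => uG; move: ex; rewrite /u uG subrr normr0 leNgt e0.
have Hu : is_derive x (delta_mx 0 j) (fun y => u y / e) (du j x / e).
  have := is_derive_mul (u_derive j x) (is_derive_cst (e^-1) x (delta_mx 0 j)).
  by rewrite mulr0 addr0.
have h := is_derive_mul (is_derive_comp (is_derive_cut _) Hu) (HD j ux).
rewrite (_ : E e j x =
  dcut (u x / e) * (du j x / e) * H j x + cut (u x / e) * D j x); first exact: h.
by rewrite /E; ring.
Qed.

Let E_cont e j : 0 < e -> continuous (E e j).
Proof.
move=> e0; apply: cont_at => x; have [xe|ex] := ltP `|u x| e.
  apply: (@cont_near _ _ (fun=> 0)); last exact: cont_cst.
  apply: filterS (near_graph e0 xe) => y /cut_near0[c0 d0].
  by rewrite /E c0 d0 mulr0 !mul0r addr0.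
have ux : x 0 i != G x.
  by apply/eqP => uG; move: ex; rewrite /u uG subrr normr0 leNgt e0.
have cu : {for x, continuous (fun y => u y / e)}.
  by apply: cont_mul; [exact: u_cont | exact: cont_cst].
apply: cont_add; last first.
  apply: cont_mul; last exact: cD.
  apply: (cont_comp cu); apply: differentiable_continuous.
  by apply/derivable1_diffP; have [] := is_derive_cut (u x / e).
apply: cont_mul; last exact: cH.
apply: cont_mul; last exact: du_cont.
apply: cont_mul; first exact: cont_cst.
by apply: (cont_comp cu); exact: dcut_continuous.
Qed.

Let E_far e j x : 0 < e -> L < `|x| -> E e j x = 0.
Proof.
move=> e0 xL; apply: (derive_far0 _ xL (E_derive j x e0)).
by move=> y yL; rewrite H0// mulr0.
Qed.

Let P_cont : continuous P.
Proof.
apply: cont_at => x; apply: cont_sum => j.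
by apply: cont_mul; [exact: du_cont | exact: cH].
Qed.

Let P_far x : L < `|x| -> P x = 0.
Proof. by move=> xL; rewrite /P big1// => j _; rewrite H0// mulr0. Qed.

Let split_flux e x : 0 < e ->
  cut (u x / e) * k x = \sum_j E e j x - e^-1 * dcut (u x / e) * P x.
Proof.
move=> e0; rewrite /E /P big_split /= mulr_sumr.
have -> : \sum_(j < 3) e^-1 * dcut (u x / e) * du j x * H j x =
          \sum_(j < 3) e^-1 * dcut (u x / e) * (du j x * H j x).
  by apply: eq_bigr => j _; rewrite !mulrA.
rewrite addrAC subrr add0r -mulr_sumr.
have [ux|/kD ->//] := eqVneq (x 0 i) (G x).
by rewrite (cut_near0 _).1 ?mul0r// /u ux subrr mul0r normr0.
Qed.

Let flux_cont e : 0 < e -> continuous (fun x => e^-1 * dcut (u x / e) * P x).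
Proof.
move=> e0; apply: cont_at => x; apply: cont_mul; last exact: P_cont.
apply: cont_mul; first exact: cont_cst.
apply: cont_comp; last exact: dcut_continuous.
by apply: cont_mul; [exact: u_cont | exact: cont_cst].
Qed.

Let Rintegral_cut e : 0 < e -> \int[mu3 R]_y (cut (u (vec3 y) / e) * k (vec3 y)) =
  - \int[mu3 R]_y (e^-1 * dcut (u (vec3 y) / e) * P (vec3 y)).
Proof.
move=> e0; under eq_Rintegral do rewrite split_flux//.
have iE j : (mu3 R).-integrable setT (EFin \o (E e j \o @vec3 R)).
  by apply: (@continuous_compact_support_integrable _ _ L) => [|x xL]; [exact: E_cont | exact: E_far].
have iP : (mu3 R).-integrable setT
    (EFin \o ((fun x => e^-1 * dcut (u x / e) * P x) \o @vec3 R)).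
  apply: (@continuous_compact_support_integrable _ _ L) => [|x xL]; first exact: flux_cont.
  by rewrite P_far// mulr0.
have [i1 i2] := Rintegral_sum_ord measurableT iE.
rewrite RintegralB//.
rewrite [X in X - _](_ : _ = 0) ?sub0r//.
apply: etrans i2 _; apply: big1 => j _.
apply: (@Rintegral_partial0 R (fun y => cut (u y / e) * H j y) (E e j) j L L0).
- by move=> x; exact: E_derive.
- exact: E_cont.
- by move=> x xL; rewrite H0// mulr0.
Qed.

(** For each e, the integral of [cut (u / e) * k] is minus the flux in the layer.
    As e tends to 0 the former converges to the integral of [k] by dominated
    convergence, because the graph is null, and the latter to 0 by [layer_flux].
    The derivatives [D] may blow up at the graph: only [k] enters the limit. *)
Lemma Rintegral_div_graph : \int[mu3 R]_y k (vec3 y) = 0.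
Proof.
pose e (n : nat) : R := n.+1%:R^-1.
have e0 n : 0 < e n by rewrite invr_gt0.
have mk : measurable_fun setT (k \o @vec3 R).
  by apply/measurable_EFinP; exact: measurable_int ik.
have mcut n : measurable_fun setT (fun y => cut (u (vec3 y) / e n)).
  apply: (@continuous_vec3_measurable _ (fun x => cut (u x / e n))).
  apply: cont_at => x.
  have cu : {for x, continuous (fun y => u y / e n)}.
    by apply: cont_mul; [exact: u_cont | exact: cont_cst].
  apply: (cont_comp cu); apply: differentiable_continuous.
  by apply/derivable1_diffP; have [] := is_derive_cut (u x / e n).
have lim1 : \int[mu3 R]_y (cut (u (vec3 y) / e n) * k (vec3 y)) @[n --> \oo] -->
            \int[mu3 R]_y k (vec3 y).
  apply: (@Rdominated_cvg _ _ _ (mu3 R) _ _ (fun y => `|k (vec3 y)|)).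
  - by move=> n; apply: measurable_funM; [exact: mcut | exact: mk].
  - exact: mk.
  - exists (@vec3 R @^-1` [set x : 'rV[R]_3 | x 0 i = G x]); split.
    + exact: (closed_vec3_measurable graph_closed).
    + exact: graph_null.
    + move=> y /=; apply: contra_notP => /eqP uy.
      have u0 : 0 < `|u (vec3 y)| by rewrite normr_gt0 subr_eq0.
      apply: (@cvg_near_cst _ _ _ _ _ _); near=> n.
      rewrite (cut_far _).1 ?mul1r// normrM normfV (gtr0_norm (e0 n)) invrK.
      rewrite -ler_pdivrMl// ltW//.
      near: n; exact: near_infty_natS.
  - exact: (integrable_norm ik).
  - move=> n y; rewrite normrM ler_piMl//.
    by have /andP[h0 h1] := cut_bound (u (vec3 y) / e n); rewrite ger0_norm.
suff lim2 : \int[mu3 R]_y (cut (u (vec3 y) / e n) * k (vec3 y)) @[n --> \oo] --> (0 : R).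
  exact: cvg_unique lim1 lim2.
have -> : (fun n => \int[mu3 R]_y (cut (u (vec3 y) / e n) * k (vec3 y))) =
  (fun n => - \int[mu3 R]_y ((e n)^-1 * dcut (u (vec3 y) / e n) * P (vec3 y))).
  by apply/funext => n; exact: Rintegral_cut.
apply/cvgrPdist_le => eps eps0.
pose w := eps / (16 * (2 * L) ^+ 2 + 1).
have K0 : 0 < 16 * (2 * L) ^+ 2 + 1 by rewrite ltr_wpDl// mulr_ge0// sqr_ge0.
have w0 : 0 < w by rewrite divr_gt0.
have [r /= r0 rP] := compact_support_uniform P_cont P_far w0.
near=> n.
rewrite sub0r opprK; apply: le_trans (_ : 16 * w * (2 * L) ^+ 2 <= _).
  apply: (layer_flux L0 (e0 n) (ltW w0) P_cont P_far).
  apply: rP; last by rewrite mulr_gt0.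
  rewrite /= sub0r normrN gtr0_norm ?mulr_gt0// -ltr_pdivlMl//.
  rewrite /e invf_plt ?posrE ?divr_gt0 ?mulr_gt0//.
  near: n; exact: near_infty_natS.
rewrite /w mulrAC mulrA ler_pdivrMr// mulrC ler_pM2l// lerDl//.
Unshelve. all: by end_near. Qed.

End divergence.

End graph.

(** * The divergence theorem across a compact C1 surface *)

Section bump.
Variable R : realType.

Definition sqdist n (p y : 'rV[R]_n) : R := \sum_(i < n) (y 0 i - p 0 i) ^+ 2.

Lemma sqdist_ge0 n (p y : 'rV[R]_n) : 0 <= sqdist p y.
Proof. by apply: sumr_ge0 => i _; exact: sqr_ge0. Qed.

Lemma sqdist_coord n (p y : 'rV[R]_n) i : (y 0 i - p 0 i) ^+ 2 <= sqdist p y.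
Proof.
by rewrite /sqdist (bigD1 i)//= lerDl; apply: sumr_ge0 => j _; exact: sqr_ge0.
Qed.

Lemma sqdist_norm n (p y : 'rV[R]_n) e : 0 <= e -> sqdist p y <= e ^+ 2 -> `|p - y| <= e.
Proof.
move=> e0 pe; apply/norm_rV_le => // i; rewrite !mxE distrC.
rewrite -(@ler_pXn2r _ 2) ?nnegrE// real_normK ?num_real//.
exact: le_trans (sqdist_coord _ _ _) pe.
Qed.

Lemma is_derive_sqdist n (p y : 'rV[R]_n) j :
  is_derive y (delta_mx 0 j) (sqdist p) (2 * (y 0 j - p 0 j)).
Proof.
apply: (@is_derive_along _ _ _ _
  (fun t : R => sqdist p y + (2 * (y 0 j - p 0 j)) * t + t ^+ 2) _ _ (0 : R) (1 : R)).
  move=> h; rewrite /sqdist scaler1 addr0 (bigD1 j)//= [in RHS](bigD1 j)//= !mxE !eqxx /= mulr1.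
  rewrite (eq_bigr (fun i => (y 0 i - p 0 i) ^+ 2)); last first.
    by move=> i ij; rewrite !mxE eqxx (negbTE ij) /= mulr0 add0r.
  ring.
by apply: is_derive_eq; rewrite /GRing.scale /=; ring.
Qed.

Lemma cont_sqdist n (p : 'rV[R]_n) : continuous (sqdist p).
Proof.
apply: cont_at => y; apply: cont_sum => i.
apply: (@cont_mul _ _ (fun y : 'rV[R]_n => y 0 i - p 0 i) (fun y : 'rV[R]_n => y 0 i - p 0 i));
  by apply: cont_sub; [exact: cont_coord | exact: cont_cst].
Qed.

Variables (p : 'rV[R]_3) (r : R).
Hypothesis r0 : 0 < r.

(** Equal to 1 at distance at most r from p, and to 0 beyond sqrt 3 times r. *)
Definition bump (y : 'rV[R]_3) : R := step (3 - sqdist p y / r ^+ 2).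

Definition dbump (j : 'I_3) (y : 'rV[R]_3) : R :=
  dstep (3 - sqdist p y / r ^+ 2) * - (2 * (y 0 j - p 0 j) / r ^+ 2).

Lemma is_derive_bump j y : is_derive y (delta_mx 0 j) bump (dbump j y).
Proof.
have H := is_derive_sub (is_derive_cst (3 : R) y (delta_mx 0 j))
  (is_derive_mul (is_derive_sqdist p y j) (is_derive_cst ((r ^+ 2)^-1) y (delta_mx 0 j))).
rewrite /dbump; rewrite mulr0 addr0 sub0r in H.
exact: (@is_derive_comp _ _ _ _ _ _ _ _ (is_derive_step _) H).
Qed.

Let cont_arg : continuous (fun y => 3 - sqdist p y / r ^+ 2).
Proof.
apply: cont_at => y; apply: cont_sub; first exact: cont_cst.
by apply: cont_mul; [exact: cont_sqdist | exact: cont_cst].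
Qed.

Lemma cont_bump : continuous bump.
Proof.
apply: cont_at => y; apply: (cont_comp (cont_arg (x := y))).
apply: differentiable_continuous; apply/derivable1_diffP.
by have [] := is_derive_step (3 - sqdist p y / r ^+ 2).
Qed.

Lemma cont_dbump j : continuous (dbump j).
Proof.
apply: cont_at => y; apply: cont_mul.
  by apply: (cont_comp (cont_arg (x := y))); exact: dstep_continuous.
rewrite (_ : (fun y : 'rV[R]_3 => - (2 * (y 0 j - p 0 j) / r ^+ 2)) =
  (fun y : 'rV[R]_3 => (y 0 j - p 0 j) * - (2 / r ^+ 2))); last first.
  by apply/funext => z; ring.
apply: cont_mul; last exact: cont_cst.
by apply: cont_sub; [exact: cont_coord | exact: cont_cst].
Qed.

Lemma bump_bound y : 0 <= bump y <= 1. Proof. exact: step_bound. Qed.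

Lemma bump_in y : sqdist p y <= r ^+ 2 -> bump y = 1 /\ (forall j, dbump j y = 0).
Proof.
move=> yr; have yr1 : sqdist p y / r ^+ 2 <= 1.
  by rewrite ler_pdivrMr ?mul1r// exprn_gt0.
split=> [|j]; first by rewrite /bump step_ge2//; lra.
by rewrite /dbump dstep_ge2 ?mul0r//; lra.
Qed.

Lemma bump_out y : 3 * r ^+ 2 <= sqdist p y -> bump y = 0 /\ (forall j, dbump j y = 0).
Proof.
move=> yr; have yr1 : 3 <= sqdist p y / r ^+ 2.
  by rewrite ler_pdivlMr// exprn_gt0.
split=> [|j]; first by rewrite /bump step_le0//; lra.
by rewrite /dbump dstep_le0 ?mul0r//; lra.
Qed.

End bump.

Section global.
Variables (R : realType) (Gam : set 'rV[R]_3).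
Hypothesis cGam : closed Gam.

(** The graph function lives on the whole space and is constant along the axis
    [i], so that it can be differentiated in the ambient directions. *)
Definition C1_graph_fun (i : 'I_3) (G : 'rV[R]_3 -> R) (dG : 'I_3 -> 'rV[R]_3 -> R) :=
  [/\ continuous G, forall x t, G (upd x i t) = G x,
      forall j x, is_derive x (delta_mx 0 j) G (dG j x) &
      forall j, continuous (dG j)].

Hypothesis graphGam : forall p : 'rV[R]_3, exists i G dG, C1_graph_fun i G dG /\
  \forall x \near p, Gam x -> (x : 'rV[R]_3) 0 i = G x.

(** The divergence [k] is a separate datum because [\sum_j D j] has no meaning on
    [Gam], and because it may be integrable when the single [D j] are not. *)
Definition piecewise_C1 (L : R) (H D : 'I_3 -> 'rV[R]_3 -> R) (k : 'rV[R]_3 -> R) :=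
  [/\ forall j, continuous (H j),
      forall j x, L < `|x| -> H j x = 0,
      forall j x, ~ Gam x ->
        is_derive x (delta_mx 0 j) (H j) (D j x) /\ {for x, continuous (D j)},
      forall x, ~ Gam x -> k x = \sum_j D j x &
      (mu3 R).-integrable setT (EFin \o (k \o @vec3 R))].

Lemma piecewise_C1_mul L H D k (b : 'rV[R]_3 -> R) (db : 'I_3 -> 'rV[R]_3 -> R) :
  (forall x, `|b x| <= 1) -> continuous b ->
  (forall j x, is_derive x (delta_mx 0 j) b (db j x)) ->
  (forall j, continuous (db j)) ->
  piecewise_C1 L H D k ->
  piecewise_C1 L (fun j x => b x * H j x) (fun j x => db j x * H j x + b x * D j x)
    (fun x => \sum_j db j x * H j x + b x * k x).
Proof.
move=> b1 cb bd cdb [cH H0 HD kD ik]; split.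
- by move=> j; apply: cont_at => x; apply: cont_mul; [exact: cb | exact: cH].
- by move=> j x xL; rewrite H0// mulr0.
- move=> j x /(HD j)[HDx cDx]; split; first exact: is_derive_mul (bd j x) HDx.
  apply: cont_add; first by apply: cont_mul; [exact: cdb | exact: cH].
  by apply: cont_mul; [exact: cb | exact: cDx].
- by move=> x /kD ->; rewrite big_split /= -mulr_sumr.
- have i1 : (mu3 R).-integrable setT (EFin \o ((fun x => \sum_j db j x * H j x) \o @vec3 R)).
    apply: (@continuous_compact_support_integrable _ _ L).
      by apply: cont_at => x; apply: cont_sum => j; apply: cont_mul; [exact: cdb | exact: cH].
    by move=> x xL; rewrite big1// => j _; rewrite H0// mulr0.
  have i2 : (mu3 R).-integrable setT (EFin \o ((fun x => b x * k x) \o @vec3 R)).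
    apply: (le_integrable _ _ _ ik) => //.
      apply/measurable_EFinP; apply: measurable_funM.
        exact: continuous_vec3_measurable.
      by apply/measurable_EFinP; exact: measurable_int ik.
    by move=> y _; rewrite /= lee_fin normrM ler_piMl.
  exact: (integrableD measurableT i1 i2).
Qed.

(* The factor 2 exceeds sqrt 3: the support of bump p (r p) lies where Gam is
   part of a single graph. *)
Let radius : exists r : 'rV[R]_3 -> R, forall p, 0 < r p /\
  exists i G dG, C1_graph_fun i G dG /\
    forall x, sqdist p x <= (2 * r p) ^+ 2 -> Gam x -> (x : 'rV[R]_3) 0 i = G x.
Proof.
suff /boolp.choice[r rP] : forall p : 'rV[R]_3, exists e : R, 0 < e /\
    exists i G dG, C1_graph_fun i G dG /\
    forall x, sqdist p x <= (2 * e) ^+ 2 -> Gam x -> (x : 'rV[R]_3) 0 i = G x.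
  by exists r.
move=> p; have [i [G [dG [GG /nbhs_ballP[e /= e0 pe]]]]] := graphGam p.
have e40 : 0 < e / 4 by rewrite divr_gt0.
exists (e / 4); split => //; exists i, G, dG; split => // x px; apply: pe.
rewrite -ball_normE /=; apply: le_lt_trans (_ : 2 * (e / 4) < e); last lra.
by apply: sqdist_norm; rewrite ?mulr_ge0// ltW.
Qed.

Let r := sval (cid radius).
Let r_gt0 p : 0 < r p. Proof. by have [] := svalP (cid radius) p. Qed.
Let r_graph p : exists i G dG, C1_graph_fun i G dG /\
    forall x, sqdist p x <= (2 * r p) ^+ 2 -> Gam x -> (x : 'rV[R]_3) 0 i = G x.
Proof. by have [] := svalP (cid radius) p. Qed.

Let finite_cover (K : set 'rV[R]_3) : compact K ->
  exists ps : seq 'rV[R]_3, forall x, K x -> exists2 p, p \in ps & sqdist p x < r p ^+ 2.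
Proof.
rewrite compact_cover => cK.
have [|x Kx|ps _ Kps] := cK _ setT (fun p => [set x | sqdist p x < r p ^+ 2]).
- move=> p _.
  rewrite (_ : [set x | _] = sqdist p @^-1` [set t | t < r p ^+ 2])//.
  by apply: open_comp; [move=> ? _; exact: cont_sqdist | exact: open_lt].
- exists x => //=; rewrite /sqdist big1 ?exprn_gt0// => i _.
  by rewrite subrr expr0n.
- exists (finmap.enum_fset ps) => x /Kps[p /= pps px]; exists p => //.
Qed.

Lemma graph_set_null : bounded_set Gam -> mu3 R (@vec3 R @^-1` Gam) = 0%E.
Proof.
move=> bG; have [ps psP] := finite_cover (bounded_closed_compact bG cGam).
suff : (mu3 R).-negligible (@vec3 R @^-1` Gam).
  by move/measure_negligible; apply; exact: closed_vec3_measurable.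
have : (mu3 R).-negligible (@vec3 R @^-1`
    [set x | exists2 p, p \in ps & Gam x /\ sqdist p x < r p ^+ 2]).
  elim: ps {psP} => [|p ps IH].
    apply: (@negligibleS _ _ _ (mu3 R) set0); last exact: negligible_set0.
    by move=> y [].
  have [i [G [dG [[cG Gi GdG cdG] pG]]]] := r_graph p.
  apply: (@negligibleS _ _ _ (mu3 R)
    ((@vec3 R @^-1` [set x : 'rV[R]_3 | x 0 i = G x]) `|`
     (@vec3 R @^-1` [set x | exists2 p, p \in ps & Gam x /\ sqdist p x < r p ^+ 2]))).
    move=> y [q]; rewrite inE => /orP[/eqP ->|qps] [Gy qy]; [left | right].
      apply: pG => //; rewrite ltW// (lt_le_trans qy)// exprMn ler_peMl ?sqr_ge0//.
      by rewrite expr_ge1//; lra.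
    by exists q.
  apply: negligibleU => //.
  exists (@vec3 R @^-1` [set x : 'rV[R]_3 | x 0 i = G x]); split => //.
    exact: closed_vec3_measurable (graph_closed cG).
  exact: graph_null.
apply: negligibleS => y Gy /=; have [p pps py] := psP _ Gy.
by exists p.
Qed.

(** Induction on a finite family of balls covering the support of [H].  With a
    bump [b] that is 1 on the first ball, [b H] meets a single graph and
    [Rintegral_div_graph] applies, while the support of [(1 - b) H] is covered
    by the remaining balls. *)
Lemma Rintegral_div0 L H D k : 0 <= L -> bounded_set Gam ->
  piecewise_C1 L H D k -> \int[mu3 R]_y k (vec3 y) = 0.
Proof.
move=> L0 bG HDk.
have [ps psP] := finite_cover (@compact_closed_ball_rV R 3 L).
have {psP} : forall j x, H j x != 0 -> exists2 p, p \in ps & sqdist p x < r p ^+ 2.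
  move=> j x Hx; apply: psP => /=; rewrite leNgt; apply/negP => xL.
  by have [_ H0 _ _ _] := HDk; rewrite H0 ?eqxx// in Hx.
elim: ps H D k HDk => [|p ps IH] H D k HDk Hps.
  have H0 : forall j, H j = cst 0.
    move=> j; apply/funext => x; apply/eqP.
    by apply/negPn/negP => /Hps[].
  have [_ _ HD kD ik] := HDk.
  transitivity (\int[mu3 R]_y 0); last by rewrite Rintegral_cst// mul0r.
  rewrite /Rintegral; congr fine; apply: ae_eq_integral => //.
  - exact: measurable_int ik.
  - exists (@vec3 R @^-1` Gam); split; first exact: closed_vec3_measurable.
      exact: graph_set_null.
    (* Off Gam, k is the divergence of the zero field. *)
    move=> y /=; apply: contra_notP => Gy _; rewrite kD// big1// => j _.
    have [+ _] := HD j _ Gy; rewrite H0 => -[_ <-]; exact: derive_cst.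
pose b := bump p (r p); pose db := dbump p (r p).
have b1 x : `|b x| <= 1 by have /andP[h0 h1] := bump_bound p (r p) x; rewrite ger0_norm.
have c1 x : `|1 - b x| <= 1.
  by have /andP[h0 h1] := bump_bound p (r p) x; rewrite ger0_norm; rewrite /b; lra.
have P1 := piecewise_C1_mul b1 (@cont_bump _ p (r p)) (is_derive_bump p (r p)) (@cont_dbump _ p (r p)) HDk.
have P2 := @piecewise_C1_mul L H D k (fun x => 1 - b x) (fun j x => 0 - db j x) c1
  ltac:(by apply: cont_at => x; apply: cont_sub; [exact: cont_cst | exact: cont_bump])
  ltac:(by move=> j x; exact: (is_derive_sub (is_derive_cst (1 : R) x (delta_mx 0 j)) (is_derive_bump p (r p) j x)))
  ltac:(by move=> j; apply: cont_at => x; apply: cont_sub; [exact: cont_cst | exact: cont_dbump]) HDk.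
have /IH P20 := P2.
have [cH1 H01 HD1 kD1 ik1] := P1.
have [_ _ _ _ ik2] := P2.
(* The gradients of b and of 1 - b cancel. *)
have -> : \int[mu3 R]_y k (vec3 y) =
   \int[mu3 R]_y (\sum_j db j (vec3 y) * H j (vec3 y) + b (vec3 y) * k (vec3 y)) +
   \int[mu3 R]_y (\sum_j (0 - db j (vec3 y)) * H j (vec3 y) + (1 - b (vec3 y)) * k (vec3 y)).
  rewrite -RintegralD//; apply: eq_Rintegral => y _.
  rewrite addrACA -big_split /= big1 => [|j _]; last by ring.
  by ring.
rewrite P20 ?addr0; last first.
  move=> j x Hx; have [q] := Hps j x ltac:(by apply: contra Hx => /eqP ->; rewrite mulr0).
  rewrite inE => /orP[/eqP ->|qps]; last by exists q.
  by move=> /ltW/(bump_in (r_gt0 p))[bx _]; rewrite /b bx subrr mul0r eqxx in Hx.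
have [i [G [dG [[cG Gi GdG cdG] pG]]]] := r_graph p.
have far (x : 'rV[R]_3) : x 0 i != G x -> Gam x -> 3 * r p ^+ 2 < sqdist p x.
  move=> xG Gx; rewrite ltNge; apply/negP => px; move/eqP: xG; apply.
  apply: pG => //; apply: le_trans px _; rewrite exprMn ler_pM2r ?exprn_gt0//; lra.
(* Points of Gam off this graph are outside the support of b, where b H
   vanishes: there b H is smooth although H may not be. *)
have out (x : 'rV[R]_3) : x 0 i != G x -> Gam x ->
    \forall y \near x, b y = 0 /\ forall j, db j y = 0.
  move=> xG Gx; have := far x xG Gx; have cs := @cont_sqdist R _ p x.
  move=> /(cvgr_gt _ cs); apply: filterS => y /ltW /(bump_out (r_gt0 p)).
  by [].
apply: (Rintegral_div_graph cG Gi GdG cdG L0 cH1 H01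
  (D := fun j x => db j x * H j x + b x * D j x) _ _ _ ik1).
- move=> j x xG; have [Gx|/(HD1 j)[]//] := pselect (Gam x).
  have ox := out x xG Gx; have [bx dbx] := nbhs_singleton ox.
  rewrite bx dbx !mul0r addr0.
  apply: (@near_eq_is_derive _ _ _ (cst 0)).
  by apply: filterS ox => y [-> _]; rewrite mul0r.
- move=> j x xG; have [Gx|/(HD1 j)[]//] := pselect (Gam x).
  apply: (@cont_near _ _ (fun=> 0)); last exact: cont_cst.
  by apply: filterS (out x xG Gx) => y [-> ->]; rewrite !mul0r addr0.
- move=> x xG; have [Gx|/kD1//] := pselect (Gam x).
  have [bx dbx] := nbhs_singleton (out x xG Gx).
  rewrite bx mul0r addr0; apply: eq_bigr => j _.
  by rewrite mul0r addr0.
Qed.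

End global.

(** * Integrals over the whole line *)

Section improper.
Variable R : realType.
Local Notation mu := (@lebesgue_measure R).

Lemma is_derive_cont (f : R -> R) (x d : R) : is_derive x (1 : R) f d -> {for x, continuous f}.
Proof.
by move=> [df _]; apply: differentiable_continuous; apply/derivable1_diffP.
Qed.

Lemma integralT_FTC (f F : R -> R) (a b : R) : (forall t, 0 <= f t) -> continuous f ->
  (forall t, is_derive t (1 : R) F (f t)) ->
  F t @[t --> +oo] --> b -> F t @[t --> -oo] --> a ->
  (\int[mu]_t (f t)%:E = (b - a)%:E)%E.
Proof.
move=> f0 cf dF Fb Fa.
have mf : measurable_fun setT f by exact: continuous_measurable_fun.
have cF : continuous F by move=> t; exact: is_derive_cont (dF t).
have -> : [set: R] = `]-oo, 0%R]%classic `|` `]0%R, +oo[%classic.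
  apply/seteqP; split=> t //= _; rewrite !in_itv /= andbT.
  by case: (leP t 0) => _; [left | right].
rewrite ge0_integral_setU//=; last 3 first.
- by apply/measurable_EFinP; exact: measurable_funTS.
- by move=> t _; rewrite lee_fin.
- apply/disj_setPS => t [] /=; rewrite !in_itv /= andbT => t0.
  by rewrite ltNge t0.
rewrite integral_itv_obnd_cbnd; last by apply/measurable_EFinP; exact: measurable_funTS.
have -> : (\int[mu]_(x in `[0%R, +oo[) (f x)%:E = b%:E - (F 0)%:E)%E.
  apply: ge0_continuous_FTC2y.
  - by move=> t _; exact: f0.
  - exact: continuous_subspaceT.
  - exact: Fb.
  - by move=> t _; have [] := dF t.
  - by apply: cvg_at_right_filter; exact: cF.
  - by move=> t _; rewrite derive1E; have [_ ->] := dF t.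
have -> : (\int[mu]_(x in `]-oo, 0%R]) (f x)%:E =
    \int[mu]_(x in `[0%R, +oo[) ((f \o -%R) x)%:E)%E.
  rewrite -{1}oppr0; apply: ge0_integration_by_substitutionNy.
    exact: continuous_subspaceT.
  by move=> t _; exact: f0.
have cfN : continuous (f \o -%R).
  by apply: cont_at => t; apply: cont_comp; [exact: opp_continuous | exact: cf].
have dG t : is_derive t (1 : R) (fun s => - F (- s)) ((f \o -%R) t).
  have H : is_derive t (1 : R) (fun s : R => - s) (- 1).
    by apply: is_derive_eq.
  have H1 := is_derive_comp (dF (- t)) H.
  have H2 := is_derive_sub (is_derive_cst (0 : R) t (1 : R)) H1.
  rewrite sub0r mulrN1 opprK in H2.
  by rewrite (_ : (fun s => - F (- s)) = (fun s => cst 0 s - (F \o -%R) s)) //; apply/funext => s; rewrite /= sub0r.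
have -> : (\int[mu]_(x in `[0%R, +oo[) ((f \o -%R) x)%:E = (- a)%:E - (- F (- 0))%:E)%E.
  apply: (@ge0_continuous_FTC2y _ (f \o -%R) (fun s => - F (- s))).
  - by move=> t _; exact: f0.
  - exact: continuous_subspaceT.
  - by apply: cvgN; apply/cvgNy_compNP.
  - by move=> t _; have [] := dG t.
  - by apply: cvg_at_right_filter; exact: is_derive_cont (dG 0).
  - by move=> t _; rewrite derive1E; have [_ ->] := dG t.
by rewrite oppr0 -!EFinB -EFinD; congr (_%:E); ring.
Qed.

(** An odd antiderivative has opposite limits at both ends. *)
Lemma integralT_odd (f F : R -> R) (c l : R) : (forall t, 0 <= f t) -> continuous f ->
  (forall t, is_derive t (1 : R) F (f t)) -> (forall t, F (- t) = - F t) ->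
  F t @[t --> +oo] --> l ->
  (\int[mu]_t (f (t - c))%:E = (2 * l)%:E)%E.
Proof.
move=> f0 cf dF Fodd Fl.
have dS t : is_derive t (1 : R) (fun s : R => s - c) 1.
  by apply: is_derive_eq; rewrite subr0.
have FS (a : R) : F (t - a) @[t --> +oo] --> l.
  apply: (@cvg_comp _ _ _ (fun t => t - a) F _ +oo%R); last exact: Fl.
  apply/cvgryPge => A; near=> t; rewrite lerBrDr.
  by near: t; apply: nbhs_pinfty_ge; exact: num_real.
rewrite (_ : 2 * l = l - - l); last by ring.
apply: (@integralT_FTC (fun t => f (t - c)) (fun t => F (t - c)) (- l) l).
- by [].
- apply: cont_at => t; apply: cont_comp; last exact: cf.
  exact: is_derive_cont (dS t).
- move=> t; rewrite -[X in is_derive _ _ _ X]mulr1.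
  exact: (@is_derive_comp _ _ F (fun s : R => s - c) _ _ _ _ (dF _) (dS t)).
- exact: FS.
- apply/cvgNy_compNP; rewrite (_ : _ \o _ = (fun t => - F (t - - c))).
    by apply: cvgN; exact: FS.
  by apply/funext => t /=; rewrite -Fodd; congr F; ring.
Unshelve. all: by end_near. Qed.

Lemma cvgy_bound (F : R -> R) (l K : R) : 0 <= K ->
  (forall t, 1 <= t -> `|l - F t| <= K / t) -> F t @[t --> +oo] --> l.
Proof.
move=> K0 h; apply/cvgrPdist_le => e e0; near=> t.
have t1 : 1 <= t by near: t; apply: nbhs_pinfty_ge; exact: num_real.
apply: le_trans (h _ t1) _; rewrite ler_pdivrMr ?(lt_le_trans _ t1)//.
rewrite -ler_pdivrMl//; near: t; apply: nbhs_pinfty_ge; exact: num_real.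
Unshelve. all: by end_near. Qed.

(* The antiderivatives are the classical ones in terms of s / sqrt (a + s^2).
   In the triple integrals below, a collects the squares of the coordinates
   that are not being integrated. *)
Section sqrt.
Variable a : R.
Hypothesis a0 : 0 < a.

Let pos s : 0 < a + s ^+ 2. Proof. by rewrite ltr_wpDr// sqr_ge0. Qed.

Let w (s : R) := Num.sqrt (a + s ^+ 2).
Let w0 s : 0 < w s. Proof. by rewrite sqrtr_gt0. Qed.
Let wn s : w s != 0. Proof. by rewrite gt_eqF. Qed.
Let an : a != 0. Proof. by rewrite gt_eqF. Qed.
Let w2 s : w s ^+ 2 = a + s ^+ 2. Proof. by rewrite sqr_sqrtr// ltW. Qed.

Let dw s : is_derive s (1 : R) w (s / w s).
Proof.
have H : is_derive s (1 : R) (fun s : R => a + s ^+ 2) (2 * s).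
  by apply: is_derive_eq; rewrite /GRing.scale /=; ring.
have := @is_derive_comp _ _ _ (fun s : R => a + s ^+ 2) _ _ _ _ (is_derive1_sqrt (pos s)) H.
rewrite (_ : _ * _ = s / w s)//.
by rewrite /w; field; rewrite gt_eqF// sqrtr_gt0.
Qed.

Let du s : is_derive s (1 : R) (fun s => s / w s) (a / w s ^+ 3).
Proof.
have Hv := is_deriveV (wn s) (dw s).
have := is_derive_mul (is_derive_id s (1 : R)) Hv.
rewrite (_ : _ + _ = a / w s ^+ 3)//.
rewrite /GRing.scale /= -(addrK (s ^+ 2) a) -w2; field.
by [].
Qed.

Let u_cvg : (s / w s) @[s --> +oo] --> (1 : R).
Proof.
apply: (@cvgy_bound _ _ a); first exact: ltW.
move=> t t1; have t0 : 0 < t by rewrite (lt_le_trans _ t1).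
have tw : t <= w t.
  by rewrite -(@ler_pXn2r _ 2) ?nnegrE ?(ltW (w0 t)) ?(ltW t0)// w2 lerDr ltW.
rewrite ger0_norm; last by rewrite subr_ge0 ler_pdivrMr// mul1r.
rewrite (_ : 1 - t / w t = (w t - t) / w t); last by field; rewrite ?wn ?an.
rewrite ler_pdivrMr// mulrAC ler_pdivlMr//.
apply: le_trans (_ : (w t - t) * (w t + t) <= _).
  by rewrite ler_wpM2l ?subr_ge0// lerDr ltW.
rewrite -subr_sqr w2 addrK (ler_peMr (ltW a0))//.
exact: le_trans t1 tw.
Qed.

Let w_cont : continuous w.
Proof. by move=> s; exact: is_derive_cont (dw s). Qed.

Let w_odd s : w (- s) = w s. Proof. by rewrite /w sqrrN. Qed.

Let wV_cont n : continuous (fun s => (w s ^+ n)^-1).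
Proof.
apply: cont_at => s; apply: (@cont_comp _ _ _ (fun x : R => (x ^+ n)^-1)); first exact: w_cont.
apply: (@cont_comp _ _ _ (fun x : R => x^-1)); first exact: exprn_continuous.
by apply: inv_continuous; rewrite expf_neq0// gt_eqF.
Qed.

Lemma integralT_sqrt3 c : (\int[mu]_t ((Num.sqrt (a + (t - c) ^+ 2)) ^+ 3)^-1%:E = (2 / a)%:E)%E.
Proof.
rewrite (_ : 2 / a = 2 * (1 / a)); last by rewrite mul1r.
apply: (@integralT_odd (fun s => (w s ^+ 3)^-1) (fun s => s / w s / a) c (1 / a)).
- by move=> t; rewrite invr_ge0 exprn_ge0// ltW.
- exact: wV_cont.
- move=> t; apply: (is_derive_eq (is_derive_mul (du t) (is_derive_cst (a^-1) t (1 : R)))).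
  by rewrite /=; field; rewrite wn an.
- by move=> t; rewrite w_odd !mulNr.
- by apply: cvgM; [exact: u_cvg | exact: cvg_cst].
Qed.

Lemma integralT_sqrt5 c : (\int[mu]_t ((Num.sqrt (a + (t - c) ^+ 2)) ^+ 5)^-1%:E = (4 / (3 * a ^+ 2))%:E)%E.
Proof.
rewrite (_ : 4 / _ = 2 * (2 / (3 * a ^+ 2))); last by field; rewrite ?wn ?an.
apply: (@integralT_odd (fun s => (w s ^+ 5)^-1)
  (fun s => (s / w s - (s / w s) * (s / w s) * (s / w s) / 3) / a ^+ 2) c (2 / (3 * a ^+ 2))).
- by move=> t; rewrite invr_ge0 exprn_ge0// ltW.
- exact: wV_cont.
- move=> t; have u3 := is_derive_mul (is_derive_mul (du t) (du t)) (du t).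
  have H := (is_derive_mul (is_derive_sub (du t) (is_derive_mul u3 (is_derive_cst (3^-1 : R) t (1 : R))))
     (is_derive_cst ((a ^+ 2)^-1) t (1 : R))).
  rewrite /= in H; refine (is_derive_eq H _).
  have ta : t ^+ 2 = w t ^+ 2 - a by rewrite w2; ring.
  rewrite /=; transitivity ((a / w t ^+ 3 * (1 - t ^+ 2 / w t ^+ 2)) / a ^+ 2).
    by field; rewrite wn an.
  by rewrite ta; field; rewrite wn an.
- by move=> t; rewrite w_odd; ring.
- rewrite (_ : 2 / (3 * a ^+ 2) = (1 - 1 * 1 * 1 / 3) / a ^+ 2); last by field; rewrite ?wn ?an.
  apply: cvgM; last exact: cvg_cst.
  apply: cvgB; first exact: u_cvg.
  apply: cvgM; last exact: cvg_cst.
  by apply: cvgM; [apply: cvgM |]; exact: u_cvg.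
Qed.

Lemma integralT_sq2 c : (\int[mu]_t ((a + (t - c) ^+ 2) ^+ 2)^-1%:E =
  (pi / (2 * Num.sqrt a ^+ 3))%:E)%E.
Proof.
have sa : 0 < Num.sqrt a by rewrite sqrtr_gt0.
have sa2 : Num.sqrt a ^+ 2 = a by rewrite sqr_sqrtr// ltW.
have san : Num.sqrt a != 0 by rewrite gt_eqF.
rewrite (_ : pi / _ = 2 * (0 / (2 * a) + pi / 2 / (2 * Num.sqrt a ^+ 3))); last first.
  by rewrite mul0r add0r; field.
apply: (@integralT_odd (fun s => ((a + s ^+ 2) ^+ 2)^-1)
  (fun s => s / (a + s ^+ 2) / (2 * a) + atan (s / Num.sqrt a) / (2 * Num.sqrt a ^+ 3)) c
  (0 / (2 * a) + pi / 2 / (2 * Num.sqrt a ^+ 3))).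
- by move=> t; rewrite invr_ge0 sqr_ge0.
- apply: cont_at => s; rewrite (_ : (fun s => _) = (fun s => (w s ^+ 4)^-1)).
    exact: wV_cont.
  by apply/funext => x; rewrite -w2 -exprM.
- move=> t; have pn : a + t ^+ 2 != 0 by rewrite gt_eqF.
  have H : is_derive t (1 : R) (fun s : R => a + s ^+ 2) (2 * t).
    by apply: is_derive_eq; rewrite /GRing.scale /=; ring.
  have H1 := is_derive_mul (is_derive_mul (is_derive_id t (1 : R)) (@is_deriveV R (fun s : R => a + s ^+ 2) _ _ _ pn H))
    (is_derive_cst ((2 * a)^-1) t (1 : R)).
  have Ha := is_derive_mul (is_derive_id t (1 : R)) (is_derive_cst ((Num.sqrt a)^-1) t (1 : R)).
  have H2 := is_derive_mul (is_derive_comp (is_derive1_atan _) Ha)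
    (is_derive_cst ((2 * Num.sqrt a ^+ 3)^-1) t (1 : R)).
  apply: (is_derive_eq (is_derive_add H1 H2)); rewrite /GRing.scale /=.
  have alg (q b z : R) : b = q ^+ 2 -> q != 0 -> b + t ^+ 2 != 0 ->
     (1 / (b + t ^+ 2) + t * (- (b + t ^+ 2) ^- 2 * (2 * t))) / (2 * b) +
     t / (b + t ^+ 2) * 0 +
     ((1 + (t / q) ^+ 2)^-1 * (1 / q + t * 0) / (2 * q ^+ 3) + z * 0) = (b + t ^+ 2) ^- 2.
    move=> -> q0 qt; field.
    by rewrite q0 qt.
  by apply: alg.
- by move=> t; rewrite sqrrN !mulNr atanN !mulNr; ring.
- apply: cvgD; (apply: cvgM; last exact: cvg_cst).
    apply: (@cvgy_bound _ _ 1) => // t t1; have t0 : 0 < t by rewrite (lt_le_trans _ t1).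
    rewrite sub0r normrN ger0_norm; last by rewrite divr_ge0// ltW.
    rewrite ler_pdivrMr// mulrAC ler_pdivlMr// mul1r -expr2; rewrite lerDr ltW//.
  apply: (@cvg_comp _ _ _ (fun t => t / Num.sqrt a) (@atan R) _ +oo%R); last exact: cvgy_atan.
  apply/cvgryPge => A; near=> t; rewrite ler_pdivlMr//.
Unshelve. all: by end_near. Qed.

End sqrt.

Lemma integralT_oneDsqr c : (\int[mu]_t (1 + (t - c) ^+ 2)^-1%:E = pi%:E)%E.
Proof.
rewrite (_ : pi = 2 * (pi / 2)); last by field.
apply: (@integralT_odd (fun s => (1 + s ^+ 2)^-1) (@atan R) c (pi / 2)).
- by move=> t; rewrite invr_ge0 addr_ge0// sqr_ge0.
- apply: cont_at => s; apply: (@cont_comp _ _ _ (fun x : R => x^-1)).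
    by apply: cont_add; [exact: cont_cst | exact: exprn_continuous].
  by apply: inv_continuous; rewrite gt_eqF// ltr_wpDr// sqr_ge0.
- by move=> t; exact: atanN.
- exact: cvgy_atan.
Qed.

End improper.

(** * The regularized distance and its integrals *)

Section kernels.
Variable R : realType.
Local Notation mu := (@lebesgue_measure R).

(** Tonelli, integrating the last coordinate first; [h2] and [h1] are the
    closed forms of the two inner integrals. *)
Lemma iterated_integral (f : 'rV[R]_3 -> R) (h2 : R -> R -> R) (h1 : R -> R) (l : R) :
  (forall x, 0 <= f x) -> continuous f ->
  (forall x y, (\int[mu]_z (f (vec3 (x, y, z)))%:E = (h2 x y)%:E)%E) ->
  (forall x, (\int[mu]_y (h2 x y)%:E = (h1 x)%:E)%E) ->
  (\int[mu]_x (h1 x)%:E = l%:E)%E ->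
  (\int[mu3 R]_y (f (vec3 y))%:E = l%:E)%E.
Proof.
move=> f0 cf fh2 h21 h1l.
have mf : measurable_fun setT (EFin \o (f \o @vec3 R)).
  by apply/measurable_EFinP; exact: continuous_vec3_measurable.
have g0 z : (0 <= (EFin \o (f \o @vec3 R)) z)%E by rewrite /= lee_fin.
have F2 : fubini_F mu (EFin \o (f \o @vec3 R)) = (fun q : R * R => (h2 q.1 q.2)%:E).
  by apply/funext => -[x y]; exact: fh2.
have h20 q : (0 <= (h2 q.1 q.2)%:E)%E.
  by rewrite -fh2; apply: integral_ge0 => z _; rewrite lee_fin.
have m2 : measurable_fun setT (fun q : R * R => (h2 q.1 q.2)%:E).
  by have := @measurable_fun_fubini_tonelli_F _ _ _ _ R mu _ mf g0; rewrite F2.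
apply: etrans (@fubini_tonelli1 _ _ _ _ R (@leb2 R) mu _ mf g0) _.
transitivity (\int[@leb2 R]_q (h2 q.1 q.2)%:E)%E.
  by apply: eq_integral => q _; exact: (congr1 (fun g => g q) F2).
apply: etrans (@fubini_tonelli1 _ _ _ _ R mu mu _ m2 h20) _.
by rewrite -h1l; apply: eq_integral => x _; exact: h21.
Qed.

Lemma integral_scale (g : R -> R) (k l : R) : 0 <= k -> (forall t, 0 <= g t) ->
  measurable_fun setT g -> (\int[mu]_t (g t)%:E = l%:E)%E ->
  (\int[mu]_t (k * g t)%:E = (k * l)%:E)%E.
Proof.
move=> k0 g0 mg gl; under eq_integral do rewrite EFinM.
rewrite ge0_integralZl_EFin//; last 2 first.
- by move=> t _; rewrite lee_fin.
- exact/measurable_EFinP.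
by rewrite gl EFinM.
Qed.

Lemma sqdist_vec3 (p : 'rV[R]_3) (y : R * R * R) :
  sqdist p (vec3 y) = (y.1.1 - p 0 0) ^+ 2 + (y.1.2 - p 0 1) ^+ 2 + (y.2 - p 0 2) ^+ 2.
Proof.
rewrite /sqdist !big_ord_recl big_ord0 !mxE /= addr0 addrA.
by congr (_ + (_ - p 0 _) ^+ 2 + (_ - p 0 _) ^+ 2); apply/val_inj.
Qed.

Lemma inv_cont (g : R -> R) : (forall t, 0 < g t) -> continuous g ->
  continuous (fun t => (g t)^-1).
Proof.
move=> g0 cg; apply: cont_at => t; apply: (@cont_comp _ _ _ (fun x : R => x^-1)).
  exact: cg.
by apply: inv_continuous; rewrite gt_eqF.
Qed.

Lemma sq_cont (a c : R) : continuous (fun t : R => a + (t - c) ^+ 2).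
Proof.
apply: cont_at => t; apply: cont_add; first exact: cont_cst.
apply: (@cont_comp _ _ _ (fun x : R => x ^+ 2)); last exact: exprn_continuous.
by apply: cont_sub; [exact: cvg_id | exact: cont_cst].
Qed.

Variables (p : 'rV[R]_3) (e : R).
Hypothesis e0 : 0 < e.

(** The distance to [p], smoothed at scale [e]. *)
Definition regdist (y : 'rV[R]_3) : R := Num.sqrt (e ^+ 2 + sqdist p y).

Lemma regdist_arg_gt0 y : 0 < e ^+ 2 + sqdist p y.
Proof. by rewrite ltr_wpDr ?sqdist_ge0// exprn_gt0. Qed.

Lemma regdist_gt0 y : 0 < regdist y.
Proof. by rewrite sqrtr_gt0 regdist_arg_gt0. Qed.

Lemma regdist_sq y : regdist y ^+ 2 = e ^+ 2 + sqdist p y.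
Proof. by rewrite sqr_sqrtr// ltW// regdist_arg_gt0. Qed.

Lemma is_derive_regdist j y :
  is_derive y (delta_mx 0 j) regdist ((y 0 j - p 0 j) / regdist y).
Proof.
have H := is_derive_add (is_derive_cst (e ^+ 2 : R) y (delta_mx 0 j)) (is_derive_sqdist p y j).
have H2 := @is_derive_comp R _ _ (fun y => e ^+ 2 + sqdist p y) _ _ _ _
  (is_derive1_sqrt (regdist_arg_gt0 y)) H.
refine (is_derive_eq H2 _).
rewrite -/(regdist y) add0r; field.
by rewrite gt_eqF// regdist_gt0.
Qed.

Lemma cont_regdist : continuous regdist.
Proof.
apply: cont_at => y; apply: (@cont_comp _ _ _ (@Num.sqrt R)); last exact: sqrt_continuous.
by apply: cont_add; [exact: cont_cst | exact: cont_sqdist].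
Qed.

Lemma cont_regdistV n : continuous (fun y => (regdist y ^+ n)^-1).
Proof.
apply: cont_at => y; apply: (@cont_comp _ _ _ (fun x : R => x^-1)).
  apply: (@cont_comp _ _ _ (fun x : R => x ^+ n)); first exact: cont_regdist.
  exact: exprn_continuous.
by apply: inv_continuous; rewrite expf_neq0// gt_eqF// regdist_gt0.
Qed.

(** Integrating out the last coordinate replaces the exponent -5/2 of
    [e ^+ 2 + sqdist p] by -2, the next one by -3/2, and the first leaves
    a constant.  By scaling, the value does not depend on [e]. *)
Lemma integral_newton : (\int[mu3 R]_y (3 * e ^+ 2 / regdist (vec3 y) ^+ 5)%:E = (4 * pi)%:E)%E.
Proof.
pose b (x : R) := e ^+ 2 + (x - p 0 0) ^+ 2.
have b0 x : 0 < b x by rewrite /b ltr_wpDr ?sqr_ge0// exprn_gt0.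
pose a (x y : R) := b x + (y - p 0 1) ^+ 2.
have a0 x y : 0 < a x y by rewrite /a ltr_wpDr ?sqr_ge0.
have k0 : 0 <= 3 * e ^+ 2 by rewrite mulr_ge0// sqr_ge0.
apply: (@iterated_integral (fun y => 3 * e ^+ 2 / regdist y ^+ 5)
  (fun x y => 4 * e ^+ 2 * (a x y ^+ 2)^-1)
  (fun x => 2 * e ^+ 2 * pi * (Num.sqrt (b x) ^+ 3)^-1)).
- by move=> y; rewrite divr_ge0// exprn_ge0// ltW// regdist_gt0.
- by apply: cont_at => y; apply: cont_mul; [exact: cont_cst | exact: cont_regdistV].
- move=> x y; rewrite (_ : 4 * e ^+ 2 * _ = 3 * e ^+ 2 * (4 / (3 * a x y ^+ 2))); last first.
    by field; rewrite gt_eqF.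
  under eq_integral do rewrite /regdist sqdist_vec3 /= !addrA.
  apply: (@integral_scale (fun z => (Num.sqrt (a x y + (z - p 0 2) ^+ 2) ^+ 5)^-1)) => //; last exact: (integralT_sqrt5 (a0 x y)).
  apply: continuous_measurable_fun; apply: inv_cont.
    by move=> t; rewrite exprn_gt0// sqrtr_gt0 ltr_wpDr// sqr_ge0.
  apply: cont_at => t; apply: (@cont_comp _ _ _ (fun x : R => x ^+ 5)); last exact: exprn_continuous.
  by apply: (@cont_comp _ _ _ (@Num.sqrt R)); [exact: sq_cont | exact: sqrt_continuous].
- move=> x; rewrite (_ : 2 * e ^+ 2 * pi * _ = 4 * e ^+ 2 * (pi / (2 * Num.sqrt (b x) ^+ 3))); last first.
    by field; rewrite gt_eqF// sqrtr_gt0.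
  apply: (@integral_scale (fun y => ((b x + (y - p 0 1) ^+ 2) ^+ 2)^-1)); last exact: (integralT_sq2 (b0 x)).
  + by rewrite mulr_ge0// sqr_ge0.
  + by move=> t; rewrite invr_ge0 sqr_ge0.
  apply: continuous_measurable_fun; apply: inv_cont.
    by move=> t; rewrite exprn_gt0//; exact: (a0 x t).
  by apply: cont_at => t; apply: (@cont_comp _ _ _ (fun x : R => x ^+ 2)); [exact: sq_cont | exact: exprn_continuous].
- rewrite (_ : 4 * pi = 2 * e ^+ 2 * pi * (2 / e ^+ 2)); last by field; rewrite gt_eqF.
  apply: (@integral_scale (fun x => (Num.sqrt (b x) ^+ 3)^-1)); last by apply: integralT_sqrt3; rewrite exprn_gt0.
  + by rewrite mulr_ge0 ?pi_ge0// mulr_ge0// sqr_ge0.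
  + by move=> t; rewrite invr_ge0 exprn_ge0// sqrtr_ge0.
  apply: continuous_measurable_fun; apply: inv_cont.
    by move=> t; rewrite exprn_gt0// sqrtr_gt0.
  apply: cont_at => t; apply: (@cont_comp _ _ _ (fun x : R => x ^+ 3)); last exact: exprn_continuous.
  by apply: (@cont_comp _ _ _ (@Num.sqrt R)); [exact: sq_cont | exact: sqrt_continuous].
Qed.

End kernels.

Section weight.
Variables (R : realType) (p : 'rV[R]_3).
Local Notation mu := (@lebesgue_measure R).

(** The integrable majorant, of order [|y|^-4], for all error terms at infinity. *)
Definition weight (y : 'rV[R]_3) : R := ((1 + sqdist p y) ^+ 2)^-1.

Lemma weight_gt0 y : 0 < weight y.
Proof. by rewrite invr_gt0 exprn_gt0// ltr_wpDr// sqdist_ge0. Qed.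

Lemma integrable_weight : (mu3 R).-integrable setT (EFin \o (weight \o @vec3 R)).
Proof.
have cw : continuous weight.
  have -> : weight = (fun y => (regdist p 1 y ^+ 4)^-1).
    by apply/funext => y; rewrite (exprM _ 2 2) regdist_sq// expr1n.
  exact: cont_regdistV.
suff E : (\int[mu3 R]_y (weight (vec3 y))%:E = (pi ^+ 2)%:E)%E.
  apply/integrableP; split; first by apply/measurable_EFinP; exact: continuous_vec3_measurable.
  under eq_integral do rewrite /= ger0_norm ?(ltW (weight_gt0 _))//.
  by rewrite E ltry.
pose b (x : R) := 1 + (x - p 0 0) ^+ 2.
have b0 x : 0 < b x by rewrite /b ltr_wpDr ?sqr_ge0.
pose a (x y : R) := b x + (y - p 0 1) ^+ 2.
have a0 x y : 0 < a x y by rewrite /a ltr_wpDr ?sqr_ge0.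
apply: (@iterated_integral _ _
  (fun x y => pi / 2 * (Num.sqrt (a x y) ^+ 3)^-1)
  (fun x => pi * (b x)^-1)).
- by move=> y; exact/ltW/weight_gt0.
- exact: cw.
- move=> x y; under eq_integral do rewrite /weight sqdist_vec3 /= !addrA.
  rewrite (_ : pi / 2 * _ = pi / (2 * Num.sqrt (a x y) ^+ 3)); last first.
    by field; rewrite gt_eqF// sqrtr_gt0.
  exact: (integralT_sq2 (a0 x y)).
- move=> x; rewrite (_ : pi / b x = pi / 2 * (2 / b x)); last by field; rewrite gt_eqF.
  apply: (@integral_scale _ (fun y => (Num.sqrt (b x + (y - p 0 1) ^+ 2) ^+ 3)^-1)); last exact: (integralT_sqrt3 (b0 x)).
  + by rewrite divr_ge0// pi_ge0.
  + by move=> t; rewrite invr_ge0 exprn_ge0// sqrtr_ge0.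
  apply: continuous_measurable_fun; apply: inv_cont.
    by move=> t; rewrite exprn_gt0// sqrtr_gt0; exact: (a0 x t).
  apply: cont_at => t; apply: (@cont_comp _ _ _ (fun x : R => x ^+ 3)); last exact: exprn_continuous.
  by apply: (@cont_comp _ _ _ (@Num.sqrt R)); [exact: sq_cont | exact: sqrt_continuous].
- rewrite expr2; apply: (@integral_scale _ (fun x => (b x)^-1)); last exact: integralT_oneDsqr.
  + exact: pi_ge0.
  + by move=> t; rewrite invr_ge0 ltW.
  by apply: continuous_measurable_fun; apply: inv_cont => //; exact: sq_cont.
Qed.

End weight.

(** * Differentiability from a quadratic remainder *)

Section quadratic.
Variable R : realType.

Lemma near0_norm_le (V : normedModType R) (e : R) :
  0 < e -> \forall h \near (0 : V), `|h| <= e.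
Proof.
move=> e0; apply/nbhs_ballP; exists e => //= h.
by rewrite -ball_normE /= sub0r normrN => /ltW.
Qed.

Lemma row_continuous (T : topologicalType) m (f : T -> 'rV[R]_m) x :
  (forall j, {for x, continuous (fun y => f y 0 j)}) -> {for x, continuous f}.
Proof.
move=> cf; apply/cvgrPdist_le => e e0; near=> y.
apply/norm_rV_le; first exact: ltW.
move=> j; rewrite !mxE; move: j; near: y; apply: filter_forall => j.
by have /cvgrPdist_le := cf j; apply.
Unshelve. all: by end_near. Qed.

Lemma mulmx_continuous n m (M : 'M[R]_(n, m)) : continuous (fun h : 'rV[R]_n => h *m M).
Proof.
move=> h; apply: (@row_continuous _ _ (fun h : 'rV[R]_n => h *m M)) => j.
rewrite (_ : (fun y : 'rV[R]_n => (y *m M) 0 j) = (fun y : 'rV[R]_n => \sum_i y 0 i * M i j)).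
  by apply: cont_sum => i; apply: cont_mul; [exact: cont_coord | exact: cont_cst].
by apply/funext => y; rewrite mxE.
Qed.

(** Vectors are rows, so increments act from the left and [M] is the transposed
    Jacobian matrix. *)
Lemma quadratic_differentiable n m (f : 'rV[R]_n -> 'rV[R]_m) p (M : 'M[R]_(n, m)) K r :
  0 < r -> 0 <= K ->
  (forall h, `|h| <= r -> `|f (h + p) - (f p + h *m M)| <= K * `|h| ^+ 2) ->
  differentiable f p /\ forall j, partial j f p = row j M.
Proof.
move=> r0 K0 fK.
have fo e : 0 < e -> \forall h \near (0 : 'rV[R]_n),
    `|f (h + p) - (f p + h *m M)| <= e * `|h|.
  move=> e0; near=> h.
  have hr : `|h| <= r by near: h; exact: (@near0_norm_le 'rV[R]_n).
  have hK : `|h| <= e / (K + 1) by near: h; apply: (@near0_norm_le 'rV[R]_n); rewrite divr_gt0// ltr_wpDl.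
  apply: le_trans (fK _ hr) _.
  rewrite expr2 mulrA ler_wpM2r//.
  apply: le_trans (_ : (K + 1) * `|h| <= _); first by rewrite ler_wpM2r// lerDl.
  by rewrite mulrC -ler_pdivlMr// ltr_wpDl.
have dE : 'd f p = mulmxr M :> ('rV[R]_n -> 'rV[R]_m).
  apply: diff_unique; first exact: mulmx_continuous.
  by apply/eqaddoP => e e0; exact: fo.
have df : differentiable f p.
  apply/diff_locallyP; rewrite dE; split; first exact: mulmx_continuous.
  by apply/eqaddoP => e e0; exact: fo.
split=> // j; rewrite /partial deriveE// dE /= rowE //.
Unshelve. all: by end_near. Qed.

(** The left-hand side equals
    [(v - u) ^+ 2 * ((u ^+ 3)^-1 / 2 + (u ^+ 2)^-1 * v^-1)], which is of second
    order without any Taylor expansion.  The constant is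
    [3 ^+ 2 * (1 / 2 + 2)], the 2 being the bound of [d / v]. *)
Lemma inv_dist_expand (u v q t d : R) : 0 < d -> d <= u -> d / 2 <= v ->
  v ^+ 2 = u ^+ 2 + q -> `|v - u| <= 3 * t ->
  0 <= t ->
  `|v^-1 - u^-1 + q / (2 * u ^+ 3)| <= 45 / 2 / d ^+ 3 * t ^+ 2.
Proof.
move=> d0 du dv vq vut t0.
have u0 : 0 < u by rewrite (lt_le_trans d0).
have v0 : 0 < v by rewrite (lt_le_trans _ dv)// divr_gt0.
have -> : q = v ^+ 2 - u ^+ 2 by rewrite vq; ring.
have -> : v^-1 - u^-1 + (v ^+ 2 - u ^+ 2) / (2 * u ^+ 3) =
  (v - u) ^+ 2 * ((u ^+ 3)^-1 / 2 + (u ^+ 2)^-1 * v^-1).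
  by field; rewrite !gt_eqF.
have ui : u^-1 <= d^-1 by rewrite lef_pV2 ?posrE.
have vi : v^-1 <= 2 * d^-1.
  by rewrite (_ : 2 * d^-1 = (d / 2)^-1) ?lef_pV2 ?posrE ?divr_gt0//; field; rewrite gt_eqF.
have uV0 : 0 <= u^-1 by rewrite invr_ge0 ltW.
have vV0 : 0 <= v^-1 by rewrite invr_ge0 ltW.
have dV0 : 0 <= d^-1 by rewrite invr_ge0 ltW.
rewrite ger0_norm; last by rewrite mulr_ge0 ?sqr_ge0// -!exprVn addr_ge0 ?mulr_ge0 ?exprn_ge0.
rewrite (_ : 45 / 2 / d ^+ 3 * t ^+ 2 = (3 * t) ^+ 2 * ((d^-1) ^+ 3 / 2 + (d^-1) ^+ 2 * (2 * d^-1))); last first.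
  by field; rewrite gt_eqF.
rewrite -!exprVn; apply: ler_pM.
- exact: sqr_ge0.
- by rewrite addr_ge0 ?mulr_ge0 ?exprn_ge0.
- by rewrite -(real_normK (num_real (v - u))) ler_pXn2r ?nnegrE ?mulr_ge0.
- by apply: lerD; [rewrite ler_wpM2r// ler_pXn2r ?nnegrE | apply: ler_pM; rewrite ?exprn_ge0 ?ler_pXn2r ?nnegrE].
Qed.

End quadratic.

(** * The vector potential away from its sources *)

Section potential.
Variables (R : realType) (Omega : set 'rV[R]_3).
Hypothesis oO : open Omega.

Let D := @vec3 R @^-1` Omega.
Let mD : measurable D. Proof. exact: open_vec3_measurable. Qed.

Lemma vol_integrable_mul (f g : 'rV[R]_3 -> R) (M : R) :
  vol_integrable Omega f -> (forall y, Omega y -> {for y, continuous g}) ->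
  (forall y, Omega y -> `|g y| <= M) -> vol_integrable Omega (fun y => f y * g y).
Proof.
move=> fi cg gM.
have mg : measurable_fun D (g \o @vec3 R).
  by apply: open_continuous_vec3_measurable => // y; rewrite inE => /cg.
apply: (@integrableMl _ _ _ (mu3 R) D mD (EFin \o (f \o @vec3 R)) (g \o @vec3 R) fi mg).
exists M; split; first exact: num_real.
by move=> M' MM y Dy /=; rewrite (le_trans (gM _ Dy))// ltW.
Qed.

Lemma enorm_sqdist (x y : 'rV[R]_3) : enorm (x - y) = Num.sqrt (sqdist x y).
Proof.
by congr Num.sqrt; apply: eq_bigr => i _; rewrite !mxE -sqrrN opprB.
Qed.

Lemma enorm_sq (x y : 'rV[R]_3) : enorm (x - y) ^+ 2 = sqdist x y.
Proof. by rewrite enorm_sqdist sqr_sqrtr// sqdist_ge0. Qed.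

Lemma enorm_ge0 n (x : 'rV[R]_n) : 0 <= enorm x. Proof. exact: sqrtr_ge0. Qed.

Lemma coord_le_enorm n (x : 'rV[R]_n) i : `|x 0 i| <= enorm x.
Proof.
rewrite -(@ler_pXn2r _ 2) ?nnegrE ?enorm_ge0// real_normK ?num_real//.
rewrite sqr_sqrtr; last by apply: sumr_ge0 => j _; exact: sqr_ge0.
by rewrite (bigD1 i)//= lerDl; apply: sumr_ge0 => j _; exact: sqr_ge0.
Qed.

Lemma cont_enorm (x : 'rV[R]_3) : continuous (fun y : 'rV[R]_3 => enorm (x - y)).
Proof.
rewrite (_ : (fun y : 'rV[R]_3 => _) = (fun y => Num.sqrt (sqdist x y))); last first.
  by apply/funext => y; rewrite enorm_sqdist.
by apply: cont_at => y; apply: cont_comp; [exact: cont_sqdist | exact: sqrt_continuous].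
Qed.

Lemma cont_inv_enorm (x y : 'rV[R]_3) n : 0 < enorm (x - y) ->
  {for y, continuous (fun y : 'rV[R]_3 => (enorm (x - y) ^+ n)^-1)}.
Proof.
move=> xy; apply: (@cont_comp _ _ _ (fun t : R => t^-1)).
  apply: (@cont_comp _ _ _ (fun t : R => t ^+ n)); first exact: cont_enorm.
  exact: exprn_continuous.
by apply: inv_continuous; rewrite expf_neq0// gt_eqF.
Qed.

Variables (J : 'rV[R]_3 -> 'rV[R]_3) (p : 'rV[R]_3) (d : R).
Hypothesis iJ : forall i, vol_integrable Omega (fun y => J y 0 i).
Hypothesis d0 : 0 < d.
Hypothesis far : forall y, Omega y -> d <= enorm (p - y).

(** The partial derivative along axis [j] of [1 / (4 pi |x - y|)] with respect to
    [x], at [x = p]. *)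
Definition newton_grad (j : 'I_3) (y : 'rV[R]_3) : R :=
  (y 0 j - p 0 j) / (4 * pi * enorm (p - y) ^+ 3).

Let pi4 : 0 < 4 * pi :> R. Proof. by rewrite mulr_gt0 ?pi_gt0. Qed.

Lemma cont_newton_grad j y : Omega y -> {for y, continuous (newton_grad j)}.
Proof.
move=> Oy; have u0 : 0 < enorm (p - y) by exact: lt_le_trans (far Oy).
rewrite (_ : newton_grad j = (fun y => (y 0 j - p 0 j) * ((4 * pi)^-1 * (enorm (p - y) ^+ 3)^-1))); last first.
  by apply/funext => z; rewrite /newton_grad -invfM.
apply: cont_mul; first by apply: cont_sub; [exact: cont_coord | exact: cont_cst].
by apply: cont_mul; [exact: cont_cst | exact: cont_inv_enorm].
Qed.

Lemma newton_grad_bound j y : Omega y -> `|newton_grad j y| <= (4 * pi * d ^+ 2)^-1.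
Proof.
move=> Oy; have u0 : 0 < enorm (p - y) by exact: lt_le_trans (far Oy).
have uj : `|y 0 j - p 0 j| <= enorm (p - y).
  by have := coord_le_enorm (p - y) j; rewrite !mxE distrC.
rewrite /newton_grad normrM normfV (gtr0_norm (_ : 0 < 4 * pi * _)); last by rewrite mulr_gt0// exprn_gt0.
rewrite ler_pdivrMr; last by rewrite mulr_gt0// exprn_gt0.
apply: (le_trans uj).
have -> : (4 * pi * d ^+ 2)^-1 * (4 * pi * enorm (p - y) ^+ 3) =
    enorm (p - y) * (enorm (p - y) ^+ 2 / d ^+ 2).
  move: (pi_gt0 R); generalize (@pi R) => q q0.
  by field; rewrite (gt_eqF d0) (gt_eqF q0).
rewrite ler_peMr ?(ltW u0)// ler_pdivlMr ?exprn_gt0// mul1r ler_pXn2r ?nnegrE ?(ltW d0) ?(ltW u0)//.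
exact: far.
Qed.

(* Difference of two Euclidean distances in terms of the sup norm of h, obtained
   from the difference of their squares; 3 is the number of coordinates. *)
Let shifted_far h y : Omega y -> `|h| <= d / 6 ->
  d / 2 <= enorm (h + p - y) /\ `|enorm (h + p - y) - enorm (p - y)| <= 3 * `|h|.
Proof.
move=> Oy hd; set u := enorm (p - y); set v := enorm (h + p - y).
have u0 : 0 < u by exact: lt_le_trans (far Oy).
have v0 : 0 <= v by exact: enorm_ge0.
have uv : 0 < u + v by rewrite ltr_pwDl.
have vu : v ^+ 2 - u ^+ 2 = \sum_(j < 3) h 0 j * ((h 0 j + p 0 j - y 0 j) + (p 0 j - y 0 j)).
  rewrite /u /v !enorm_sq /sqdist -sumrB; apply: eq_bigr => j _; rewrite !mxE; ring.
have D1 : `|v - u| * (u + v) <= 3 * `|h| * (u + v).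
  rewrite -{1}(gtr0_norm uv) -normrM (_ : (v - u) * (u + v) = v ^+ 2 - u ^+ 2); last by ring.
  rewrite vu; apply: le_trans (ler_norm_sum _ _ _) _.
  apply: le_trans (_ : \sum_(j < 3) `|h| * (u + v) <= _); last first.
    by rewrite sumr_const card_ord -[leLHS]mulr_natl mulrA.
  apply: ler_sum => j _; rewrite normrM ler_pM ?coord_le_norm//.
  apply: le_trans (ler_normD _ _) _; rewrite addrC lerD//.
    by have := coord_le_enorm (p - y) j; rewrite !mxE.
  by have := coord_le_enorm (h + p - y) j; rewrite !mxE.
have D2 : `|v - u| <= 3 * `|h| by rewrite ler_pM2r in D1.
split=> //; have := far Oy; rewrite -/u => du.
by move: D2; rewrite ler_norml => /andP[D2 _]; lra.
Qed.

(* The first-order Taylor remainder, in h, of the Newton kernel at p. *)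
Let remainder (h y : 'rV[R]_3) : R :=
  (4 * pi * enorm (h + p - y))^-1 - (4 * pi * enorm (p - y))^-1
    - \sum_(j < 3) h 0 j * newton_grad j y.

Let remainder_bound h y : Omega y -> `|h| <= d / 6 ->
  `|remainder h y| <= (4 * pi)^-1 * (24 / d ^+ 3) * `|h| ^+ 2.
Proof.
move=> Oy hd; have [dv uv] := shifted_far Oy hd.
rewrite /remainder; set u := enorm (p - y); set v := enorm (h + p - y).
rewrite -/v -/u in dv uv.
have u0 : 0 < u by exact: lt_le_trans (far Oy).
have v0 : 0 < v by rewrite (lt_le_trans _ dv)// divr_gt0.
pose s := \sum_(j < 3) h 0 j ^+ 2.
have vu : v ^+ 2 = u ^+ 2 + (s - 2 * \sum_(j < 3) h 0 j * (y 0 j - p 0 j)).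
  rewrite /u /v !enorm_sq /sqdist mulr_sumr -sumrB -big_split /=.
  by apply: eq_bigr => j _; rewrite !mxE; ring.
have E := inv_dist_expand d0 (far Oy) dv vu uv (normr_ge0 h).
have s0 : 0 <= s by apply: sumr_ge0 => j _; exact: sqr_ge0.
have sh : s <= 3 * `|h| ^+ 2.
  apply: le_trans (_ : \sum_(j < 3) `|h| ^+ 2 <= _); last first.
    by rewrite sumr_const card_ord -[leLHS]mulr_natl.
  apply: ler_sum => j _; rewrite -(real_normK (num_real _)) ler_pXn2r ?nnegrE//.
  exact: coord_le_norm.
have -> : (4 * pi * v)^-1 - (4 * pi * u)^-1 - \sum_(j < 3) h 0 j * newton_grad j y =
   (4 * pi)^-1 * ((v^-1 - u^-1 + (s - 2 * \sum_(j < 3) h 0 j * (y 0 j - p 0 j)) / (2 * u ^+ 3)) - s / (2 * u ^+ 3)).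
  have -> : \sum_(j < 3) h 0 j * newton_grad j y =
     (\sum_(j < 3) h 0 j * (y 0 j - p 0 j)) / (4 * pi * u ^+ 3).
    by rewrite mulr_suml; apply: eq_bigr => j _; rewrite /newton_grad -/u mulrA.
  move: (pi_gt0 R); generalize (@pi R) => q q0.
  by field; rewrite (gt_eqF u0) (gt_eqF v0) (gt_eqF q0).
rewrite normrM gtr0_norm ?invr_gt0// -mulrA ler_pM2l ?invr_gt0//.
apply: le_trans (ler_normB _ _) _.
(* The linear term of v^2 - u^2 gives the gradient; its square term s adds
   3 / 2 to the constant 45 / 2 of inv_dist_expand. *)
rewrite (_ : 24 / d ^+ 3 * _ = 45 / 2 / d ^+ 3 * `|h| ^+ 2 + 3 * `|h| ^+ 2 * (2 * d ^+ 3)^-1); last first.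
  by field; rewrite gt_eqF.
apply: lerD => //; rewrite ger0_norm; last by rewrite divr_ge0// mulr_ge0// exprn_ge0// ltW.
apply: ler_pM => //; first by rewrite invr_ge0 mulr_ge0// exprn_ge0// ltW.
rewrite lef_pV2 ?posrE ?mulr_gt0 ?exprn_gt0// ler_pM2l// ler_pXn2r ?nnegrE ?(ltW d0) ?(ltW u0)//.
exact: far.
Qed.

(** The Taylor remainder of the kernel is quadratic in the increment uniformly
    for sources in [Omega], so integrating it against [J] leaves a quadratic
    remainder for the potential. *)
Lemma vector_potential_differentiable :
  differentiable (vector_potential Omega J) p /\
  forall j i, partial j (vector_potential Omega J) p 0 i =
    vol_integral Omega (fun y => J y 0 i * newton_grad j y).
Proof.
pose M : 'M[R]_3 := \matrix_(j, i) vol_integral Omega (fun y => J y 0 i * newton_grad j y).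
pose N := \sum_(i < 3) vol_integral Omega (fun y => `|J y 0 i|).
have iN i : (mu3 R).-integrable D (EFin \o ((fun y => `|J y 0 i|) \o @vec3 R)).
  exact: (integrable_norm (iJ i)).
have N0 i : 0 <= vol_integral Omega (fun y => `|J y 0 i|).
  by apply: Rintegral_ge0.
have C0 : 0 <= (4 * pi)^-1 * (24 / d ^+ 3).
  rewrite mulr_ge0 ?invr_ge0 ?(ltW pi4)//.
  by rewrite divr_ge0// exprn_ge0// ltW.
have K0 : 0 <= (4 * pi)^-1 * (24 / d ^+ 3) * N by rewrite mulr_ge0// sumr_ge0.
have r0 : 0 < d / 6 by rewrite divr_gt0.
suff H h : `|h| <= d / 6 -> `|vector_potential Omega J (h + p) -
    (vector_potential Omega J p + h *m M)| <= (4 * pi)^-1 * (24 / d ^+ 3) * N * `|h| ^+ 2.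
  have [dA pA] := quadratic_differentiable r0 K0 H.
  by split => // j i; rewrite pA !mxE.
move=> hd; apply/norm_rV_le; first by rewrite mulr_ge0 ?sqr_ge0.
move=> i; rewrite !mxE.
have k1 (x : 'rV[R]_3) c : 0 < c -> (forall y, Omega y -> c <= enorm (x - y)) ->
    vol_integrable Omega (fun y => J y 0 i / (4 * pi * enorm (x - y))).
  move=> c0 xc; apply: (@vol_integrable_mul _ _ ((4 * pi * c)^-1) (iJ i)) => y Oy.
    have := @cont_inv_enorm x y 1 (lt_le_trans c0 (xc _ Oy)) => H.
    rewrite (_ : (fun y => _) = (fun y => (4 * pi)^-1 * (enorm (x - y) ^+ 1)^-1)).
      by apply: cont_mul; [exact: cont_cst | exact: H].
    by apply/funext => z; rewrite invfM.
  have e0 := lt_le_trans c0 (xc _ Oy).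
  rewrite ger0_norm; last by rewrite invr_ge0 mulr_ge0 ?enorm_ge0 ?(ltW pi4).
  have e1 : 0 < 4 * pi * enorm (x - y) by rewrite mulr_gt0 ?pi4.
  have e2 : 0 < 4 * pi * c by rewrite mulr_gt0 ?pi4.
  by rewrite lef_pV2 ?posrE// ler_pM2l ?pi4// xc.
have I1 : (mu3 R).-integrable D (EFin \o ((fun y => J y 0 i / (4 * pi * enorm (h + p - y))) \o @vec3 R)).
  by apply: (k1 (h + p) (d / 2)) => [|y Oy]; [rewrite divr_gt0 | exact: (shifted_far Oy hd).1].
have I2 : (mu3 R).-integrable D (EFin \o ((fun y => J y 0 i / (4 * pi * enorm (p - y))) \o @vec3 R)).
  exact: k1 far.
have I3 j : (mu3 R).-integrable D (EFin \o ((fun y => h 0 j * (J y 0 i * newton_grad j y)) \o @vec3 R)).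
  have H : vol_integrable Omega (fun y => J y 0 i * newton_grad j y).
    by apply: (vol_integrable_mul (iJ i)); [exact: cont_newton_grad | exact: newton_grad_bound].
  by have := @integrableZl _ _ _ (mu3 R) D mD (h 0 j) _ H.
have [I4 E4] := @Rintegral_sum_ord R _ _ (mu3 R) D 3
  (fun j y => h 0 j * (J (vec3 y) 0 i * newton_grad j (vec3 y))) mD I3.
have -> : \sum_j h 0 j * M j i = \int[mu3 R]_(y in D) \sum_(j < 3) (h 0 j * (J (vec3 y) 0 i * newton_grad j (vec3 y))).
  rewrite E4; apply: eq_bigr => j _; rewrite mxE /vol_integral.
  rewrite -RintegralZl//.
  by apply: (vol_integrable_mul (iJ i)); [exact: cont_newton_grad | exact: newton_grad_bound].
have I12 : (mu3 R).-integrable D (EFin \o ((fun y => J y 0 i / (4 * pi * enorm (h + p - y)) -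
    J y 0 i / (4 * pi * enorm (p - y))) \o @vec3 R)).
  by have := integrableB (mu := mu3 R) mD I1 I2; apply: eq_integrable.
have Ir : (mu3 R).-integrable D (EFin \o ((fun y => J y 0 i * remainder h y) \o @vec3 R)).
  have := integrableB (mu := mu3 R) mD I12 I4; apply: eq_integrable => // y _ /=.
  rewrite -EFinB; congr (_%:E); rewrite /remainder !mulrBr; congr (_ - _).
  by rewrite mulr_sumr; apply: eq_bigr => j _; rewrite mulrCA.
rewrite opprD addrA /vol_integral -(RintegralB (mu := mu3 R) mD I1 I2) -(RintegralB (mu := mu3 R) mD I12 I4).
rewrite (_ : \int[mu3 R]_(y in D) _ = \int[mu3 R]_(y in D) (J (vec3 y) 0 i * remainder h (vec3 y))); last first.
  apply: eq_Rintegral => y _ /=; rewrite /remainder !mulrBr; congr (_ - _).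
  by rewrite mulr_sumr; apply: eq_bigr => j _; rewrite mulrCA.
apply: le_trans (le_normr_Rintegral (mu := mu3 R) mD Ir) _.
pose c := (4 * pi)^-1 * (24 / d ^+ 3) * `|h| ^+ 2.
have Ic : (mu3 R).-integrable D (EFin \o ((fun y => `|J y 0 i| * c) \o @vec3 R)).
  exact: (integrableZr (mu := mu3 R) mD _ (iN i)).
apply: le_trans (_ : \int[mu3 R]_(y in D) (`|J (vec3 y) 0 i| * c) <= _).
  apply: le_Rintegral => //; first exact: (integrable_norm Ir).
  move=> y Oy; rewrite normrM ler_wpM2l//.
  exact: remainder_bound.
rewrite (RintegralZr (mu := mu3 R) _ mD (iN i)) mulrAC -/c mulrC ler_wpM2l//.
  by rewrite /c mulr_ge0 ?sqr_ge0.
by rewrite /N (bigD1 i)//= lerDl sumr_ge0.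
Qed.

End potential.

(** * Derivatives of the regularized Newton kernel *)

Section newton_kernel.
Variables (R : realType) (p : 'rV[R]_3) (e : R).
Hypothesis e0 : 0 < e.
Local Notation w := (regdist p e).

(** The partial derivatives of [1 / regdist p e]. *)
Definition reg_grad (j : 'I_3) (y : 'rV[R]_3) : R := (p 0 j - y 0 j) * (w y ^+ 3)^-1.

(** The second partial derivatives of [1 / regdist p e]. *)
Definition reg_hess (l j : 'I_3) (y : 'rV[R]_3) : R :=
  3 * (y 0 j - p 0 j) * (y 0 l - p 0 l) * (w y ^+ 5)^-1 - (l == j)%:R * (w y ^+ 3)^-1.

Lemma is_derive_reg_grad l j y :
  is_derive y (delta_mx 0 l) (reg_grad j) (reg_hess l j y).
Proof.
have w0 := regdist_gt0 p e0 y.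
have dw := is_derive_regdist p e0 l y.
have dw3 := is_derive_mul (is_derive_mul dw dw) dw.
have wn : w y * w y * w y != 0 by rewrite !mulf_neq0 ?gt_eqF.
have inv3 : is_derive (w y * w y * w y) (1 : R) (fun t : R => t^-1) (- (w y * w y * w y) ^- 2).
  have Hi := @is_deriveV R (fun t : R => t) _ _ _ wn (is_derive_id _ (1 : R)).
  by refine (is_derive_eq Hi _); rewrite /GRing.scale /= mulr1.
have dV3 := @is_derive_comp R _ (fun t : R => t^-1) (fun y => w y * w y * w y) _ _ _ _ inv3 dw3.
have dp := is_derive_sub (is_derive_cst (p 0 j) y (delta_mx 0 l)) (is_derive_coord j y (delta_mx 0 l)).
have H := is_derive_mul dp dV3.
rewrite (_ : reg_grad j = (fun y => (p 0 j - y 0 j) * (w y * w y * w y)^-1)); last first.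
  by apply/funext => z; rewrite /reg_grad !exprS expr0 mulr1 mulrA.
refine (is_derive_eq H _).
rewrite /= /reg_hess !mxE eqxx /= (eq_sym l j).
by field; rewrite gt_eqF.
Qed.

Lemma cont_reg_grad j : continuous (reg_grad j).
Proof.
apply: cont_at => y; apply: cont_mul; last exact: cont_regdistV.
by apply: cont_sub; [exact: cont_cst | exact: cont_coord].
Qed.

Lemma cont_reg_hess l j : continuous (reg_hess l j).
Proof.
have c i y : {for y, continuous (fun y : 'rV[R]_3 => y 0 i - p 0 i)}.
  by apply: cont_sub; [exact: cont_coord | exact: cont_cst].
apply: cont_at => y; apply: cont_sub; last first.
  by apply: cont_mul; [exact: cont_cst | exact: cont_regdistV].
apply: cont_mul; last exact: cont_regdistV.
by apply: cont_mul => //; apply: cont_mul => //; exact: cont_cst.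
Qed.

Lemma reg_hessC l j y : reg_hess l j y = reg_hess j l y.
Proof. by rewrite /reg_hess eq_sym; congr (_ * _ - _); ring. Qed.

(** Minus the Laplacian of [1 / regdist p e]: 4 pi times a smoothed unit point
    mass at [p]. *)
Definition newton_density (y : 'rV[R]_3) : R := 3 * e ^+ 2 / w y ^+ 5.

Lemma reg_laplacian y : \sum_j reg_hess j j y = - newton_density y.
Proof.
have w0 := regdist_gt0 p e0 y.
transitivity (3 * sqdist p y * (w y ^+ 5)^-1 - 3 * (w y ^+ 3)^-1).
  rewrite /reg_hess sumrB -mulr_suml; congr (_ * _ - _).
    by rewrite /sqdist mulr_sumr; apply: eq_bigr => j _; ring.
  under eq_bigr do rewrite eqxx mul1r.
  by rewrite sumr_const card_ord -[LHS]mulr_natl.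
have -> : sqdist p y = w y ^+ 2 - e ^+ 2 by rewrite regdist_sq//; ring.
by rewrite /newton_density; field; rewrite gt_eqF.
Qed.

Lemma newton_density_gt0 y : 0 < newton_density y.
Proof. by rewrite divr_gt0 ?mulr_gt0 ?exprn_gt0// regdist_gt0. Qed.

Lemma cont_newton_density : continuous newton_density.
Proof.
by apply: cont_at => y; apply: cont_mul; [exact: cont_cst | exact: cont_regdistV].
Qed.

Lemma coord_le_regdist j (y : 'rV[R]_3) : `|p 0 j - y 0 j| <= w y.
Proof.
have w0 := regdist_gt0 p e0 y.
rewrite -(@ler_pXn2r _ 2) ?nnegrE ?(ltW w0)// real_normK ?num_real// regdist_sq//.
rewrite -sqrrN opprB; apply: le_trans (sqdist_coord p y j) _.
by rewrite lerDr sqr_ge0.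
Qed.

Lemma reg_grad_bound j y : `|reg_grad j y| <= (w y ^+ 2)^-1.
Proof.
have w0 := regdist_gt0 p e0 y.
rewrite /reg_grad normrM normfV (gtr0_norm (exprn_gt0 _ w0)).
rewrite ler_pdivrMr ?exprn_gt0// (_ : _ * w y ^+ 3 = w y); last by field; rewrite gt_eqF.
exact: coord_le_regdist.
Qed.

Lemma integrable_newton_density : (mu3 R).-integrable setT (EFin \o (newton_density \o @vec3 R)).
Proof.
apply/integrableP; split.
  by apply/measurable_EFinP; exact: continuous_vec3_measurable cont_newton_density.
under eq_integral do rewrite /= ger0_norm ?(ltW (newton_density_gt0 _))//.
by rewrite integral_newton// ltry.
Qed.

Lemma Rintegral_newton_density : \int[mu3 R]_y newton_density (vec3 y) = 4 * pi.
Proof. by rewrite /Rintegral integral_newton. Qed.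

End newton_kernel.

Lemma regdist1_ge1 (R : realType) (p y : 'rV[R]_3) : 1 <= regdist p 1 y.
Proof.
have w0 := regdist_gt0 p (@ltr01 R) y.
rewrite -(@ler_pXn2r _ 2) ?nnegrE ?(ltW w0)// regdist_sq// expr1n lerDl.
exact: sqdist_ge0.
Qed.

Lemma weightE (R : realType) (p y : 'rV[R]_3) : weight p y = (regdist p 1 y ^+ 4)^-1.
Proof. by rewrite (exprM _ 2 2) regdist_sq// expr1n. Qed.

(** * A solenoidal field is recovered from its curl *)

Lemma cvg_sum_ord (R : realType) n (f : 'I_n -> nat -> R) (l : 'I_n -> R) :
  (forall j, f j x @[x --> \oo] --> l j) ->
  (\sum_(j < n) f j x) @[x --> \oo] --> \sum_(j < n) l j.
Proof.
elim: n f l => [|n IH] f l fl.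
  rewrite big_ord0; under eq_fun do rewrite big_ord0; exact: cvg_cst.
rewrite big_ord_recr /=; under eq_fun do rewrite big_ord_recr /=.
by apply: cvgD; [apply: IH => j; exact: fl | exact: fl].
Qed.

Section representation.
Variables (R : realType) (Gam : set 'rV[R]_3).
Hypothesis cGam : closed Gam.
Hypothesis bGam : bounded_set Gam.
Hypothesis graphGam : forall p : 'rV[R]_3, exists i G dG, C1_graph_fun i G dG /\
  \forall x \near p, Gam x -> (x : 'rV[R]_3) 0 i = G x.
Variables (V : 'I_3 -> 'rV[R]_3 -> R) (dV : 'I_3 -> 'I_3 -> 'rV[R]_3 -> R).
Hypothesis cV : forall k, continuous (V k).
Hypothesis VdV : forall j k x, ~ Gam x ->
  is_derive x (delta_mx 0 j) (V k) (dV j k x) /\ {for x, continuous (dV j k)}.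
Hypothesis divV : forall x, ~ Gam x -> \sum_j dV j j x = 0.
Variable W : 'I_3 -> 'I_3 -> 'rV[R]_3 -> R.
Hypothesis dVW : forall j k x, ~ Gam x -> dV j k x - dV k j x = W j k x.
Hypothesis iW : forall j k, (mu3 R).-integrable setT (EFin \o (W j k \o @vec3 R)).
Variables (p : 'rV[R]_3) (C : R).
Hypothesis C0 : 0 <= C.
Hypothesis VC : forall k y, `|V k y| <= C / regdist p 1 y.

Let q := regdist p 1.
Let q1 y : 1 <= q y. Proof. exact: regdist1_ge1. Qed.
Let q0 y : 0 < q y. Proof. by rewrite (lt_le_trans ltr01). Qed.

Let V_bounded j y : `|V j y| <= C.
Proof. by apply: le_trans (VC j y) _; rewrite ler_piMr// invf_le1. Qed.

Section fixed_regularization.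
Variable e : R.
Hypothesis e01 : 0 < e <= 1.
Let e0 : 0 < e. Proof. by case/andP: e01. Qed.

Local Notation w := (regdist p e).
Local Notation g := (reg_grad p e).
Local Notation dg := (reg_hess p e).
Local Notation rho := (newton_density p e).

Let w0 y : 0 < w y. Proof. exact: regdist_gt0. Qed.

Variable k : 'I_3.

(* The last term of H_j is the gradient in the index k of V . g; it removes from
   the divergence the second derivatives of 1 / w contracted with V, leaving
   only its Laplacian, and turns d_j V_k into d_j V_k - d_k V_j. *)
Let H (j : 'I_3) (y : 'rV[R]_3) : R :=
  V k y * g j y + V j y * g k y - (j == k)%:R * \sum_(l < 3) V l y * g l y.

(* D j is the j-th partial derivative of H j, and K the divergence of H, with
   the derivatives of V eliminated in favour of W. *)
Let D (j : 'I_3) (y : 'rV[R]_3) : R :=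
  (dV j k y * g j y + V k y * dg j j y) + (dV j j y * g k y + V j y * dg j k y)
  - (0 * (\sum_(l < 3) V l y * g l y) + (j == k)%:R * \sum_(l < 3) (dV j l y * g l y + V l y * dg j l y)).

Let K (y : 'rV[R]_3) : R := \sum_(j < 3) W j k y * g j y - V k y * rho y.

Let H_cont j : continuous (H j).
Proof.
have c a b : continuous (fun y => V a y * g b y).
  by apply: cont_at => y; apply: cont_mul; [exact: cV | exact: cont_reg_grad].
apply: cont_at => y; apply: cont_sub; first by apply: cont_add; exact: c.
by apply: cont_mul; [exact: cont_cst | apply: cont_sum => l; exact: c].
Qed.

Let H_derive j y : ~ Gam y -> is_derive y (delta_mx 0 j) (H j) (D j y).
Proof.
move=> Gy.
have dd a b : is_derive y (delta_mx 0 j) (fun y => V a y * g b y) (dV j a y * g b y + V a y * dg j b y).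
  exact: (is_derive_mul (VdV j a Gy).1 (is_derive_reg_grad p e0 j b y)).
have ds : is_derive y (delta_mx 0 j) (fun y => \sum_(l < 3) V l y * g l y)
    (\sum_(l < 3) (dV j l y * g l y + V l y * dg j l y)).
  have -> : (fun y => \sum_(l < 3) V l y * g l y) = \sum_(l < 3) (fun y => V l y * g l y).
    by apply/funext => z; rewrite fct_sumE.
  by apply: is_derive_sum => l; exact: dd.
exact: (is_derive_sub (is_derive_add (dd k j) (dd j k))
  (is_derive_mul (is_derive_cst ((j == k)%:R : R) y (delta_mx 0 j)) ds)).
Qed.

Let D_cont j y : ~ Gam y -> {for y, continuous (D j)}.
Proof.
move=> Gy.
have c1 a b : {for y, continuous (fun y => V a y * g b y)}.
  by apply: cont_mul; [exact: cV | exact: cont_reg_grad].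
have c2 a b : {for y, continuous (fun y => dV j a y * g b y + V a y * dg j b y)}.
  apply: cont_add; apply: cont_mul; first exact: (VdV j a Gy).2.
  - exact: cont_reg_grad.
  - exact: cV.
  - exact: cont_reg_hess.
apply: cont_sub; first by apply: cont_add; exact: c2.
apply: cont_add; apply: cont_mul; try exact: cont_cst.
- by apply: cont_sum => l; exact: c1.
- by apply: cont_sum => l; exact: c2.
Qed.

Let K_div y : ~ Gam y -> K y = \sum_(j < 3) D j y.
Proof.
move=> Gy; rewrite /D sumrB !big_split /=.
have -> : \sum_(j < 3) 0 * (\sum_(l < 3) V l y * g l y) = 0.
  by rewrite big1// => j _; rewrite mul0r.
have -> : \sum_(j < 3) (j == k)%:R * (\sum_(l < 3) (dV j l y * g l y + V l y * dg j l y)) =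
    \sum_(l < 3) dV k l y * g l y + \sum_(l < 3) V l y * dg l k y.
  rewrite (bigD1 k)//= eqxx mul1r [X in _ + X]big1; last first.
    by move=> j jk; rewrite (negbTE jk) mul0r.
  rewrite addr0.
  by rewrite big_split /=; congr (_ + _); apply: eq_bigr => l _; rewrite reg_hessC.
rewrite -!mulr_suml divV// mul0r -mulr_sumr reg_laplacian// add0r.
rewrite /K.
have -> : \sum_(j < 3) W j k y * g j y = \sum_(j < 3) dV j k y * g j y - \sum_(j < 3) dV k j y * g j y.
  by rewrite -sumrB; apply: eq_bigr => j _; rewrite -dVW// mulrBl.
by rewrite add0r; ring.
Qed.

Let integrable_Wg j : (mu3 R).-integrable setT (EFin \o ((fun y => W j k y * g j y) \o @vec3 R)).
Proof.
have mg : measurable_fun setT (g j \o @vec3 R).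
  by apply: continuous_vec3_measurable; exact: cont_reg_grad.
apply: (@integrableMl _ _ _ (mu3 R) setT measurableT _ (g j \o @vec3 R) (iW j k) mg).
exists ((e ^+ 2)^-1); split; first exact: num_real.
move=> M' MM y _ /=; apply/ltW; apply: le_lt_trans MM.
apply: le_trans (reg_grad_bound p e0 j _) _.
by rewrite lef_pV2 ?posrE ?exprn_gt0// regdist_sq// lerDl sqdist_ge0.
Qed.

Let integrable_Vrho : (mu3 R).-integrable setT (EFin \o ((fun y => V k y * rho y) \o @vec3 R)).
Proof.
have mV : measurable_fun setT (V k \o @vec3 R) by exact: continuous_vec3_measurable.
apply: (@integrableMr _ _ _ (mu3 R) setT measurableT (V k \o @vec3 R)
  (EFin \o (rho \o @vec3 R)) mV).
  exists C; split; first exact: num_real.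
  by move=> M' MM y _ /=; apply/ltW; apply: le_lt_trans MM; exact: V_bounded.
exact: integrable_newton_density.
Qed.

Let integrable_WgS : (mu3 R).-integrable setT (EFin \o ((fun y => \sum_(j < 3) W j k y * g j y) \o @vec3 R)).
Proof.
exact: (@Rintegral_sum_ord R _ _ (mu3 R) setT 3 (fun j y => W j k (vec3 y) * g j (vec3 y)) measurableT integrable_Wg).1.
Qed.

Let integrable_K : (mu3 R).-integrable setT (EFin \o (K \o @vec3 R)).
Proof.
by have := integrableB (mu := mu3 R) measurableT integrable_WgS integrable_Vrho; apply: eq_integrable.
Qed.

(* Five terms, each at most (C / q) (2 / q^2). *)
Let H_bound j y : q y ^+ 2 <= 2 * sqdist p y -> `|H j y| <= 10 * C / q y ^+ 3.
Proof.
move=> qs.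
have gb i : `|g i y| <= 2 / q y ^+ 2.
  apply: le_trans (reg_grad_bound p e0 i y) _.
  rewrite (_ : 2 / q y ^+ 2 = (q y ^+ 2 / 2)^-1); last by field; rewrite gt_eqF.
  rewrite lef_pV2 ?posrE ?divr_gt0 ?exprn_gt0// regdist_sq//.
  rewrite ler_pdivrMr//; have := sqr_ge0 e; lra.
have Vg a b : `|V a y * g b y| <= C / q y * (2 / q y ^+ 2).
  by rewrite normrM ler_pM// VC.
rewrite (_ : 10 * C / q y ^+ 3 = C / q y * (2 / q y ^+ 2) + C / q y * (2 / q y ^+ 2) + 3 * (C / q y * (2 / q y ^+ 2))); last first.
  by field; rewrite gt_eqF.
have c0 : 0 <= C / q y * (2 / q y ^+ 2).
  by rewrite mulr_ge0 ?divr_ge0 ?exprn_ge0 ?(ltW (q0 y)).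
apply: le_trans (ler_normB _ _) _; apply: lerD.
  by apply: le_trans (ler_normD _ _) _; apply: lerD.
rewrite normrM; apply: le_trans (_ : 1 * \sum_(l < 3) `|V l y * g l y| <= _).
  apply: ler_pM => //; last exact: ler_norm_sum.
  by case: (j == k); rewrite ?normr1 ?normr0.
rewrite mul1r; apply: le_trans (_ : \sum_(l < 3) C / q y * (2 / q y ^+ 2) <= _).
  by apply: ler_sum => l _; exact: Vg.
by rewrite sumr_const card_ord -[leLHS]mulr_natl.
Qed.

(* On the annulus where the bump is not constant, r^2 and q^2 are comparable:
   q^2 <= 1 + 3 r^2 <= 4 r^2. *)
Let dbump_bound r j y : 1 <= r ->
  `|dbump p r j y| <= 12 / q y /\ (dbump p r j y != 0 -> q y ^+ 2 <= 2 * sqdist p y).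
Proof.
move=> r1; have r0 : 0 < r by rewrite (lt_le_trans ltr01).
have [s1|s1] := leP (sqdist p y) (r ^+ 2).
  have [_ ->] := bump_in r0 s1; rewrite normr0 eqxx; split=> //.
  by rewrite divr_ge0// ltW.
have [s3|s3] := leP (3 * r ^+ 2) (sqdist p y).
  have [_ ->] := bump_out r0 s3; rewrite normr0 eqxx; split=> //.
  by rewrite divr_ge0// ltW.
have r21 : 1 <= r ^+ 2 by rewrite exprn_ege1.
have qs : q y ^+ 2 <= 2 * sqdist p y by rewrite regdist_sq// expr1n; lra.
split=> //.
rewrite /dbump normrM normrN.
have /andP[h0 h1] := dstep_bound (3 - sqdist p y / r ^+ 2).
rewrite (ger0_norm h0) -[leRHS]mul1r; apply: ler_pM => //.
rewrite normrM normrM (ger0_norm (_ : 0 <= 2))// normfV (ger0_norm (sqr_ge0 r)).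
rewrite ler_pdivrMr ?exprn_gt0//.
have cq : `|y 0 j - p 0 j| <= q y by rewrite distrC; exact: coord_le_regdist.
apply: le_trans (_ : 2 * q y <= _); first by rewrite ler_pM2l.
rewrite mulrAC ler_pdivlMr// -mulrA -expr2; lra.
Qed.

(** [Rintegral_div0] for [H] cut off at distance [r n] from [p].  The gradient of
    the cut-off is O(1/q) and [H] is O(1/q^3), so the additional term is
    dominated by the integrable function [weight p] and converges to 0
    pointwise. *)
Lemma Rintegral_divergence_K : \int[mu3 R]_y K (vec3 y) = 0.
Proof.
pose r (n : nat) : R := n.+1%:R.
have r1 n : 1 <= r n by rewrite ler1n.
have r0 n : 0 < r n by rewrite ltr0n.
pose F n (y : 'rV[R]_3) : R := \sum_(j < 3) dbump p (r n) j y * H j y + bump p (r n) y * K y.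
have far n y : `|p| + 2 * r n < `|y| -> 3 * r n ^+ 2 <= sqdist p y.
  move=> yL; rewrite leNgt; apply/negP => s3.
  have : `|p - y| <= 2 * r n.
    apply: sqdist_norm; first by rewrite mulr_ge0// ltW.
    by rewrite exprMn; apply: le_trans (ltW s3) _; rewrite ler_pM2r ?exprn_gt0//; lra.
  by have := ler_normD p (y - p); rewrite subrKC (distrC y p); lra.
have iF1 n : (mu3 R).-integrable setT (EFin \o ((fun y => \sum_(j < 3) dbump p (r n) j y * H j y) \o @vec3 R)).
  apply: (@continuous_compact_support_integrable _ _ (`|p| + 2 * r n)).
    by apply: cont_at => y; apply: cont_sum => j; apply: cont_mul; [exact: cont_dbump | exact: H_cont].
  move=> y /far s3; rewrite big1// => j _.
  by have [_ ->] := bump_out (r0 n) s3; rewrite mul0r.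
have iF2 n : (mu3 R).-integrable setT (EFin \o ((fun y => bump p (r n) y * K y) \o @vec3 R)).
  apply: (le_integrable _ _ _ integrable_K) => //.
    apply/measurable_EFinP; apply: measurable_funM.
      by apply: continuous_vec3_measurable; exact: cont_bump.
    by apply/measurable_EFinP; exact: measurable_int integrable_K.
  move=> y _; rewrite /= lee_fin normrM ler_piMl//.
  by have /andP[h0 h1] := bump_bound p (r n) (vec3 y); rewrite ger0_norm.
have iF n : (mu3 R).-integrable setT (EFin \o (F n \o @vec3 R)).
  exact: (integrableD (mu := mu3 R) measurableT (iF1 n) (iF2 n)).
have F0 n : \int[mu3 R]_y F n (vec3 y) = 0.
  apply: (@Rintegral_div0 R Gam cGam graphGam (`|p| + 2 * r n)
    (fun j y => bump p (r n) y * H j y)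
    (fun j y => dbump p (r n) j y * H j y + bump p (r n) y * D j y)) => //.
    by apply: addr_ge0 => //; apply: mulr_ge0 => //; exact: ltW.
  split.
  - by move=> j; apply: cont_at => y; apply: cont_mul; [exact: cont_bump | exact: H_cont].
  - by move=> j y /far s3; have [-> _] := bump_out (r0 n) s3; rewrite mul0r.
  - move=> j y Gy; split.
      by apply: is_derive_mul; [exact: is_derive_bump | exact: H_derive].
    apply: cont_add; apply: cont_mul.
    + exact: cont_dbump.
    + exact: H_cont.
    + exact: cont_bump.
    + exact: D_cont.
  - by move=> y Gy; rewrite /F K_div// mulr_sumr -big_split.
  - exact: iF.
have iG : (mu3 R).-integrable setT (EFin \o ((fun y => `|K y| + 360 * C * weight p y) \o @vec3 R)).
  have ik : (mu3 R).-integrable setT (EFin \o ((fun y => `|K y|) \o @vec3 R)).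
    exact: (integrable_norm integrable_K).
  have iw : (mu3 R).-integrable setT (EFin \o ((fun y => 360 * C * weight p y) \o @vec3 R)).
    exact: (integrableZl (mu := mu3 R) measurableT (360 * C) (integrable_weight p)).
  exact: (integrableD (mu := mu3 R) measurableT ik iw).
have : \int[mu3 R]_y F n (vec3 y) @[n --> \oo] --> \int[mu3 R]_y K (vec3 y).
  apply: (Rdominated_cvg _ _ _ iG).
  - by move=> n; apply/measurable_EFinP; exact: measurable_int (iF n).
  - by apply/measurable_EFinP; exact: measurable_int integrable_K.
  - apply: aeW => y; apply: cvg_near_cst; near=> n.
    have sr : sqdist p (vec3 y) <= r n ^+ 2.
      apply: le_trans (_ : r n <= _); last by rewrite expr2 ler_peMr// ltW.
      by apply/ltW; near: n; exact: near_infty_natS.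
    have [b1 d0] := bump_in (r0 n) sr.
    by rewrite /F b1 mul1r big1 ?add0r// => j _; rewrite d0 mul0r.
  - move=> n y; rewrite /F addrC; apply: le_trans (ler_normD _ _) _; apply: lerD.
      rewrite normrM ler_piMl//.
      by have /andP[h0 h1] := bump_bound p (r n) (vec3 y); rewrite ger0_norm.
    apply: le_trans (ler_norm_sum _ _ _) _.
    apply: le_trans (_ : \sum_(j < 3) 120 * C * weight p (vec3 y) <= _); last first.
      by rewrite sumr_const card_ord -[leLHS]mulr_natl !mulrA; lra.
    apply: ler_sum => j _; have [db dq] := dbump_bound j (vec3 y) (r1 n).
    have [->|/dq qs] := eqVneq (dbump p (r n) j (vec3 y)) 0.
      by rewrite mul0r normr0 !mulr_ge0// ltW// weight_gt0.
    rewrite normrM weightE -/q.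
    have -> : 120 * C / q (vec3 y) ^+ 4 = 12 / q (vec3 y) * (10 * C / q (vec3 y) ^+ 3).
      by field; rewrite gt_eqF.
    by apply: ler_pM => //; exact: H_bound.
rewrite (_ : (fun n => _) = (fun=> 0)); last by apply/funext => n; exact: F0.
by move=> h; exact: cvg_unique h (cvg_cst _).
Unshelve. all: by end_near. Qed.

Lemma regularized_representation :
  \int[mu3 R]_y (V k (vec3 y) * rho (vec3 y)) =
  \sum_(j < 3) \int[mu3 R]_y (W j k (vec3 y) * g j (vec3 y)).
Proof.
have [_ E] := @Rintegral_sum_ord R _ _ (mu3 R) setT 3 (fun j y => W j k (vec3 y) * g j (vec3 y)) measurableT integrable_Wg.
rewrite -E; apply/eqP; rewrite eq_sym -subr_eq0; apply/eqP.
by rewrite -(RintegralB (mu := mu3 R) measurableT integrable_WgS integrable_Vrho) Rintegral_divergence_K.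
Qed.

End fixed_regularization.

(* Away from p the density is at most a multiple of e^2 times the weight. *)
Let density_far e r y : 0 < e -> 0 < r <= 1 -> r ^+ 2 <= sqdist p y ->
  newton_density p e y <= 12 / r ^+ 5 * e ^+ 2 * weight p y.
Proof.
move=> e0 /andP[r0 r1] rs; rewrite weightE -/(q y) /newton_density.
have w0 := regdist_gt0 p e0 y.
have rq : r ^+ 2 * q y ^+ 2 / 2 <= regdist p e y ^+ 2.
  rewrite !regdist_sq// expr1n ler_pdivrMr//.
  have r21 : r ^+ 2 <= 1 by rewrite expr_le1// ltW.
  have := sqr_ge0 e; have := sqdist_ge0 p y; nra.
have rw : r <= regdist p e y.
  rewrite -(@ler_pXn2r _ 2) ?nnegrE ?(ltW w0) ?(ltW r0)// regdist_sq//.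
  by apply: le_trans rs _; rewrite lerDr sqr_ge0.
have h : r ^+ 5 * q y ^+ 4 / 4 <= regdist p e y ^+ 5.
  rewrite (_ : r ^+ 5 * q y ^+ 4 / 4 = r * (r ^+ 2 * q y ^+ 2 / 2) ^+ 2); last by field.
  rewrite [regdist p e y ^+ 5]exprS; apply: ler_pM => //; [exact: ltW | exact: sqr_ge0 |].
  rewrite (exprM _ 2 2) ler_pXn2r ?nnegrE ?sqr_ge0//.
  by rewrite divr_ge0// mulr_ge0 ?sqr_ge0.
have -> : 12 / r ^+ 5 * e ^+ 2 / q y ^+ 4 = 3 * e ^+ 2 / (r ^+ 5 * q y ^+ 4 / 4).
  by field; rewrite (gt_eqF r0) (gt_eqF (q0 y)).
apply: ler_wpM2l; first by rewrite mulr_ge0 ?sqr_ge0.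
by rewrite lef_pV2 ?posrE ?divr_gt0 ?mulr_gt0 ?exprn_gt0.
Qed.

Let eps (n : nat) : R := n.+1%:R^-1.
Let eps01 n : 0 < eps n <= 1.
Proof. by rewrite invr_gt0 ltr0n /= invf_le1// ler1n. Qed.
Let eps0 n : 0 < eps n. Proof. by case/andP: (eps01 n). Qed.

Let eps_cvg : eps @ \oo --> (0 : R).
Proof.
apply/cvgrPdist_le => t t0; near=> n.
rewrite sub0r normrN gtr0_norm// invf_ple ?posrE// ltW//.
near: n; exact: near_infty_natS.
Unshelve. all: by end_near. Qed.

(** The density has mass 4 pi and concentrates at [p].  Split according to whether
    [y] is so near to [p] that [V k] is close to [V k p], or not, where
    [density_far] applies. *)
Lemma density_approximates_identity k :
  \int[mu3 R]_y (V k (vec3 y) * newton_density p (eps n) (vec3 y)) @[n --> \oo]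
    --> 4 * pi * V k p.
Proof.
pose I := \int[mu3 R]_y weight p (vec3 y).
have I0 : 0 <= I by apply: Rintegral_ge0 => y _; rewrite ltW// weight_gt0.
have ir n : (mu3 R).-integrable setT (EFin \o (newton_density p (eps n) \o @vec3 R)).
  exact: integrable_newton_density.
have mV : measurable_fun setT (V k \o @vec3 R) by exact: continuous_vec3_measurable.
have iVr n : (mu3 R).-integrable setT (EFin \o ((fun y => V k y * newton_density p (eps n) y) \o @vec3 R)).
  apply: (@integrableMr _ _ _ (mu3 R) setT measurableT (V k \o @vec3 R)
    (EFin \o (newton_density p (eps n) \o @vec3 R)) mV); last exact: ir.
  exists C; split; first exact: num_real.
  by move=> M' MM y _ /=; apply/ltW; apply: le_lt_trans MM; exact: V_bounded.
have iVp n : (mu3 R).-integrable setT (EFin \o ((fun y => V k p * newton_density p (eps n) y) \o @vec3 R)).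
  exact: (integrableZl (mu := mu3 R) measurableT (V k p) (ir n)).
apply/cvgrPdist_le => t t0.
pose u := t / (2 * (4 * pi)).
have pi4 : 0 < 4 * pi :> R by rewrite mulr_gt0 ?pi_gt0.
have u0 : 0 < u by rewrite divr_gt0// mulr_gt0.
have /cvgrPdist_le /(_ _ u0) /nbhs_ballP[r' /= r'0 Vr] := @cV k p.
pose r := Num.min (r' / 2) 1.
have r0 : 0 < r by rewrite lt_min divr_gt0//=.
have r1 : r <= 1 by rewrite ge_min lexx orbT.
have rr' : r < r' by rewrite gt_min ltr_pdivrMr// ltr_pMr// ltr1n.
pose c := 2 * C * (12 / r ^+ 5).
have c0 : 0 <= c by rewrite !mulr_ge0// invr_ge0 exprn_ge0// ltW.
have near_far n y : `|V k p * newton_density p (eps n) y - V k y * newton_density p (eps n) y|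
   <= u * newton_density p (eps n) y + c * eps n ^+ 2 * weight p y.
  rewrite -mulrBl normrM (gtr0_norm (newton_density_gt0 p (eps0 n) y)).
  have rho0 := newton_density_gt0 p (eps0 n) y.
  have wt0 := weight_gt0 p y.
  have [ys|/ltW sy] := leP (sqdist p y) (r ^+ 2).
    rewrite -[leLHS]addr0; apply: lerD; last first.
      by apply: mulr_ge0; [apply: mulr_ge0 => //; exact: sqr_ge0 | exact: ltW].
    rewrite ler_pM2r//; apply: Vr; rewrite -ball_normE /=.
    by apply: le_lt_trans rr'; apply: sqdist_norm => //; exact: ltW.
  rewrite -[leLHS]add0r; apply: lerD; first by rewrite mulr_ge0// ltW.
  apply: le_trans (_ : 2 * C * newton_density p (eps n) y <= _).
    rewrite ler_pM2r//; apply: le_trans (ler_normB _ _) _.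
    by have := V_bounded k p; have := V_bounded k y; lra.
  rewrite (_ : c * _ * _ = 2 * C * (12 / r ^+ 5 * eps n ^+ 2 * weight p y)); last first.
    by rewrite /c !mulrA.
  by apply: ler_wpM2l; [exact: mulr_ge0 | apply: density_far; rewrite ?r0].
near=> n.
have -> : 4 * pi * V k p = \int[mu3 R]_y (V k p * newton_density p (eps n) (vec3 y)).
  rewrite (RintegralZl (mu := mu3 R) _ measurableT (ir n)).
  by rewrite Rintegral_newton_density// mulrC.
rewrite -(RintegralB (mu := mu3 R) measurableT (iVp n) (iVr n)).
have iB : (mu3 R).-integrable setT (EFin \o ((fun y => V k p * newton_density p (eps n) y -
    V k y * newton_density p (eps n) y) \o @vec3 R)).
  by have := integrableB (mu := mu3 R) measurableT (iVp n) (iVr n); apply: eq_integrable.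
apply: le_trans (le_normr_Rintegral (mu := mu3 R) measurableT iB) _.
have i1 : (mu3 R).-integrable setT (EFin \o ((fun y => u * newton_density p (eps n) y) \o @vec3 R)).
  exact: (integrableZl (mu := mu3 R) measurableT u (ir n)).
have i2 : (mu3 R).-integrable setT (EFin \o ((fun y => c * eps n ^+ 2 * weight p y) \o @vec3 R)).
  exact: (integrableZl (mu := mu3 R) measurableT (c * eps n ^+ 2) (integrable_weight p)).
have i3 : (mu3 R).-integrable setT (EFin \o ((fun y => u * newton_density p (eps n) y +
    c * eps n ^+ 2 * weight p y) \o @vec3 R)).
  exact: (integrableD (mu := mu3 R) measurableT i1 i2).
apply: le_trans (le_Rintegral (mu := mu3 R) measurableT _ i3 _) _.
- exact: (integrable_norm iB).
- by move=> y _; exact: near_far.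
rewrite (RintegralD (mu := mu3 R) measurableT i1 i2).
rewrite (RintegralZl (mu := mu3 R) _ measurableT (ir n)) Rintegral_newton_density//.
rewrite (RintegralZl (mu := mu3 R) _ measurableT (integrable_weight p)) -/I.
have -> : u * (4 * pi) = t / 2.
  rewrite /u; move: pi4; generalize (4 * @pi R) => z z0.
  by field; rewrite gt_eqF.
have e1 : c * eps n ^+ 2 * I <= c * I * eps n.
  rewrite mulrAC; apply: ler_wpM2l; first exact: mulr_ge0.
  rewrite expr2; apply: ler_piMr; first exact: ltW.
  by case/andP: (eps01 n).
suff : c * I * eps n <= t / 2 by lra.
have cI : 0 <= c * I by rewrite mulr_ge0.
apply: le_trans (_ : (c * I + 1) * eps n <= _).
  by rewrite ler_wpM2r ?(ltW (eps0 n))// lerDl.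
have K1 : 0 < c * I + 1 by rewrite ltr_wpDl.
rewrite mulrC -ler_pdivlMr// /eps invf_ple ?posrE ?divr_gt0// ltW//.
near: n; exact: near_infty_natS.
Unshelve. all: by end_near. Qed.

Variable d : R.
Hypothesis d0 : 0 < d.
Hypothesis farW : forall j k y, W j k y != 0 -> d <= enorm (p - y).

Let Wng_integrable j k : (mu3 R).-integrable setT
  (EFin \o ((fun y => `|W j k y| / d ^+ 2) \o @vec3 R)).
Proof.
exact: (integrableZr (mu := mu3 R) measurableT _ (integrable_norm (iW j k))).
Qed.

(** Dominated convergence: the sources stay at distance at least [d] from [p], so
    the regularized kernels are bounded by [1 / d ^+ 2] on them. *)
Lemma reg_grad_limit j k :
  \int[mu3 R]_y (W j k (vec3 y) * reg_grad p (eps n) j (vec3 y)) @[n --> \oo]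
    --> \int[mu3 R]_y (W j k (vec3 y) * - (4 * pi * newton_grad p j (vec3 y))).
Proof.
have mW : measurable_fun setT (W j k \o @vec3 R).
  by apply/measurable_EFinP; exact: measurable_int (iW j k).
have mf n : measurable_fun setT (fun y => W j k (vec3 y) * reg_grad p (eps n) j (vec3 y)).
  by apply: measurable_funM => //; apply: continuous_vec3_measurable; exact: cont_reg_grad.
have cvg y : W j k (vec3 y) * reg_grad p (eps n) j (vec3 y) @[n --> \oo] -->
    W j k (vec3 y) * - (4 * pi * newton_grad p j (vec3 y)).
  have [->|/farW dy] := eqVneq (W j k (vec3 y)) 0.
    by rewrite mul0r; under eq_fun do rewrite mul0r; exact: cvg_cst.
  have u0 : 0 < enorm (p - vec3 y) by rewrite (lt_le_trans d0).
  apply: cvgM; first exact: cvg_cst.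
  have -> : - (4 * pi * newton_grad p j (vec3 y)) =
      (p 0 j - vec3 y 0 j) * (Num.sqrt (0 ^+ 2 + sqdist p (vec3 y)) ^+ 3)^-1.
    rewrite expr0n add0r -enorm_sqdist /newton_grad.
    move: (pi_gt0 R); generalize (@pi R) => z z0.
    by field; rewrite (gt_eqF u0) (gt_eqF z0).
  apply: cvgM; first exact: cvg_cst.
  have cs : continuous (fun s : R => Num.sqrt (s ^+ 2 + sqdist p (vec3 y)) ^+ 3).
    apply: cont_at => s; apply: (@cont_comp _ _ _ (fun x : R => x ^+ 3)); last exact: exprn_continuous.
    apply: (@cont_comp _ _ _ (@Num.sqrt R)); last exact: sqrt_continuous.
    by apply: cont_add; [exact: exprn_continuous | exact: cont_cst].
  apply: cvgV.
    by rewrite expr0n add0r -enorm_sqdist expf_neq0// gt_eqF.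
  exact: (cvg_comp _ _ eps_cvg (cs 0)).
apply: (@Rdominated_cvg _ _ R (mu3 R)
  (fun n y => W j k (vec3 y) * reg_grad p (eps n) j (vec3 y))
  (fun y => W j k (vec3 y) * - (4 * pi * newton_grad p j (vec3 y)))
  (fun y => `|W j k (vec3 y)| / d ^+ 2) mf _ _ (Wng_integrable j k)).
- by apply: (measurable_fun_cvg mf) => y _; exact: cvg.
- by apply: aeW => y; exact: cvg.
- move=> n y /=; have [->|/farW dy] := eqVneq (W j k (vec3 y)) 0.
    by rewrite !mul0r normr0 mul0r.
  rewrite normrM ler_wpM2l//; apply: le_trans (reg_grad_bound p (eps0 n) j _) _.
  have s0 : 0 < enorm (p - vec3 y) by rewrite (lt_le_trans d0).
  rewrite lef_pV2 ?posrE ?exprn_gt0// ?regdist_gt0// regdist_sq// -enorm_sq.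
  apply: le_trans (_ : enorm (p - vec3 y) ^+ 2 <= _); last by rewrite lerDr sqr_ge0.
  by rewrite ler_pXn2r ?nnegrE ?(ltW d0) ?(ltW s0).
Qed.

(** Both sides of [regularized_representation] converge as the regularization
    scale tends to 0. *)
Lemma newton_representation k :
  4 * pi * V k p =
  \sum_(j < 3) \int[mu3 R]_y (W j k (vec3 y) * - (4 * pi * newton_grad p j (vec3 y))).
Proof.
have l1 := @density_approximates_identity k.
have l2 : \sum_(j < 3) \int[mu3 R]_y (W j k (vec3 y) * reg_grad p (eps n) j (vec3 y)) @[n --> \oo]
   --> \sum_(j < 3) \int[mu3 R]_y (W j k (vec3 y) * - (4 * pi * newton_grad p j (vec3 y))).
  by apply: cvg_sum_ord => j; exact: reg_grad_limit.
have E : (fun n => \int[mu3 R]_y (V k (vec3 y) * newton_density p (eps n) (vec3 y))) =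
   (fun n => \sum_(j < 3) \int[mu3 R]_y (W j k (vec3 y) * reg_grad p (eps n) j (vec3 y))).
  by apply/funext => n; exact: regularized_representation.
by rewrite E in l1; exact: cvg_unique l1 l2.
Qed.

End representation.

(** * The smooth boundary as a union of graphs *)

Section boundary_graph.
Variables (R : realType) (Omega : set 'rV[R]_3).

Lemma col'_upd (i : 'I_3) (x : 'rV[R]_3) t : col' i (upd x i t) = col' i x.
Proof.
by apply/rowP => j; rewrite !mxE; case: eqP => // h; have := neq_lift i j; rewrite h eqxx.
Qed.

Lemma col'_continuous (i : 'I_3) : continuous (fun x : 'rV[R]_3 => (col' i x : 'rV[R]_2)).
Proof.
move=> x; apply: (@row_continuous R _ _ (fun x : 'rV[R]_3 => (col' i x : 'rV[R]_2))) => j.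
rewrite (_ : (fun y : 'rV[R]_3 => _) = (fun y : 'rV[R]_3 => y 0 (lift i j))).
  exact: cont_coord.
by apply/funext => y; rewrite mxE.
Qed.

Lemma smooth_C1_graph (i : 'I_3) (s : bool) (gam : 'rV[R]_2 -> R) : smooth gam ->
  exists dG, C1_graph_fun i (fun x => (-1) ^+ s * gam (col' i x)) dG.
Proof.
move=> sg; have [cg dg] := sg 1%N.
(* The derivative along the distinguished axis is 0; the others are those of
   gam at the index that col' leaves. *)
exists (fun j x => if unlift i j is Some j' then (-1) ^+ s * partial j' gam (col' i x) else 0).
split.
- apply: cont_at => x; apply: cont_mul; first exact: cont_cst.
  by apply: (@cont_comp _ _ _ gam (fun x : 'rV[R]_3 => (col' i x : 'rV[R]_2))); [exact: col'_continuous | exact: cg].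
- by move=> x t; rewrite col'_upd.
- move=> j x; case: unliftP => [j' ->|->].
    have [df _] := dg j'.
    have H : is_derive (col' i x : 'rV[R]_2) (delta_mx 0 j') (fun y => (-1) ^+ s * gam y)
        ((-1) ^+ s * partial j' gam (col' i x)).
      have H1 : is_derive (col' i x : 'rV[R]_2) (delta_mx 0 j') gam (partial j' gam (col' i x)).
        by split => //; exact: df.
      refine (is_derive_eq (is_derive_mul (is_derive_cst ((-1) ^+ s : R) _ _) H1) _).
      by rewrite mul0r add0r.
    apply: (is_derive_along _ H) => h; congr (_ * gam _).
    apply/rowP => l; rewrite !mxE eqxx /=.
    by rewrite (inj_eq lift_inj).
  apply: (@is_derive_along R _ _ _ (fun=> (-1) ^+ s * gam (col' i x)) _ _ (0 : R) (0 : R)).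
    move=> h; congr (_ * gam _); apply/rowP => l; rewrite !mxE eqxx /=.
    have -> : (lift i l == i) = false by rewrite eq_sym; exact/negbTE/neq_lift.
    by rewrite /= mulr0 add0r.
- move=> j; case: (unlift i j) => [j'|]; last by apply: cont_at => x; exact: cont_cst.
  have [_ [cdg _]] := dg j'.
  apply: cont_at => x; apply: cont_mul; first exact: cont_cst.
  by apply: (@cont_comp _ _ _ (partial j' gam) (fun x : 'rV[R]_3 => (col' i x : 'rV[R]_2))); [exact: col'_continuous | exact: cdg].
Qed.

Lemma closed_boundary : closed (boundary Omega).
Proof.
rewrite /boundary setDE; apply: closedI; first exact: closed_closure.
by apply: open_closedC; exact: open_interior.
Qed.

(** Near a boundary point only the equality case of the defining inequality is
    possible: the strict inequality means interior, and the opposite strict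
    inequality holds on a neighbourhood that misses [Omega].  Away from the
    boundary any graph will do. *)
Lemma boundary_graph : open Omega -> smooth_boundary Omega ->
  forall p : 'rV[R]_3, exists i G dG, C1_graph_fun i G dG /\
    \forall x \near p, boundary Omega x -> (x : 'rV[R]_3) 0 i = G x.
Proof.
move=> oO sO p; have [bp|nbp] := pselect (boundary Omega p); last first.
  exists 0, (fun=> 0), (fun _ _ => 0); split.
    split.
    - by apply: cont_at => x; exact: cont_cst.
    - by [].
    - by move=> j x; exact: is_derive_cst.
    - by move=> j; apply: cont_at => x; exact: cont_cst.
  have : nbhs p (~` boundary Omega).
    by apply: open_nbhs_nbhs; split => //; exact: closed_openC closed_boundary.
  by apply: filterS.
have [i [s [gam [sg pg]]]] := sO p bp.
have [dG CG] := smooth_C1_graph i s sg.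
have [cg _] := sg 0%N.
exists i, (fun x => (-1) ^+ s * gam (col' i x)), dG; split => //.
have s2 : (-1) ^+ s * (-1) ^+ s = 1 :> R by rewrite -signr_addb addbb.
have cx : continuous (fun x : 'rV[R]_3 => (-1) ^+ s * x 0 i - gam (col' i x)).
  apply: cont_at => x; apply: cont_sub.
    by apply: cont_mul; [exact: cont_cst | exact: cont_coord].
  by apply: (@cont_comp _ _ _ gam (fun x : 'rV[R]_3 => (col' i x : 'rV[R]_2))); [exact: col'_continuous | exact: cg].
move: pg => /nbhs_interior; apply: filterS => x /= xP [clx nix].
have Px := nbhs_singleton xP.
have [lt|gt|eq] := ltgtP (gam (col' i x)) ((-1) ^+ s * x 0 i).
- by exfalso; apply: nix; apply: open_nbhs_nbhs; split => //; exact/Px.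
- exfalso; have lt0 : (-1) ^+ s * x 0 i - gam (col' i x) < 0 by rewrite subr_lt0.
  have near_lt : nbhs x [set y : 'rV[R]_3 | (-1) ^+ s * y 0 i - gam (col' i y) < 0].
    exact: (cvgr_lt _ (cx x) _ lt0).
  have [y [Oy [yP /= ylt]]] := clx _ (filterI xP near_lt).
  by move/yP: Oy; move: ylt; rewrite subr_lt0 => /ltW; rewrite leNgt => /negP.
- by rewrite eq mulrA s2 mul1r.
Qed.

End boundary_graph.

(** * Gluing the inner and the outer field *)

Section glue.
Variables (R : realType) (Omega : set 'rV[R]_3) (Jm Bm Bp E : 'rV[R]_3 -> 'rV[R]_3).
Hypothesis oO : open Omega.
Hypothesis bO : bounded_set Omega.
Hypothesis hBm : curl_div_solution Omega Bm Jm.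
Hypothesis hBm_cont : {within closure Omega, continuous Bm}.
Hypothesis hBp : curl_div_solution (exterior Omega) Bp (fun=> 0).
Hypothesis hBp_cont : {within exterior Omega `|` boundary Omega, continuous Bp}.
Hypothesis hE : curl_div_solution Omega E (fun=> 0).
Hypothesis hE_cont : {within closure Omega, continuous E}.
Hypothesis match_bd : forall x, boundary Omega x -> Bm x - E x = Bp x.
Hypothesis decay : exists C M : R, forall x, exterior Omega x ->
  M < enorm x -> enorm (Bp x) <= C * (enorm x)^-1.

Definition glued (x : 'rV[R]_3) : 'rV[R]_3 :=
  if `[< closure Omega x >] then Bm x - E x else Bp x.

Lemma glued_in x : closure Omega x -> glued x = Bm x - E x.
Proof. by move=> cx; rewrite /glued asboolT. Qed.

Lemma glued_out x : exterior Omega x -> glued x = Bp x.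
Proof. by move=> cx; rewrite /glued asboolF. Qed.

Let oExt : open (exterior Omega).
Proof. by apply: closed_openC; exact: closed_closure. Qed.

Lemma not_boundary x : ~ boundary Omega x -> Omega x \/ exterior Omega x.
Proof.
move=> nb; have [cx|] := pselect (closure Omega x); last by right.
left; apply: contrapT => nO; apply: nb; split => //.
by move=> /interior_subset.
Qed.

Let oExt_boundary : exterior Omega `|` boundary Omega = ~` Omega.
Proof.
apply/seteqP; split=> x.
  by move=> [nc Ox|[_ nO Ox]]; [exact: nc (subset_closure Ox) | apply: nO; exact: open_nbhs_nbhs].
move=> nO; have [cx|] := pselect (closure Omega x); last by left.
by right; split => // /interior_subset.
Qed.

(** The closure of [Omega] and the complement of [Omega] are closed and cover the
    space; on the overlap, the boundary, both expressions agree by [match_bd]. *)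
Lemma glued_continuous k : continuous (fun x => glued x 0 k).
Proof.
have coordW (A : set 'rV[R]_3) (F : 'rV[R]_3 -> 'rV[R]_3) :
    {within A, continuous F} -> {within A, continuous (fun x => F x 0 k)}.
  move=> cF; apply: (@cont_at R (subspace A)) => x.
  apply: (@cont_comp (subspace A) _ _ (fun v : 'rV[R]_3 => v 0 k) F); first exact: cF.
  exact: cont_coord.
have c1 : {within closure Omega, continuous (fun x => glued x 0 k)}.
  apply: (@subspace_eq_continuous _ (closure Omega) _ (fun x => Bm x 0 k - E x 0 k)).
    by move=> x /set_mem cx; rewrite /from_subspace /= glued_in// !mxE.
  apply: (@cont_at R (subspace (closure Omega))) => x.
  by apply: cont_sub; [exact: (coordW _ _ hBm_cont) | exact: (coordW _ _ hE_cont)].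
have c2 : {within ~` Omega, continuous (fun x => glued x 0 k)}.
  rewrite -oExt_boundary.
  apply: (@subspace_eq_continuous _ (exterior Omega `|` boundary Omega) _ (fun x => Bp x 0 k)).
    move=> x /set_mem /= [xe|xb]; rewrite /from_subspace /=; first by rewrite glued_out.
    by rewrite -match_bd// glued_in//; case: xb.
  exact: coordW.
have := withinU_continuous (@closed_closure _ Omega) (open_closedC oO) c1 c2.
rewrite (_ : closure Omega `|` ~` Omega = setT); first by move=> h; apply/continuous_subspace_setT.
apply/seteqP; split=> x // _; have [Ox|nO] := pselect (Omega x); last by right.
by left; exact: subset_closure.
Qed.

Definition dglued (j k : 'I_3) (x : 'rV[R]_3) : R :=
  if `[< Omega x >] then partial j Bm x 0 k - partial j E x 0 k else partial j Bp x 0 k.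

Let C1_coord U F j k x : open U -> C1_on U F -> U x ->
  is_derive x (delta_mx 0 j) (fun y : 'rV[R]_3 => (F y : 'rV[R]_3) 0 k) (partial j F x 0 k) /\
  {for x, continuous (fun y => partial j F y 0 k)}.
Proof.
move=> oU hF Ux; have [dF cF] := hF j x Ux; split.
  have dk := (derivable_mxP _ _ _).1 dF.
  by split; [exact: dk | rewrite /partial derive_mx// mxE].
apply: (@cont_comp _ _ _ (fun v : 'rV[R]_3 => v 0 k) (partial j F)); first exact: cF.
exact: cont_coord.
Qed.

Let near_open (U : set 'rV[R]_3) x : open U -> U x -> \forall y \near x, U y.
Proof. by move=> oU Ux; exact: open_nbhs_nbhs. Qed.

Let extN x : exterior Omega x -> ~ Omega x.
Proof. by move=> xe /subset_closure. Qed.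

Lemma glued_derive j k x : ~ boundary Omega x ->
  is_derive x (delta_mx 0 j) (fun y => glued y 0 k) (dglued j k x) /\
  {for x, continuous (dglued j k)}.
Proof.
move=> /not_boundary[Ox|ex].
  have [d1 c1] := C1_coord j k oO hBm.1 Ox.
  have [d2 c2] := C1_coord j k oO hE.1 Ox.
  have nO := near_open oO Ox.
  split.
    rewrite /dglued asboolT//.
    apply: (near_eq_is_derive _ (is_derive_sub d1 d2)).
    by apply: filterS nO => y Oy; rewrite glued_in ?mxE//; exact: subset_closure.
  apply: (cont_near _ (cont_sub c1 c2)).
  by apply: filterS nO => y Oy; rewrite /dglued asboolT.
have [d1 c1] := C1_coord j k oExt hBp.1 ex.
have nO := near_open oExt ex.
split.
  rewrite /dglued asboolF; last exact: extN.
  apply: (near_eq_is_derive _ d1).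
  by apply: filterS nO => y ey; rewrite glued_out.
apply: (cont_near _ c1).
by apply: filterS nO => y ey; rewrite /dglued asboolF//; exact: extN.
Qed.

Lemma glued_div x : ~ boundary Omega x -> \sum_j dglued j j x = 0.
Proof.
move=> /not_boundary[Ox|ex].
  under eq_bigr do rewrite /dglued asboolT//.
  rewrite sumrB.
  have := (hBm.2 x Ox).2; have := (hE.2 x Ox).2; rewrite /divergence => -> ->.
  by rewrite subrr.
rewrite -[RHS](hBp.2 x ex).2 /divergence; apply: eq_bigr => j _.
by rewrite /dglued asboolF//; exact: extN.
Qed.

(** The antisymmetric matrix [d_j V_k - d_k V_j] of a field [V] with curl [Jm]. *)
Definition vorticity (j k : 'I_3) (x : 'rV[R]_3) : R :=
  if j == k + 1 then - Jm x 0 (k + 2) else if j == k + 2 then Jm x 0 (k + 1) else 0.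

Let I3 : [/\ 1 + 1 = 2 :> 'I_3, 1 + 2 = 0 :> 'I_3, 2 + 1 = 0 :> 'I_3 & 2 + 2 = 1 :> 'I_3].
Proof. by split; apply/val_inj. Qed.

Lemma glued_curl j k x : ~ boundary Omega x ->
  dglued j k x - dglued k j x = (if `[< Omega x >] then vorticity j k x else 0).
Proof.
have [e11 e12 e21 e22] := I3.
have curlE (F : 'rV[R]_3 -> 'rV[R]_3) (J : 'rV[R]_3) : curl F x = J -> forall i,
    partial (i + 1) F x 0 (i + 2) - partial (i + 2) F x 0 (i + 1) = J 0 i.
  by move=> <- i; rewrite mxE.
have anti (f J : 'I_3 -> 'I_3 -> R) (c : 'I_3 -> R) :
    (forall i, f (i + 1) (i + 2) - f (i + 2) (i + 1) = c i) -> forall j k,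
    f j k - f k j = if j == k + 1 then - c (k + 2) else if j == k + 2 then c (k + 1) else 0.
  move=> fc; have := fc 0; have := fc 1; have := fc 2.
  rewrite !add0r e11 e12 e21 e22 => c2 c1 c0.
  apply: ord3_ind; apply: ord3_ind; rewrite ?add0r ?e11 ?e12 ?e21 ?e22 /=;
    rewrite -?c0 -?c1 -?c2; lra.
move=> /not_boundary[Ox|ex].
  rewrite asboolT// /dglued asboolT// /vorticity.
  apply: (@anti (fun j k => partial j Bm x 0 k - partial j E x 0 k) (fun _ _ => 0) (Jm x 0)) => i.
  have a := curlE _ _ (hBm.2 x Ox).1 i; have b := curlE _ _ (hE.2 x Ox).1 i.
  by move: a b; rewrite mxE => <- b; lra.
have nO := extN ex.
rewrite asboolF// /dglued asboolF//.
have := @anti (fun j k => partial j Bp x 0 k) (fun _ _ => 0) (fun=> 0) _ j k.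
rewrite oppr0 => ->; first by rewrite !if_same.
by move=> i; rewrite (curlE _ _ (hBp.2 x ex).1) mxE.
Qed.

(** Near infinity this is the decay of [Bp], since [regdist p 1] is at most a
    constant times [enorm]; on a large ball it is compactness. *)
Lemma glued_decay p : exists2 C, 0 <= C & forall k y, `|glued y 0 k| <= C / regdist p 1 y.
Proof.
have [C [M hC]] := decay.
have [M1 [_ OM]] := bO.
(* Outside this ball: exterior of Omega, decay valid, and norm at least 1. *)
pose L := Num.max (Num.max M (M1 + 1)) 1.
have out y : L < `|y| -> exterior Omega y.
  move=> Ly; move=> cy.
  have : `|y| <= M1 + 1.
    by apply: (closure_norm_le _ cy) => z Oz; apply: OM => //; rewrite ltrDl.
  by rewrite leNgt (le_lt_trans _ Ly)// /L !le_max lexx orbT.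
pose K := Num.sqrt (3 + 2 * enorm p ^+ 2).
have rg0 y : 0 < regdist p 1 y by exact: regdist_gt0.
have farb k y : L < `|y| -> `|glued y 0 k| <= `|C| * K / regdist p 1 y.
  move=> Ly; rewrite glued_out; last exact: out.
  have n1 : 1 <= enorm y.
    apply: le_trans (_ : `|y| <= _); last by apply/norm_rV_le; [exact: enorm_ge0 | move=> i; exact: coord_le_enorm].
    by rewrite ltW// (le_lt_trans _ Ly)// le_max lexx orbT.
  have n0 : 0 < enorm y by rewrite (lt_le_trans ltr01).
  have Me : M < enorm y.
    apply: lt_le_trans (_ : `|y| <= _).
      by rewrite (le_lt_trans _ Ly)// !le_max lexx.
    by apply/norm_rV_le; [exact: enorm_ge0 | move=> i; exact: coord_le_enorm].
  apply: le_trans (coord_le_enorm _ _) _; apply: le_trans (hC _ (out _ Ly) Me) _.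
  rewrite ler_pdivlMr// mulrAC ler_pdivrMr// -mulrA.
  apply: le_trans (_ : `|C| * regdist p 1 y <= _).
    by rewrite ler_wpM2r ?ler_norm// ltW.
  rewrite ler_wpM2l//.
  have K2 : K ^+ 2 = 3 + 2 * enorm p ^+ 2.
    by rewrite sqr_sqrtr// addr_ge0// mulr_ge0// sqr_ge0.
  rewrite -(@ler_pXn2r _ 2) ?nnegrE ?(ltW (rg0 y)) ?mulr_ge0 ?sqrtr_ge0 ?(ltW n0)//.
  rewrite regdist_sq// expr1n exprMn K2.
  have ssq : sqdist p y <= 2 * enorm y ^+ 2 + 2 * enorm p ^+ 2.
    rewrite /enorm !sqr_sqrtr; try by apply: sumr_ge0 => i _; exact: sqr_ge0.
    rewrite !mulr_sumr -big_split /=; apply: ler_sum => i _.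
    by have := sqr_ge0 (y 0 i + p 0 i); rewrite !expr2; lra.
  have n21 : 1 <= enorm y ^+ 2 by rewrite exprn_ege1.
  have := sqr_ge0 (enorm p); nra.
have [N N0 hN] : exists2 N, 0 <= N & forall k y, `|y| <= L -> `|glued y 0 k * regdist p 1 y| <= N.
  have cont k : continuous (fun y => glued y 0 k * regdist p 1 y).
    by apply: cont_at => y; apply: cont_mul; [exact: glued_continuous | exact: cont_regdist].
  have b k := bounded_on_compact (@compact_closed_ball_rV R 3 L) (continuous_subspaceT (cont k)).
  have [N0 n0 h0] := b 0; have [N1 n1 h1] := b 1; have [N2 n2 h2] := b 2.
  exists (N0 + N1 + N2); first by rewrite !addr_ge0.
  apply: ord3_ind => y yL.
  - by have := h0 y yL; lra.
  - by have := h1 y yL; lra.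
  - by have := h2 y yL; lra.
exists (`|C| * K + N); first by rewrite addr_ge0// mulr_ge0// sqrtr_ge0.
move=> k y; have [yL|Ly] := leP `|y| L; last first.
  apply: le_trans (farb k y Ly) _; rewrite ler_pM2r ?invr_gt0//.
  by rewrite lerDl.
rewrite ler_pdivlMr//; apply: le_trans (_ : N <= _); last by rewrite lerDr mulr_ge0// sqrtr_ge0.
by have := hN k y yL; rewrite normrM (gtr0_norm (rg0 y)).
Qed.

End glue.

(** * The outer field is a Biot-Savart field *)

Section field_outside.
Variables (R : realType) (Omega : set 'rV[R]_3) (Jm : 'rV[R]_3 -> 'rV[R]_3).
Hypothesis oO : open Omega.
Hypothesis hJm : forall i : 'I_3, vol_integrable Omega (fun y => Jm y 0 i).

Lemma exterior_dist (p : 'rV[R]_3) : exterior Omega p ->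
  exists2 d : R, 0 < d & forall y, Omega y -> d <= enorm (p - y).
Proof.
move=> pe; have oE : open (exterior Omega) by apply: closed_openC; exact: closed_closure.
have /nbhs_ballP[d /= d0 bE] : nbhs p (exterior Omega) by exact: open_nbhs_nbhs.
exists d => // y Oy; rewrite leNgt; apply/negP => yd.
apply: (bE y); last exact: subset_closure.
rewrite -ball_normE /=; apply: le_lt_trans yd.
by apply/norm_rV_le; [exact: enorm_ge0 | move=> i; exact: coord_le_enorm].
Qed.

Let W (j k : 'I_3) (x : 'rV[R]_3) : R := if `[< Omega x >] then vorticity Jm j k x else 0.

Let mO : measurable (@vec3 R @^-1` Omega).
Proof. exact: open_vec3_measurable. Qed.

Lemma vorticity_integrable j k :
  (mu3 R).-integrable setT (EFin \o (W j k \o @vec3 R)).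
Proof.
have -> : EFin \o (W j k \o @vec3 R) =
    (fun y => (EFin \o (vorticity Jm j k \o @vec3 R)) y) \_ (@vec3 R @^-1` Omega).
  apply/funext => y; rewrite patchE /W /=; case: ifPn => [/asboolP Oy|/asboolP nO].
    by rewrite mem_set.
  by rewrite memNset.
apply/(integrable_mkcond (mu := mu3 R) _ mO).
rewrite /vorticity; case: eqP => _.
  exact: (integrableN (mu := mu3 R) (hJm (k + 2))).
case: eqP => _; first exact: hJm.
exact: (integrable0 (mu3 R)).
Qed.

Lemma vorticity_integral j k (g : 'rV[R]_3 -> R) :
  \int[mu3 R]_y (W j k (vec3 y) * g (vec3 y)) =
  vol_integral Omega (fun y => vorticity Jm j k y * g y).
Proof.
rewrite /vol_integral [RHS]Rintegral_mkcond; apply: eq_Rintegral => y _.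
rewrite patchE /W /=; case: ifPn => [/asboolP Oy|/asboolP nO].
  by rewrite mem_set.
by rewrite memNset// mul0r.
Qed.

(** Only [j = k + 1] and [j = k + 2] contribute, with opposite signs; these are
    the two terms of the [k]-th component of the curl of the potential. *)
Lemma vorticity_sum (p : 'rV[R]_3) d k : 0 < d -> (forall y, Omega y -> d <= enorm (p - y)) ->
  \sum_j vol_integral Omega (fun y => vorticity Jm j k y * - (4 * pi * newton_grad p j y)) =
  4 * pi * (vol_integral Omega (fun y => Jm y 0 (k + 2) * newton_grad p (k + 1) y) -
            vol_integral Omega (fun y => Jm y 0 (k + 1) * newton_grad p (k + 2) y)).
Proof.
move=> d0 far.
pose I i j := vol_integral Omega (fun y => Jm y 0 i * newton_grad p j y).
have ZI c i j : vol_integral Omega (fun y => c * (Jm y 0 i * newton_grad p j y)) = c * I i j.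
  have h := vol_integrable_mul oO (hJm i) (fun y => @cont_newton_grad _ _ p d d0 far j y) (fun y => @newton_grad_bound _ _ p d d0 far j y).
  by rewrite /I /vol_integral (RintegralZl (mu := mu3 R) _ mO h).
have term j : vol_integral Omega (fun y => vorticity Jm j k y * - (4 * pi * newton_grad p j y)) =
    4 * pi * (if j == k + 1 then I (k + 2) j else if j == k + 2 then - I (k + 1) j else 0).
  rewrite /vorticity; case: eqP => _; first by rewrite -ZI; congr vol_integral; apply/funext => y; ring.
  case: eqP => _; last by rewrite mulr0 /vol_integral; under eq_Rintegral do rewrite mul0r; rewrite /Rintegral integral0.
  by rewrite mulrN -mulNr -ZI; congr vol_integral; apply/funext => y; ring.
under eq_bigr do rewrite term.
rewrite -mulr_sumr; congr (_ * _).
have ne : k + 2 != k + 1 by rewrite (inj_eq (addrI k)).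
rewrite (bigD1 (k + 1))//= eqxx (bigD1 (k + 2))//= (negPf ne) eqxx.
by rewrite big1 ?addr0// => j /andP[/negPf-> /negPf->].
Qed.

End field_outside.

Theorem theorem5 (R : realType) (Omega : set 'rV[R]_3)
    (Jm Bin Bm Bp : 'rV[R]_3 -> 'rV[R]_3)
    (hOmega : bounded_smooth_domain Omega)
    (hJm : forall i : 'I_3, vol_integrable Omega (fun y => Jm y 0 i))
    (hBm : curl_div_solution Omega Bm Jm)
    (hBm_cont : {within closure Omega, continuous Bm})
    (hBp : curl_div_solution (exterior Omega) Bp (fun=> 0))
    (hBp_cont : {within exterior Omega `|` boundary Omega, continuous Bp})
    (hBp_decay : exists C M : R, forall x, exterior Omega x ->
       M < enorm x -> enorm (Bp x) <= C * (enorm x)^-1)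
    (hjump : forall x, boundary Omega x -> Bm x - Bp x = Bin x)
    (hext : exists E : 'rV[R]_3 -> 'rV[R]_3,
       [/\ curl_div_solution Omega E (fun=> 0),
           {within closure Omega, continuous E}
         & forall x, boundary Omega x -> E x = Bin x]) :
  forall x, exterior Omega x ->
    differentiable (vector_potential Omega Jm) x /\
    Bp x = curl (vector_potential Omega Jm) x.
Proof.
move=> p pe.
have [oO _ _ bO sO] := hOmega.
have [E [hE hE_cont EB]] := hext.
have match_bd x : boundary Omega x -> Bm x - E x = Bp x.
  by move=> bx; rewrite EB// -hjump// opprB addrC subrK.
have [d d0 far] := exterior_dist pe.
have [dA gA] := vector_potential_differentiable oO hJm d0 far.
split; first exact: dA.
apply/rowP => k.
transitivity (vol_integral Omega (fun y => Jm y 0 (k + 2) * newton_grad p (k + 1) y) -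
            vol_integral Omega (fun y => Jm y 0 (k + 1) * newton_grad p (k + 2) y)); last first.
  rewrite [RHS]mxE; congr (_ - _); apply: esym; [exact: (gA (k + 1) (k + 2)) | exact: (gA (k + 2) (k + 1))].
have bGam : bounded_set (boundary Omega).
  have [L [_ OL]] := bO.
  exists (L + 1); split; first exact: num_real.
  move=> M LM x [cx _] /=; apply: le_trans (ltW LM).
  by apply: (closure_norm_le _ cx) => z Oz; apply: OL => //; rewrite ltrDl.
have [C C0 VC] := glued_decay oO bO hBm_cont hBp_cont hE_cont match_bd hBp_decay p.
have pi4 : 4 * pi != 0 :> R by rewrite gt_eqF// mulr_gt0 ?pi_gt0.
apply: (mulfI pi4); rewrite -(vorticity_sum oO hJm _ d0 far).
under eq_bigr do rewrite -vorticity_integral//.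
rewrite -(glued_out Bm Bp E pe).
refine (@newton_representation R (boundary Omega) (@closed_boundary _ _) bGam
  (boundary_graph oO sO) (fun k x => glued Omega Bm Bp E x 0 k) (dglued Omega Bm Bp E)
  _ _ _ (fun j k x => if `[< Omega x >] then vorticity Jm j k x else 0) _ _ p C C0 VC d d0 _ k).
- exact: (glued_continuous oO hBm_cont hBp_cont hE_cont match_bd).
- exact: (glued_derive oO hBm hBp hE).
- exact: (glued_div hBm hBp hE).
- exact: (glued_curl hBm hBp hE).
- by move=> j i; exact: vorticity_integrable.
- move=> j i y; case: ifPn => [/asboolP Oy _|_]; first exact: far.
  by rewrite eqxx.
Qed.
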